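(* Let $A_1,\ldots,A_M\in GL_2(\mathbb{R})$, let $\mu$ be a fully supported ergodic shift-invariant Borel probability measure on $\Sigma_M=\{1,\ldots,M\}^{\mathbb{N}}$, and let $n_0\ge1$ and $\varepsilon>0$. Suppose that the Lyapunov exponents $\lambda_1(\mu),\lambda_2(\mu)$, defined by $\lambda_i(\mu)=\lim_{n\to\infty}\frac1n\int\log\alpha_i(A(x,n))\,d\mu(x)$, are not equal to one another. Then there exist $n>n_0$ and a subset $\Gamma$ of $\{1,\ldots,M\}^n$ such that: (i) The cardinality of $\Gamma$ is at least $e^{n(h(\mu)-\varepsilon)}$. (ii) The matrices $\{A_{\mathtt{i}}:\mathtt{i}\in\Gamma\}$ strictly preserve a cone $\mathcal{C}$. (iii) For every $u\in\mathcal{C}$ and $\mathtt{i}\in\Gamma$ we have $\|A_{\mathtt{i}}u\|\ge e^{n(\lambda_1(\mu)-\varepsilon)}\|u\|$. In particular, the set of matrices $\{A_{\mathtt{i}}:\mathtt{i}\in\Gamma\}$ has lower spectral radius at least $e^{n(\lambda_1(\mu)-\varepsilon)}$. (iv) The set of matrices $\{A_{\mathtt{i}}:\mathtt{i}\in\Gamma\}$ has joint spectral radius at most $e^{n(\lambda_1(\mu)+\varepsilon)}$. (v) For every $\mathtt{i}\in\Gamma$, $e^{n(\lambda_1(\mu)+\lambda_2(\mu)-\varepsilon)}\le\det A_{\mathtt{i}}\le e^{n(\lambda_1(\mu)+\lambda_2(\mu)+\varepsilon)}$. In particular every $A_{\mathtt{i}}$ with $\mathtt{i}\in\Gamma$ has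 positive determinant. (vi) If $\{A_1,\ldots,A_M\}$ is strongly irreducible, then so is $\{A_{\mathtt{i}}:\mathtt{i}\in\Gamma\}$. (vii) If $\mathtt{k}\in\{1,\ldots,M\}^k$ where $1\le k\le n_0$, then $\mathtt{k}$ is a subword of every $\mathtt{i}\in\Gamma$.
   Context: For $x\in\Sigma_M$, $A(x,n)=A_{x_n}\cdots A_{x_1}$; for a word $\mathtt{i}=(i_1,\ldots,i_n)$, $A_{\mathtt{i}}=A_{i_n}\cdots A_{i_1}$. $\alpha_1\ge\alpha_2$ are the singular values, $\|\cdot\|$ the Euclidean (operator) norm, $h(\mu)$ the metric entropy of $\mu$ with respect to the left shift. Fully supported means every nonempty open set has positive measure. A subword is a block of consecutive letters. A cone is a convex, positively homogeneous subset of $\mathbb{R}^2\setminus\{0\}$, closed in $\mathbb{R}^2\setminus\{0\}$, with nonempty interior; a set of matrices strictly preserves a cone $\mathcal{C}$ if each of its elements maps $\mathcal{C}$ into the interior of $\mathcal{C}$. A set of matrices is strongly irreducible if its elements do not jointly preserve a finite nonempty union of one-dimensional subspaces. For a set $\mathsf{A}$ of $2\times2$ matrices, the joint spectral radius is $\inf_{m\ge1}\sup_{B_1,\ldots,B_m\in\mathsf{A}}\|B_1\cdots B_m\|^{1/m}$ and the lower spectral radius is $\inf_{m\ge1}\inf_{B_1,\ldots,B_m\in\mathsf{A}}\|B_1\cdots B_m\|^{1/m}$. *)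

(* Defs.v *)
From HB Require Import structures.
From mathcomp Require Import all_boot all_order all_algebra.
From mathcomp Require Import all_classical all_reals all_analysis.

Set Implicit Arguments.
Unset Strict Implicit.
Unset Printing Implicit Defensive.

Import Order.TTheory GRing.Theory Num.Theory.
Import numFieldNormedType.Exports.

Local Open Scope classical_set_scope.
Local Open Scope ring_scope.

(* The library norm on matrices is the maximum norm, hence these definitions. *)
Definition enorm (R : realType) (u : 'cV[R]_2) : R :=
  Num.sqrt (\sum_(i < 2) u i ord0 ^+ 2).

Definition opnorm (R : realType) (B : 'M[R]_2) : R :=
  sup [set enorm (B *m u) | u in [set u : 'cV[R]_2 | enorm u = 1]].

(* Singular values are the square roots of the eigenvalues of B^T B; for 2 x 2
   matrices the largest and the smallest one are all of them, and they coincide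
   when the eigenvalue is double. *)
Definition singular_values (R : realType) (B : 'M[R]_2) : set R :=
  [set Num.sqrt t | t in [set t : R | eigenvalue (B^T *m B) t]].

Definition alpha1 (R : realType) (B : 'M[R]_2) : R := sup (singular_values B).

Definition alpha2 (R : realType) (B : 'M[R]_2) : R := inf (singular_values B).

Definition is_cone (R : realType) (C : set 'cV[R]_2) : Prop :=
  [/\ forall (u v : 'cV[R]_2) (t : R), C u -> C v -> 0 <= t <= 1 ->
        C (t *: u + (1 - t) *: v),
      forall (u : 'cV[R]_2) (t : R), C u -> 0 < t -> C (t *: u),
      ~ C 0,
      (exists2 F : set 'cV[R]_2, closed F & C = F `&` ~` [set 0]) &
      C° !=set0].

Definition strictly_preserves (R : realType) (S : set 'M[R]_2)
    (C : set 'cV[R]_2) : Prop :=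
  forall B : 'M[R]_2, S B -> [set B *m u | u in C] `<=` C°.

Definition strongly_irreducible (R : realType) (S : set 'M[R]_2) : Prop :=
  ~ exists L : seq {vspace 'cV[R]_2},
      [/\ L != [::],
          (forall V, V \in L -> \dim V = 1%N) &
          forall B : 'M[R]_2, S B ->
            let U := [set u : 'cV[R]_2 | exists2 V, V \in L & u \in V] in
            [set B *m u | u in U] `<=` U].

(* The set of the numbers ||B_1 ... B_m||^(1/m) with B_1, ..., B_m in S. *)
Definition normalized_norms (R : realType) (S : set 'M[R]_2) (m : nat) :
    set (\bar R) :=
  [set ((opnorm (\prod_(i < m) B i)) `^ (m%:R^-1))%:E |
     B in [set B : 'I_m -> 'M[R]_2 | forall i, S (B i)]].

Definition joint_spectral_radius (R : realType) (S : set 'M[R]_2) : \bar R :=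
  ereal_inf [set ereal_sup (normalized_norms S m) | m in [set m | (1 <= m)%N]].

Definition lower_spectral_radius (R : realType) (S : set 'M[R]_2) : \bar R :=
  ereal_inf [set ereal_inf (normalized_norms S m) | m in [set m | (1 <= m)%N]].

(* The M.+1 letters are numbered from 0, and so are the coordinates: x_1 is
   x 0. A space with no letters would carry no probability measure. *)
Definition shift_space (M : nat) : Type :=
  {ptws nat -> discrete_topology 'I_M.+1}.

HB.instance Definition _ (M : nat) := Topological.on (shift_space M).
HB.instance Definition _ (M : nat) :=
  isPointed.Build (shift_space M) (fun=> ord0).

Definition borel_shift_space (M : nat) :=
  g_sigma_algebraType (@open (shift_space M)).

Definition left_shift (M : nat) (x : borel_shift_space M) :
    borel_shift_space M :=
  fun n => x n.+1.

Definition fully_supported (R : realType) (M : nat)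
    (mu : probability (borel_shift_space M) R) : Prop :=
  forall U : set (shift_space M), open U -> U !=set0 -> (0 < mu U)%E.

Definition invariant_measure (d : measure_display) (T : measurableType d)
    (R : realType) (f : T -> T) (mu : probability T R) : Prop :=
  forall B : set T, measurable B -> mu (f @^-1` B) = mu B.

Definition ergodic (d : measure_display) (T : measurableType d)
    (R : realType) (f : T -> T) (mu : probability T R) : Prop :=
  forall B : set T, measurable B -> f @^-1` B = B -> mu B = 0%E \/ mu B = 1%E.

(* Empty parts are allowed: they contribute 0 to the entropy. *)
Definition finite_partition (d : measure_display) (T : measurableType d)
    (k : nat) (P : 'I_k -> set T) : Prop :=
  [/\ forall j, measurable (P j),
      trivIset [set: 'I_k] P &
      \bigcup_j P j = [set: T]].

(* The cells of the join of P, f^-1 P, ..., f^-(n-1) P. *)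
Definition join_cell (T : Type) (f : T -> T) (k : nat) (P : 'I_k -> set T)
    (n : nat) (w : n.-tuple 'I_k) : set T :=
  [set x | forall i : 'I_n, P (tnth w i) (iter i f x)].

(* 0 * ln 0 = 0, since ln is 0 outside the positive reals. *)
Definition join_entropy (d : measure_display) (T : measurableType d)
    (R : realType) (f : T -> T) (mu : probability T R) (k : nat)
    (P : 'I_k -> set T) (n : nat) : R :=
  - \sum_(w : n.-tuple 'I_k)
      fine (mu (join_cell f P w)) * ln (fine (mu (join_cell f P w))).

Definition partition_entropy (d : measure_display) (T : measurableType d)
    (R : realType) (f : T -> T) (mu : probability T R) (k : nat)
    (P : 'I_k -> set T) : R :=
  limn (fun n : nat => n%:R^-1 * join_entropy f mu P n).

Definition metric_entropy (d : measure_display) (T : measurableType d)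
    (R : realType) (f : T -> T) (mu : probability T R) : \bar R :=
  ereal_sup [set h : \bar R | exists (k : nat) (P : 'I_k -> set T),
    finite_partition P /\ h = (partition_entropy f mu P)%:E].

(* A_i = A_{i_n} ... A_{i_1}: later letters multiply on the left. *)
Definition word_matrix (R : realType) (M : nat) (A : 'I_M.+1 -> 'M[R]_2)
    (w : seq 'I_M.+1) : 'M[R]_2 :=
  foldl (fun B j => A j *m B) 1%:M w.

Definition cocycle (R : realType) (M : nat) (A : 'I_M.+1 -> 'M[R]_2)
    (x : borel_shift_space M) (n : nat) : 'M[R]_2 :=
  word_matrix A (mkseq x n).

(* The exponent lambda_i is obtained with alpha := alpha_i. *)
Definition lyapunov (R : realType) (M : nat) (alpha : 'M[R]_2 -> R)
    (A : 'I_M.+1 -> 'M[R]_2) (mu : probability (borel_shift_space M) R) : R :=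
  limn (fun n : nat => n%:R^-1 * \int[mu]_x ln (alpha (cocycle A x n))).

(* Main.v *)
Require Import Defs.
From HB Require Import structures.
From mathcomp Require Import all_boot all_order all_algebra.
From mathcomp Require Import all_classical all_reals all_analysis.
From mathcomp Require Import measurable_realfun ring lra zify.

Set Implicit Arguments.
Unset Strict Implicit.
Unset Printing Implicit Defensive.

Import Order.TTheory GRing.Theory Num.Theory.
Import numFieldNormedType.Exports.

Local Open Scope classical_set_scope.
Local Open Scope ring_scope.

(** Write l1, l2 for the exponents and D for l1 + l2, so that D < 2 l1. The
    matrix of a long typical word of length N has norm about exp (N l1) and
    determinant about exp (N D), up to sign. The proof finds, inside each such
    word, a subword that preserves a cone, keeps nearly the whole length N, and
    is one of many such subwords with the same cone.

    Subwords. The logarithm F of the norm is subadditive. Typically F of the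
    whole orbit is about N l1 while its windows of length l have F equal to
    about l l1 on average; the sum over all positions of the norm lost when a
    window is split off telescopes, so that few positions lose much
    ([sum_loss_at_end], [sum_loss_at_start]). Since D < 2 l1, most windows
    have determinants far smaller than their squared norms and hence contract
    one direction strongly. By pigeonhole ([common_state]) such a window b
    occurs near the beginning and again near the end without much loss at
    either place. The word between the two occurrences starts with b and is
    followed by b; having lost little, it neither is contracted by b nor ends
    in the direction that b contracts, so that in coordinates adapted to b it
    is dominated by one entry ([aligned_block_dominated]). It then maps a cone
    that depends on b only into its interior, up to sign, and expands it by
    nearly its norm ([dominated_entry_cone], [typical_orbit_cone_word]).

    Number. A set of words of length N whose cylinders have nearly full
    measure has at least exp (N (h - e)) elements ([entropy_count]). What is
    cut off from a typical word is a negligible number of letters, so that by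
    pigeonhole exponentially many of the subwords have the same length n and
    the same b ([many_cone_words]). The only probabilistic input is that a
    subadditive process with means at least N l1 is at least N (l1 - d) with
    probability tending to one ([subadditive_process_lower_bound]); it is
    applied to the norm, to averages over windows, to determinants, and to
    frequencies of words.

    The family. Take from these subwords a family on which the sign of the
    determinant and the sign of the action on the cone are constant. Products
    of an even number of them have positive determinant and preserve the cone.
    Let Gamma be the set of all words of length 2 n m that satisfy the
    required bounds ([admissible_word]), with m large. It contains all products
    of 2 m words of the family, which gives the cardinality, and also products
    that contain a bounded number of other letters
    ([padded_products_admissible]). Put h = w0 w0 with w0 in the family; its
    matrix has two real eigenlines with distinct positive eigenvalues. A
    finite union of lines that Gamma preserves consists of eigenlines of h. If
    the matrices A_i are strongly irreducible, some word c moves an eigenline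
    off both of them ([escaping_words]); for large p the word
    h^p c h^p c h^p acts on the cone like the projection to the larger
    eigenvalue ([dominated_products]), so that it occurs as padding in Gamma,
    and no such union is preserved ([hyperbolic_strongly_irreducible]). *)


(** * Probabilities as real numbers *)

(** Real valued, so that linear arithmetic applies to probabilities. *)
Definition prob (d : measure_display) (T : measurableType d) (R : realType)
  (mu : probability T R) (B : set T) : R := fine (mu B).

Section Prob.
Context (d : measure_display) (T : measurableType d) (R : realType).
Variable mu : probability T R.
Notation pr := (prob mu).

Lemma probE (B : set T) : measurable B -> mu B = (pr B)%:E.
Proof. by move=> mB; rewrite fineK// fin_num_measure. Qed.

Lemma prob_ge0 (B : set T) : 0 <= pr B.
Proof. exact: fine_ge0. Qed.

Lemma prob_le (A B : set T) : measurable A -> measurable B -> A `<=` B ->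
  pr A <= pr B.
Proof.
move=> mA mB AB; rewrite -lee_fin -!probE//.
by apply: le_measure => //; rewrite inE.
Qed.

Lemma probT : pr [set: T] = 1.
Proof. by rewrite /prob (@probability_setT _ _ _ mu). Qed.

Lemma prob0 : pr set0 = 0.
Proof. by rewrite /prob measure0. Qed.

Lemma probC (B : set T) : measurable B -> pr (~` B) = 1 - pr B.
Proof.
move=> mB; have mC : measurable (~` B) by exact: measurableC.
apply: EFin_inj; rewrite -probE// EFinB -probE//.
exact: probability_setC.
Qed.

Lemma probU (A B : set T) : measurable A -> measurable B ->
  pr (A `|` B) <= pr A + pr B.
Proof.
move=> mA mB; rewrite -lee_fin EFinD -!probE//; last exact: measurableU.
exact: measureU2.
Qed.

Lemma prob_setI (A B : set T) (a b : R) : measurable A -> measurable B ->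
  1 - a <= pr A -> 1 - b <= pr B -> 1 - (a + b) <= pr (A `&` B).
Proof.
move=> mA mB pA pB.
have mI : measurable (A `&` B) by exact: measurableI.
have := probU (measurableC mA) (measurableC mB).
rewrite -setCI !probC//; lra.
Qed.

Lemma prob_bigcap (I : choiceType) (s : seq I) (B : I -> set T) (e : R) :
  (forall i, measurable (B i)) -> (forall i, i \in s -> 1 - e <= pr (B i)) ->
  1 - (size s)%:R * e <= pr [set x | forall i, i \in s -> B i x].
Proof.
move=> mB; elim: s => [|i s IH] hs.
  rewrite (_ : [set _ | _] = setT) ?probT ?mul0r ?subr0//.
  by apply/seteqP; split => x //= _ i.
rewrite (_ : [set _ | _] = B i `&` [set x | forall j, j \in s -> B j x]).
  have -> : (size (i :: s))%:R * e = e + (size s)%:R * e.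
    by rewrite /= mulrS mulrDl mul1r.
  apply: prob_setI => //.
  - rewrite (_ : [set _ | _] = \bigcap_(j in [set` s]) B j).
      by apply: fin_bigcap_measurable.
    by apply/seteqP; split.
  - by apply: hs; rewrite inE eqxx.
  - by apply: IH => j js; apply: hs; rewrite inE js orbT.
apply/seteqP; split => x /= => [h|[h1 h2] j].
  split; first by apply: h; rewrite inE eqxx.
  by move=> j js; apply: h; rewrite inE js orbT.
by rewrite inE => /orP[/eqP->//|]; exact: h2.
Qed.

Lemma prob_nondecreasing (F : nat -> set T) (e : R) :
  (forall i, measurable (F i)) -> (forall i j, (i <= j)%N -> F i `<=` F j) ->
  pr (\bigcup_i F i) = 1 -> 0 < e -> exists n, 1 - e < pr (F n).
Proof.
move=> mF ndF F1 e0.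
have mU : measurable (\bigcup_i F i) by exact: bigcup_measurable.
have hF : {homo F : n m / (n <= m)%N >-> (n <= m)%O}.
  by move=> n m nm; apply/subsetPset; exact: ndF.
have : (mu \o F) x @[x --> \oo] --> mu (\bigcup_n F n).
  exact: nondecreasing_cvg_mu.
rewrite (probE mU) F1 => /fine_cvgP[_] /cvgrPdist_lt /(_ _ e0)[n _] /(_ n).
move=> /(_ (leqnn n)) /=; rewrite ltr_norml => /andP[_ h].
by exists n; rewrite /prob; lra.
Qed.

Lemma prob_nonincreasing0 (F : nat -> set T) (e : R) :
  (forall i, measurable (F i)) -> (forall i j, (i <= j)%N -> F j `<=` F i) ->
  pr (\bigcap_i F i) = 0 -> 0 < e -> exists n, pr (F n) < e.
Proof.
move=> mF niF F0 e0.
have mC i : measurable (~` F i) by exact: measurableC.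
have [||n] := @prob_nondecreasing (fun i => ~` F i) e mC _ _ e0.
- by move=> i j ij; apply: subsetC; exact: niF.
- by rewrite -setC_bigcap probC ?F0 ?subr0//; exact: bigcap_measurableType.
- by move=> h; exists n; move: h; rewrite probC//; lra.
Qed.

Lemma bounded_integrable (g : T -> R) (K : R) : measurable_fun setT g ->
  (forall x, `|g x| <= K) -> mu.-integrable setT (EFin \o g).
Proof.
move=> mg gK; apply: measurable_bounded_integrable => //.
  exact: le_lt_trans (probability_le1 mu measurableT) (ltry 1).
exists K; split; first exact: num_real.
by move=> M KM x _; apply: le_trans (gK x) (ltW KM).
Qed.

Lemma Rintegral_sum (I : Type) (s : seq I) (g : I -> T -> R) (K : I -> R) :
  (forall i, measurable_fun setT (g i)) -> (forall i x, `|g i x| <= K i) ->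
  \int[mu]_x (\sum_(i <- s) g i x) = \sum_(i <- s) \int[mu]_x g i x.
Proof.
move=> mg gK; elim: s => [|i s IH].
  rewrite big_nil -[RHS](mul0r (fine (mu setT))) -Rintegral_cst//.
  by congr Rintegral; apply/funext => x; rewrite big_nil.
rewrite big_cons -IH -RintegralD//.
- by congr Rintegral; apply/funext => x; rewrite big_cons.
- exact: bounded_integrable (gK i).
- apply: (@bounded_integrable _ (\sum_(i <- s) K i)).
    exact: measurable_sum.
  by move=> x; apply: le_trans (ler_norm_sum _ _ _) _; apply: ler_sum.
Qed.

Lemma Rintegral_indic (B : set T) : measurable B -> \int[mu]_x \1_B x = pr B.
Proof. by move=> mB; rewrite /Rintegral integral_indic// setIT. Qed.

Lemma Rintegral_cstT (c : R) : \int[mu]_x c = c.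
Proof. by rewrite Rintegral_cst// -[fine _]/(pr setT) probT mulr1. Qed.

End Prob.

(** * A lower bound for subadditive processes over an ergodic map *)

Section Ergodic.
Context (d : measure_display) (T : measurableType d) (R : realType).
Variables (mu : probability T R) (f : T -> T).
Hypotheses (mf : measurable_fun setT f) (inv : invariant_measure f mu)
  (erg : ergodic f mu).
Notation pr := (prob mu).

Lemma measurable_iter n : measurable_fun setT (iter n f).
Proof.
by elim: n => [|n IH]; [exact: measurable_id|exact: measurableT_comp].
Qed.

Lemma measurable_preimage_iter n (B : set T) : measurable B ->
  measurable (iter n f @^-1` B).
Proof. by move=> mB; rewrite -[X in measurable X]setTI; exact: measurable_iter. Qed.

Lemma prob_preimage_iter n (B : set T) : measurable B ->
  pr (iter n f @^-1` B) = pr B.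
Proof.
move=> mB; elim: n => [//|n IH].
rewrite -IH /prob -(inv (measurable_preimage_iter n mB)); congr (fine (mu _)).
by apply/seteqP; split => x /=; rewrite -iterSr.
Qed.

Section SubadditiveProcess.
Variables (g : nat -> T -> R) (C lam : R).
Hypothesis mg : forall n, measurable_fun setT (g n).
Hypothesis subg : forall m n x, g (m + n)%N x <= g m x + g n (iter m f x).
Hypothesis g0 : forall x, `|g 0%N x| <= C.
Hypothesis gS : forall n x, `|g n.+1 x - g n (f x)| <= C.
Hypothesis lam_le : forall n, n%:R * lam <= \int[mu]_x g n x.

Let C_ge0 (x : T) : 0 <= C.
Proof. exact: le_trans (normr_ge0 _) (g0 x). Qed.

Lemma subadditive_process_bound n x : `|g n x| <= C * n.+1%:R.
Proof.
elim: n x => [|n IH] x; first by rewrite mulr1.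
have := gS n x; have := IH (f x); rewrite -[in n.+2%:R]addn1 natrD mulrDr mulr1.
rewrite !ler_norml; lra.
Qed.

Section Covering.
Variables (del : R) (N : nat).

(** The points whose process stays above the line of slope [lam - del] up to
    time [N]. *)
Let no_drop : set T :=
  [set x | forall n, (1 <= n <= N)%N -> n%:R * (lam - del) < g n x].

Lemma measurable_gt_lin n (a : R) : measurable [set x | a < g n x].
Proof.
rewrite (_ : [set _ | _] = setT `&` (g n @^-1` `]a, +oo[%classic)).
  exact: mg.
by apply/seteqP; split => y /=; rewrite in_itv/= andbT// => -[].
Qed.

Lemma measurable_no_drop : measurable no_drop.
Proof.
rewrite /no_drop (_ : [set _ | _] = \bigcap_(n in [set n | (1 <= n <= N)%N])
   [set x | n%:R * (lam - del) < g n x]); last by apply/seteqP; split.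
by apply: bigcap_measurableType => n _; exact: measurable_gt_lin.
Qed.

Let K := 2 * C + `|lam - del|.

(** Cut the orbit from the left: outside [no_drop] remove a time interval over
    which [g] is small, inside remove a single step at cost [K]. At most [N]
    steps remain when this stops. *)
Lemma greedy_covering L x : g L x <= L%:R * (lam - del) +
  K * \sum_(i < L) \1_no_drop (iter i f x) + K * N.+1%:R.
Proof.
have C0 := C_ge0 x.
have K0 : 0 <= K by rewrite /K addr_ge0// mulr_ge0.
have ind0 (B : set T) y : 0 <= (\1_B y : R) by rewrite indicE.
have [k] : exists k, (L <= k)%N by exists L.
elim: k x L => [|k IH] x L.
  rewrite leqn0 => /eqP ->; rewrite big_ord0 mul0r mulr0 !add0r.
  apply: le_trans (ler_norm _) _; apply: le_trans (g0 x) _.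
  have : K * 1 <= K * N.+1%:R by rewrite ler_wpM2l// ler1n.
  have := normr_ge0 (lam - del); rewrite /K; lra.
move=> Lk; case: (leqP L N) => LN.
  have h1 := le_trans (ler_norm _) (subadditive_process_bound L x).
  have h2 : (L.+1%:R : R) <= N.+1%:R by rewrite ler_nat.
  have h3 : (L%:R : R) <= L.+1%:R by rewrite ler_nat.
  have h4 : - (L%:R * `|lam - del|) <= L%:R * (lam - del).
    by rewrite -mulrN ler_wpM2l// lerNl ler_normr lexx orbT.
  have h5 : L.+1%:R * K <= N.+1%:R * K by rewrite ler_wpM2r.
  have h6 : L%:R * `|lam - del| <= L.+1%:R * `|lam - del|.
    by rewrite ler_wpM2r.
  have h7 : 0 <= C * L.+1%:R by rewrite mulr_ge0.
  have h8 : 0 <= K * \sum_(i < L) \1_no_drop (iter i f x).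
    by rewrite mulr_ge0// sumr_ge0.
  move: h5 h8; rewrite {1}/K [K * N.+1%:R]mulrC; lra.
have step n : (1 <= n <= L)%N ->
   g n x <= n%:R * (lam - del) + K * \sum_(i < n) \1_no_drop (iter i f x) ->
   g L x <= L%:R * (lam - del) +
     K * \sum_(i < L) \1_no_drop (iter i f x) + K * N.+1%:R.
  move=> /andP[n1 nL] hn; have LE : L = (n + (L - n))%N by rewrite subnKC.
  have := subg n (L - n) x; rewrite -LE => /le_trans; apply.
  have LnK : (L - n <= k)%N by lia.
  have := IH (iter n f x) (L - n)%N LnK.
  rewrite [in X in _ -> _ <= X]LE natrD big_split_ord/=.
  under [X in _ -> _ <= _ + _ * (_ + X) + _]eq_bigr do rewrite addnC iterD.
  move: hn; set s1 := \sum_(i < n) _; set s2 := \sum_(i < L - n) _; lra.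
have [hx|] := pselect (no_drop x).
  apply: (step 1%N); first by lia.
  have := subadditive_process_bound 1 x; rewrite ler_norml => /andP[_].
  rewrite big_ord1 /= indicE mem_set//= !mulr1 mul1r.
  have : - `|lam - del| <= lam - del by rewrite lerNl ler_normr lexx orbT.
  rewrite /K; lra.
move=> /existsNP[n /not_implyP[nN /negP]]; rewrite -leNgt => hn.
apply: (step n); first by lia.
apply: le_trans hn _; rewrite lerDl mulr_ge0// sumr_ge0//.
Qed.

(** The integral of the covering bound over a long orbit would otherwise be
    smaller than the assumed means. *)
Lemma prob_no_drop : del <= K * pr no_drop.
Proof.
have [x0 _] : [set: T] !=set0.
  apply/set0P/eqP => T0; have := probT mu; rewrite T0 prob0.
  by move/eqP; rewrite eq_sym oner_eq0.
have K0 : 0 <= K by rewrite /K addr_ge0// mulr_ge0// (C_ge0 x0).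
have mS := measurable_no_drop.
rewrite leNgt; apply/negP => lt_del.
set c := del - K * pr no_drop.
have c0 : 0 < c by rewrite subr_gt0.
(* long enough for the gain [c] per step to exceed the boundary term *)
pose L := Num.bound (K * N.+1%:R / c).
have hL : K * N.+1%:R < L%:R * c.
  rewrite -ltr_pdivrMr//; apply: le_lt_trans (ler_norm _) _.
  by rewrite ger0_norm ?archi_boundP// divr_ge0 ?mulr_ge0// ltW.
pose h i x : R := \1_no_drop (iter i f x).
have mh i : measurable_fun setT (h i).
  rewrite (_ : h i = \1_(iter i f @^-1` no_drop)).
    exact/measurable_indic/measurable_preimage_iter.
  by apply/funext => x; rewrite /h !indicE.
have hb i x : `|h i x| <= 1.
  by rewrite /h indicE; case: (_ \in _); rewrite ?normr1 ?normr0.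
have Ih i : \int[mu]_x h i x = pr no_drop.
  rewrite -(prob_preimage_iter i mS) -Rintegral_indic.
    by congr Rintegral; apply/funext => x; rewrite /h !indicE.
  exact: measurable_preimage_iter.
have hle : \int[mu]_x g L x <= \int[mu]_x
    (L%:R * (lam - del) + K * N.+1%:R + \sum_(i < L) K * h i x).
  apply: le_Rintegral => //.
  - exact: bounded_integrable (subadditive_process_bound L).
  - apply: (@bounded_integrable _ _ _ _ _
      (`|L%:R * (lam - del) + K * N.+1%:R| + \sum_(i < L) K)).
      apply: measurable_funD => //; apply: measurable_sum => i.
      exact: measurable_funM.
    move=> x; apply: le_trans (ler_normD _ _) _; rewrite lerD2l.
    apply: le_trans (ler_norm_sum _ _ _) _; apply: ler_sum => i _.
    by rewrite normrM ger0_norm// -[leRHS]mulr1 ler_wpM2l.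
  - by move=> x _; have := greedy_covering L x; rewrite mulr_sumr; lra.
have := le_trans (lam_le L) hle; rewrite RintegralD//; first last.
- apply: (@bounded_integrable _ _ _ _ _ (\sum_(i < L) K)).
    by apply: measurable_sum => i; exact: measurable_funM.
  move=> x; apply: le_trans (ler_norm_sum _ _ _) _; apply: ler_sum => i _.
  by rewrite normrM ger0_norm// -[leRHS]mulr1 ler_wpM2l.
- exact: (@bounded_integrable _ _ _ _ _ `|L%:R * (lam - del) + K * N.+1%:R|).
rewrite Rintegral_cstT (@Rintegral_sum _ _ _ _ _ _ _ (fun=> K)); first last.
- by move=> i x; rewrite normrM ger0_norm// -[leRHS]mulr1 ler_wpM2l.
- by move=> i; exact: measurable_funM.
under eq_bigr => i _.
  rewrite RintegralZl//; last exact: bounded_integrable (hb i).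
  rewrite Ih; over.
rewrite sumr_const card_ord -mulr_natl.
by move: hL; rewrite /c; lra.
Qed.

End Covering.

(** The union is invariant because [g n.+1 x] and [g n (f x)] differ by a
    bounded amount. If it were null, almost every point would leave [no_drop]
    as the time [N] grows, against the previous bound. *)
Lemma subadditive_process_tempered (del : R) : 0 < del ->
  pr (\bigcup_K [set x | forall n, n%:R * (lam - del) - K%:R < g n x]) = 1.
Proof.
move=> del0; set U := \bigcup_K _.
have mU : measurable U.
  apply: bigcup_measurable => K _.
  rewrite (_ : [set _ | _] =
    \bigcap_n [set x | n%:R * (lam - del) - K%:R < g n x]).
    by apply: bigcap_measurableType => n _; exact: measurable_gt_lin.
  by apply/seteqP; split => x h n; [move=> _; exact: h|exact: (h n I)].
have invU : f @^-1` U = U.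
  apply/seteqP; split => x [K _ /= hK].
    have [K' hK'] : exists K' : nat, K%:R + C + `|lam - del| < K'%:R.
      exists (Num.bound (K%:R + C + `|lam - del|)).
      by apply: archi_boundP; rewrite !addr_ge0// (C_ge0 x).
    exists K' => //= -[|n].
      have := g0 x; have := normr_ge0 (lam - del); rewrite mul0r ler_norml.
      have : 0 <= K%:R :> R by []. lra.
    have := hK n; have := gS n x; have := ler_norm (lam - del).
    rewrite ler_norml [n.+1%:R]mulrS mulrDl mul1r; lra.
  have [K' hK'] : exists K' : nat, K%:R + C + `|lam - del| < K'%:R.
    exists (Num.bound (K%:R + C + `|lam - del|)).
    by apply: archi_boundP; rewrite !addr_ge0// (C_ge0 x).
  exists K' => //= n.
  have := hK n.+1; have := gS n x.
  have : - `|lam - del| <= lam - del by rewrite lerNl ler_normr lexx orbT.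
  rewrite ler_norml [n.+1%:R]mulrS mulrDl mul1r; lra.
have [mu0|mu1] := erg mU invU; last by rewrite /prob mu1.
pose S N : set T := [set x | forall n, (1 <= n <= N)%N -> n%:R * (lam - del) < g n x].
have [x0 _] : [set: T] !=set0.
  apply/set0P/eqP => T0; have := probT mu; rewrite T0 prob0.
  by move/eqP; rewrite eq_sym oner_eq0.
pose K := 2 * C + `|lam - del|.
have K0 : 0 <= K by rewrite /K addr_ge0// mulr_ge0// (C_ge0 x0).
have [|||N hN] := @prob_nonincreasing0 _ _ _ mu S (del / (K + 1))
    (measurable_no_drop del).
- by move=> i j ij x hx n ?; apply: hx; lia.
- apply/eqP; rewrite eq_le prob_ge0 andbT.
  have -> : 0 = pr U by rewrite /prob mu0.
  apply: prob_le => //.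
    apply: bigcap_measurableType => n _; exact: (measurable_no_drop del n).
  move=> x hx; exists (Num.bound C) => //= -[|n].
    have := g0 x; have := @archi_boundP _ C (C_ge0 x0).
    by rewrite mul0r ler_norml; lra.
  have := hx n.+1 I n.+1 (andb_true_intro (conj (ltn0Sn n) (leqnn _))).
  have : 0 <= (Num.bound C)%:R :> R by []. lra.
- by rewrite divr_gt0// ltr_wpDl.
have := prob_no_drop del N; rewrite -/(S N) -/K => h.
suff : K * pr (S N) < del by lra.
rewrite ltr_pdivlMr ?ltr_wpDl// in hN; apply: le_lt_trans hN.
by rewrite mulrDr mulr1 mulrC lerDl prob_ge0.
Qed.

(** The lower half of Kingman's theorem, in probability. Applied to the
    negatives of additive processes it also gives upper bounds. *)
Lemma subadditive_process_lower_bound (del e : R) : 0 < del -> 0 < e ->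
  exists N0, forall N, (N0 <= N)%N ->
    1 - e <= pr [set x | N%:R * (lam - del) <= g N x].
Proof.
move=> del0 e0; have del20 : 0 < del / 2 by rewrite divr_gt0.
have mF K : measurable [set x | forall n, n%:R * (lam - del / 2) - K%:R < g n x].
  rewrite (_ : [set _ | _] =
    \bigcap_n [set x | n%:R * (lam - del / 2) - K%:R < g n x]).
    by apply: bigcap_measurableType => n _; exact: measurable_gt_lin.
  by apply/seteqP; split => x h n; [move=> _; exact: h|exact: (h n I)].
have [|K hK] := prob_nondecreasing mF _ (subadditive_process_tempered del20) e0.
  move=> i j ij x /= hx n; have := hx n.
  have : i%:R <= j%:R :> R by rewrite ler_nat.
  lra.
exists (Num.bound (K%:R / (del / 2))) => N hN.
apply: le_trans (ltW hK) _; apply: prob_le => //.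
  rewrite (_ : [set _ | _] = setT `&` (g N @^-1` `[N%:R * (lam - del), +oo[%classic)).
    exact: mg.
  by apply/seteqP; split => y /=; rewrite in_itv/= andbT// => -[].
move=> x /= /(_ N) h; apply/ltW/(le_lt_trans _ h).
have : K%:R / (del / 2) < N%:R.
  by apply: lt_le_trans (archi_boundP _) _; rewrite ?ler_nat// divr_ge0// ltW.
by rewrite ltr_pdivrMr//; lra.
Qed.

End SubadditiveProcess.

Lemma visits_markov (B : set T) N (t : R) : measurable B -> 0 <= t ->
  t * pr [set x | t < \sum_(i < N) \1_B (iter i f x)] <= N%:R * pr B.
Proof.
move=> mB t0.
pose h i x : R := \1_B (iter i f x).
have mh i : measurable_fun setT (h i).
  rewrite (_ : h i = \1_(iter i f @^-1` B)).
    exact/measurable_indic/measurable_preimage_iter.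
  by apply/funext => x; rewrite /h !indicE.
have hb i x : `|h i x| <= 1.
  by rewrite /h indicE; case: (_ \in _); rewrite ?normr1 ?normr0.
have Ih i : \int[mu]_x h i x = pr B.
  rewrite -(prob_preimage_iter i mB) -Rintegral_indic.
    by congr Rintegral; apply/funext => x; rewrite /h !indicE.
  exact: measurable_preimage_iter.
have mS : measurable_fun setT (fun x => \sum_(i < N) h i x).
  by apply: measurable_sum => i; exact: mh.
set D := [set x | _].
have mD : measurable D.
  rewrite (_ : D = setT `&` ((fun x => \sum_(i < N) h i x) @^-1` `]t, +oo[%classic)).
    exact: mS.
  by apply/seteqP; split => y /=; rewrite in_itv/= andbT// => -[].
have -> : N%:R * pr B = \int[mu]_x (\sum_(i < N) h i x).
  rewrite (@Rintegral_sum _ _ _ _ _ _ _ (fun=> 1))//.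
  under eq_bigr do rewrite Ih.
  by rewrite sumr_const card_ord mulr_natl.
rewrite -Rintegral_indic// -RintegralZl//; last first.
  apply: (@bounded_integrable _ _ _ _ _ 1); first exact: measurable_indic.
  by move=> x; rewrite indicE; case: (_ \in _); rewrite ?normr1 ?normr0.
apply: le_Rintegral => //.
- apply: (@bounded_integrable _ _ _ _ _ t).
    by apply: measurable_funM => //; exact: measurable_indic.
  move=> x; rewrite indicE; case: (_ \in _); rewrite ?mulr1 ?mulr0 ?normr0//.
  by rewrite ger0_norm.
- apply: (@bounded_integrable _ _ _ _ _ (\sum_(i < N) 1)) => // x.
  by apply: le_trans (ler_norm_sum _ _ _) _; apply: ler_sum.
move=> x _; rewrite indicE; have [xD|xD] := boolP (x \in D).
  by rewrite mulr1; move: xD; rewrite inE => /ltW.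
by rewrite mulr0 sumr_ge0// => i _; rewrite /h indicE.
Qed.

End Ergodic.

Lemma prob_finite_sum (d : measure_display) (T : measurableType d) (R : realType)
    (mu : probability T R) (W : finType) (N : T -> W) (F : {set W}) :
  (forall w, measurable [set x | N x = w]) ->
  prob mu [set x | N x \in F] = \sum_(w in F) prob mu [set x | N x = w].
Proof.
move=> mN.
have mF : measurable [set x | N x \in F].
  rewrite (_ : [set _ | _] = \bigcup_(w in [set w | w \in F]) [set x | N x = w]).
    by apply: fin_bigcup_measurable => //; exact: finite_finset.
  by apply/seteqP; split => [x xF|x [w wF /= ->]//]; exists (N x).
under eq_bigr do rewrite -Rintegral_indic//.
rewrite -Rintegral_indic// -big_enum.
rewrite -(@Rintegral_sum _ _ _ _ _ _ _ (fun=> 1)).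
- congr Rintegral; apply/funext => x; rewrite big_enum /= indicE.
  have [xF|xF] := boolP (N x \in F).
    rewrite (mem_set (xF : [set x | N x \in F] x)) (bigD1 (N x))//=.
    rewrite indicE mem_set//= big1 ?addr0// => w /andP[_ wx].
    by rewrite indicE memNset//= => /esym/eqP; rewrite (negbTE wx).
  rewrite memNset /=; last exact/negP.
  rewrite big1// => w wF; rewrite indicE memNset//= => xw.
  by move: xF; rewrite xw wF.
- by move=> w; exact: measurable_indic.
- by move=> w x; rewrite indicE; case: (_ \in _); rewrite ?normr1 ?normr0.
Qed.

(** * Prefixes and cylinders in the shift space *)

Section ShiftSpace.
Variable M : nat.
Notation letter := 'I_M.+1.
Notation X := (borel_shift_space M).

Lemma iter_left_shift (x : X) i n : iter i (@left_shift M) x n = x (i + n)%N.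
Proof. by elim: i n => [//|i IH] n; rewrite iterS /left_shift IH addnS. Qed.

Definition prefix_word (x : X) n : n.-tuple letter := [tuple x i | i < n].

Lemma val_prefix_word x n : val (prefix_word x n) = mkseq x n.
Proof. by rewrite /mkseq -val_enum_ord -map_comp. Qed.

Lemma eq_prefix_word (x y : X) n :
  prefix_word x n = prefix_word y n <-> forall i, (i < n)%N -> x i = y i.
Proof.
split=> [h i ni|h]; last by apply: eq_from_tnth => i; rewrite !tnth_mktuple h.
by have := congr1 (fun t => tnth t (Ordinal ni)) h; rewrite !tnth_mktuple.
Qed.

Lemma cvg_coordinatewise (x : shift_space M) (y : nat -> shift_space M) :
  (forall n i, (i < n)%N -> y n i = x i) -> y n @[n --> \oo] --> x.
Proof.
move=> yx; apply/cvg_sup => i; apply/cvg_image.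
  by apply/seteqP; split => a //= _; exists (fun=> a).
move=> B /= hB; exists (proj i @^-1` B).
  by exists i.+1 => // n /= hn; rewrite /proj yx//; exact: nbhs_singleton hB.
by apply/seteqP; split => [_ [z hz <-]//|a Ba]; exists (fun=> a).
Qed.

Lemma open_contains_cylinder (U : set (shift_space M)) (x : shift_space M) :
  open U -> U x -> exists n, forall y : shift_space M,
    (forall i, (i < n)%N -> y i = x i) -> U y.
Proof.
move=> oU Ux; apply: contrapT => /forallNP h.
have {}h n : exists y : shift_space M, (forall i, (i < n)%N -> y i = x i) /\ ~ U y.
  by have /existsNP[y /not_implyP ?] := h n; exists y.
have [y hy] := choice h.
have /(_ U) : y n @[n --> \oo] --> x.
  by apply: cvg_coordinatewise => n; exact: (hy n).1.
have nU : nbhs x U by exact: open_nbhs_nbhs.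
by move=> /(_ nU)[n _ /(_ n (leqnn n))]; exact: (hy n).2.
Qed.

Lemma open_coordinate i (a : letter) : open [set x : shift_space M | x i = a].
Proof.
rewrite (_ : [set _ | _] = proj i @^-1` [set a]); last by apply/seteqP; split.
apply: open_comp; last exact: discrete_open.
by move=> x _; exact: proj_continuous.
Qed.

Lemma measurable_prefix n (S : set (n.-tuple letter)) :
  measurable [set x : X | S (prefix_word x n)].
Proof.
rewrite (_ : [set _ | _] = \bigcup_(w in S) [set x : X | prefix_word x n = w]).
  apply: fin_bigcup_measurable => [|w _]; first exact: finite_finset.
  rewrite (_ : [set _ | _] =
    \bigcap_(i in [set: 'I_n]) [set x : X | x (val i) = tnth w i]).
    apply: fin_bigcap_measurable => // i _; apply: sub_gen_smallest.
    exact: open_coordinate.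
  apply/seteqP; split => [x /= <- i _|x h]; first by rewrite tnth_mktuple.
  by apply: eq_from_tnth => i; rewrite tnth_mktuple; exact: h.
by apply/seteqP; split => [x hx|x [w Sw /= ->]//]; exists (prefix_word x n).
Qed.

Lemma measurable_dep n (B : set X) :
  (forall x y : X, prefix_word x n = prefix_word y n -> B x -> B y) ->
  measurable B.
Proof.
move=> hB; rewrite (_ : B = [set x | [set w | exists2 y, B y & prefix_word y n = w]
  (prefix_word x n)]); first exact: measurable_prefix.
by apply/seteqP; split => [x Bx|x [y By /hB]]; [exists x|exact].
Qed.

Lemma measurable_fun_dep d' (Y : measurableType d') n (g : X -> Y) :
  (forall x y : X, prefix_word x n = prefix_word y n -> g x = g y) ->
  measurable_fun setT g.
Proof.
move=> hg _ B mB; rewrite setTI; apply: (@measurable_dep n) => x y xy.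
by rewrite /= (hg _ _ xy).
Qed.

Lemma bigcup_cylinders (U : set X) : open (U : set (shift_space M)) ->
  U = \bigcup_n [set x : X | forall y : X,
        prefix_word y n = prefix_word x n -> U y].
Proof.
move=> oU; apply/seteqP; split => [x Ux|x [n _ /=]]; last exact.
have [n hn] := open_contains_cylinder oU Ux.
by exists n => // y /eq_prefix_word /hn.
Qed.

Lemma measurable_left_shift : measurable_fun setT (@left_shift M).
Proof.
apply: (@measurability _ _ X X setT (@left_shift M) (@open (shift_space M))) => //.
move=> _ [U oU <-]; rewrite setTI (bigcup_cylinders oU) preimage_bigcup.
apply: bigcup_measurable => n _; apply: (@measurable_dep n.+1) => x y xy h z hz.
apply: h; rewrite hz; apply/eq_prefix_word => i ni; rewrite /left_shift.
by move/eq_prefix_word : xy => ->.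
Qed.

(** The sets with this property form a sigma-algebra that contains the open
    sets. *)
Lemma cylinder_approximation (R : realType) (mu : probability X R) (B : set X)
    (e : R) : measurable B -> 0 < e ->
  exists n (S : set (n.-tuple letter)),
    prob mu ((B `\` [set x | S (prefix_word x n)]) `|`
             ([set x | S (prefix_word x n)] `\` B)) < e.
Proof.
move=> mB e0.
pose sd (A D : set X) := (A `\` D) `|` (D `\` A).
have msd A D : measurable A -> measurable D -> measurable (sd A D).
  by move=> mA mD; apply: measurableU; exact: measurableD.
pose G : set (set X) := [set A | measurable A /\ forall e : R, 0 < e ->
  exists n (S : set (n.-tuple letter)),
    prob mu (sd A [set x | S (prefix_word x n)]) < e].
suff : G B by move=> [_ /(_ e e0)].
have cylG n (S : set (n.-tuple letter)) : G [set x | S (prefix_word x n)].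
  split; first exact: measurable_prefix.
  by move=> e' e'0; exists n, S; rewrite /sd !setDv setU0 prob0.
have GU (F : nat -> set X) : (forall i, G (F i)) -> G (\bigcup_i F i).
  move=> hF; have mF i := (hF i).1.
  have mU : measurable (\bigcup_i F i) by exact: bigcup_measurable.
  split=> // e' e'0.
  pose V k : set X := \bigcup_(i in [set i | (i < k)%N]) F i.
  have mV k : measurable (V k) by exact: bigcup_measurable.
  have VS j : V j.+1 `<=` V j `|` F j.
    move=> x [i /=]; rewrite ltnS leq_eqVlt => /orP[/eqP->|ij] Fx; first by right.
    by left; exists i.
  have [k hk] : exists k, prob mu ((\bigcup_i F i) `\` V k) < e' / 2.
    apply: prob_nonincreasing0 => //.
    - by move=> i; exact: measurableD.
    - move=> i j ij; apply: setDS => x [l li Fx]; exists l => //=; exact: leq_trans li ij.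
    - rewrite (_ : \bigcap_i _ = set0) ?prob0//.
      apply/seteqP; split => // x h.
      have [[i _ Fix] _] := h 0%N I.
      by have [_] := h i.+1 I; apply; exists i => /=.
    - by rewrite divr_gt0.
  have : forall j, exists n (S : set (n.-tuple letter)),
    prob mu (sd (V j) [set x | S (prefix_word x n)]) <= (e' / 2) * (j%:R / k.+1%:R).
    elim=> [|j [n1 [S1 h1]]].
      exists 0%N, set0; rewrite mul0r mulr0 /sd.
      by rewrite (_ : _ `|` _ = set0) ?prob0//; apply/seteqP; split => x [] [] // [].
    have [|n2 [S2 h2]] := (hF j).2 (e' / 2 / k.+1%:R).
      by rewrite !divr_gt0.
    pose n := maxn n1 n2.
    pose S := [set w | exists x : X, prefix_word x n = w /\
      (S1 (prefix_word x n1) \/ S2 (prefix_word x n2))].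
    exists n, S.
    have SE x : S (prefix_word x n) <-> S1 (prefix_word x n1) \/ S2 (prefix_word x n2).
      split=> [[y [/eq_prefix_word yx]]|h]; last by exists x.
      have e1 : prefix_word y n1 = prefix_word x n1.
        by apply/eq_prefix_word => i ?; apply: yx; rewrite leq_max; lia.
      have e2 : prefix_word y n2 = prefix_word x n2.
        by apply/eq_prefix_word => i ?; apply: yx; rewrite leq_max; lia.
      by rewrite e1 e2.
    apply: (@le_trans _ _ (prob mu (sd (V j) [set x | S1 (prefix_word x n1)] `|`
       sd (F j) [set x | S2 (prefix_word x n2)]))).
      apply: prob_le.
      - by apply: msd => //; exact: measurable_prefix.
      - by apply: measurableU; apply: msd => //; exact: measurable_prefix.
      have VF : V j `|` F j `<=` V j.+1.
        move=> x [[i /= ij Fx]|Fx]; last by exists j => /=.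
        by exists i => //=; exact: leq_trans ij _.
      move=> x; rewrite /sd /= SE; have := VS j x; have := VF x.
      by rewrite /setU /setD /=; tauto.
    apply: le_trans (probU _ _ _) _.
    - by apply: msd => //; exact: measurable_prefix.
    - by apply: msd => //; exact: measurable_prefix.
    rewrite -[j.+1]addn1 natrD mulrDl mulrDr mul1r.
    by apply: lerD => //; exact: ltW.
  move=> /(_ k)[n [S hS]]; exists n, S.
  apply: (@le_lt_trans _ _ (prob mu (((\bigcup_i F i) `\` V k) `|`
        sd (V k) [set x | S (prefix_word x n)]))).
    apply: prob_le.
    - by apply: msd => //; exact: measurable_prefix.
    - apply: measurableU; first exact: measurableD.
      by apply: msd => //; exact: measurable_prefix.
    have VU : V k `<=` \bigcup_i F i.
      by move=> x [i _ Fx]; exists i.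
    move=> x [[h1 h2]|[h1 h2]]; last first.
      by right; right; split => // h3; apply: h2; exact: VU.
    by have [h3|h3] := pselect (V k x); [right; left|left].
  apply: le_lt_trans (probU _ _ _) _.
  - exact: measurableD.
  - by apply: msd => //; exact: measurable_prefix.
  rewrite [ltRHS](splitr e'); apply: ltr_leD => //.
  apply: le_trans hS _; rewrite -[leRHS]mulr1 ler_wpM2l//.
    by rewrite divr_ge0// ltW.
  by rewrite ler_pdivrMr// mul1r ler_nat.
have : <<s @open (shift_space M) >> `<=` G.
  apply: smallest_sub.
    split.
    - have := cylG 0%N set0; congr G; exact/seteqP.
    - move=> A [mA hA]; rewrite setTD; split; first exact: measurableC.
      move=> e' /hA[n [S hS]]; exists n, (~` S); apply: le_lt_trans hS.
      apply: prob_le.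
      + by apply: msd; [exact: measurableC|exact: measurable_prefix].
      + by apply: msd => //; exact: measurable_prefix.
      by move=> x [[/= h1 /contrapT h2]|[/= h1 /contrapT h2]]; [right|left].
    - exact: GU.
  move=> U oU; rewrite (bigcup_cylinders oU); apply: GU => n.
  have := cylG n [set w | forall y : X, prefix_word y n = w -> U y].
  by [].
by apply.
Qed.

End ShiftSpace.

(** * Entropy bounds from below the number of typical words *)

Section EntropyCount.
Context (R : realType).

Lemma ln_le_sub1 (x : R) : 0 < x -> ln x <= x - 1.
Proof. by move=> x0; have := expR_ge1Dx (ln x); rewrite lnK ?posrE//; lra. Qed.

(** Gibbs' inequality against the distribution that puts half of its mass
    uniformly on [F] and the other half uniformly on the whole type. *)
Lemma finite_entropy_le (W : finType) (p : W -> R) (F : {set W}) :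
  (forall w, 0 <= p w) -> \sum_w p w = 1 -> (0 < #|F|)%N ->
  - \sum_w p w * ln (p w) <=
    ln 2 + ln #|F|%:R + (1 - \sum_(w in F) p w) * ln #|W|%:R.
Proof.
move=> p0 p1 F0; have W0 : (0 < #|W|)%N.
  by apply: leq_trans F0 _; exact: max_card.
pose q w : R := if w \in F then (2 * #|F|%:R)^-1 else (2 * #|W|%:R)^-1.
have F0' : 0 < #|F|%:R :> R by rewrite ltr0n.
have W0' : 0 < #|W|%:R :> R by rewrite ltr0n.
have q0 w : 0 < q w by rewrite /q; case: ifP; rewrite invr_gt0 mulr_gt0.
have gibbs w : - (p w * ln (p w)) <= - (p w * ln (q w)) + (q w - p w).
  have [->|pw0] := eqVneq (p w) 0; first by rewrite !mul0r oppr0 add0r addr0 ltW.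
  have pw : 0 < p w by rewrite lt_def pw0 p0.
  have := ln_le_sub1 (divr_gt0 (q0 w) pw).
  rewrite ln_div ?posrE// => /(ler_wpM2l (ltW pw)).
  by rewrite mulrBr mulrBr mulr1 mulrCA divff// mulr1; lra.
rewrite -sumrN; apply: le_trans (ler_sum _ (fun w _ => gibbs w)) _.
rewrite big_split /= sumrB p1.
have Sq : \sum_w q w <= 1.
  rewrite (bigID (mem F))/=.
  under eq_bigr => w wF do rewrite /q wF.
  under [X in _ + X]eq_bigr => w wF do rewrite /q (negbTE wF).
  rewrite !sumr_const -[X in X + _]mulr_natl -[X in _ + X]mulr_natl.
  rewrite !invfM mulrCA divff ?gt_eqF// mulr1.
  apply: (@le_trans _ _ (2^-1 + #|W|%:R * (2^-1 * #|W|%:R^-1))).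
    by rewrite lerD2l ler_wpM2r// ?ler_nat ?max_card// mulr_ge0 ?invr_ge0// ltW.
  by rewrite mulrCA divff ?gt_eqF// mulr1; lra.
suff -> : \sum_w - (p w * ln (q w)) = ln 2 + (\sum_(w in F) p w) * ln #|F|%:R +
     (1 - \sum_(w in F) p w) * ln #|W|%:R.
  have : (\sum_(w in F) p w) * ln #|F|%:R <= ln #|F|%:R.
    rewrite ler_piMl// ?ln_ge0 ?ler1n// -p1 [leRHS](bigID (mem F))/= lerDl.
    exact: sumr_ge0.
  lra.
have hp : \sum_(w in F) p w + \sum_(w | w \notin F) p w = 1.
  by rewrite -p1 [RHS](bigID (mem F)).
rewrite (bigID (mem F))/=.
rewrite (eq_bigr (fun w => p w * ln (2 * #|F|%:R))); last first.
  by move=> w wF; rewrite /q wF lnV ?posrE ?mulr_gt0// mulrN opprK.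
rewrite [X in _ + X](eq_bigr (fun w => p w * ln (2 * #|W|%:R))); last first.
  by move=> w wF; rewrite /q (negbTE wF) lnV ?posrE ?mulr_gt0// mulrN opprK.
rewrite -!mulr_suml !lnM ?posrE//.
have -> : \sum_(i | i \notin F) p i = 1 - \sum_(w in F) p w by lra.
by ring.
Qed.

Definition hamming (k n : nat) (u v : n.-tuple 'I_k) : nat :=
  \sum_(i < n) (tnth u i != tnth v i).

(** The exponential moment factors over the coordinates; it bounds the
    cardinality of the Hamming balls below. *)
Lemma sum_hamming (k n : nat) (u : n.-tuple 'I_k) (s : R) :
  \sum_(v : n.-tuple 'I_k) expR (- s * (hamming u v)%:R) <=
  expR (n%:R * (k%:R * expR (- s))).
Proof.
have -> : \sum_(v : n.-tuple 'I_k) expR (- s * (hamming u v)%:R) =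
   \sum_(g : {ffun 'I_n -> 'I_k}) \prod_i expR (- s * (tnth u i != g i)%:R).
  rewrite (reindex (fun g : {ffun 'I_n -> 'I_k} => [tuple g i | i < n])) /=; last first.
    exists (fun v => [ffun i => tnth v i]) => [g _|v _].
      by apply/ffunP => i; rewrite ffunE tnth_mktuple.
    by apply: eq_from_tnth => i; rewrite tnth_mktuple ffunE.
  apply: eq_bigr => g _; rewrite /hamming natr_sum mulr_sumr expR_sum.
  by apply: eq_bigr => i _; rewrite tnth_mktuple.
rewrite -(bigA_distr_bigA (fun i j => expR (- s * (tnth u i != j)%:R))).
have step i : \sum_j expR (- s * (tnth u i != j)%:R) <= expR (k%:R * expR (- s)).
  apply: le_trans (expR_ge1Dx _).
  rewrite (bigD1 (tnth u i))//= eqxx mulr0 expR0 lerD2l.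
  have -> : k%:R * expR (- s) = \sum_(j < k) expR (- s).
    by rewrite sumr_const card_ord mulr_natl.
  rewrite [leRHS](bigD1 (tnth u i))//= ler_wpDl ?expR_ge0//.
  by apply: ler_sum => j ju; rewrite eq_sym ju mulr1.
apply: (@le_trans _ _ (\prod_(i < n) expR (k%:R * expR (- s)))).
  apply: ler_prod => i _; rewrite step andbT.
  by apply: sumr_ge0 => j _; exact: expR_ge0.
by rewrite prodr_const card_ord (expRM_natl n).
Qed.

Section Shift.
Variables (M : nat).
Notation letter := 'I_M.+1.
Notation X := (borel_shift_space M).
Variables (mu : probability X R) (k : nat) (P : 'I_k -> set X).
Hypothesis inv : invariant_measure (@left_shift M) mu.
Hypothesis hP : finite_partition P.

Lemma partition_label : exists lab : X -> 'I_k, forall x j, P j x <-> lab x = j.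
Proof.
have [_ tP cP] := hP.
have h x : exists j, P j x.
  have [j _ ?] : (\bigcup_j P j) x by rewrite cP.
  by exists j.
have [lab hlab] := choice h.
exists lab => x j; split => [Pj|<-]//.
by apply: tP => //; exists x; split; [exact: hlab|].
Qed.

(** Each cell is nearly a cylinder, so that the first [q] letters determine the
    label of all points outside a small set. *)
Lemma partition_coding (lab : X -> 'I_k) (kap : R) :
  (forall x j, P j x <-> lab x = j) -> 0 < kap ->
  exists q (code : q.-tuple letter -> 'I_k),
    measurable [set x | lab x != code (prefix_word x q)] /\
    prob mu [set x | lab x != code (prefix_word x q)] <= kap.
Proof.
move=> labP kap0; have [mP _ _] := hP.
pose j0 := lab (fun=> ord0).
have k0 : (0 < k)%N by case: k j0 => // -[].
have kk0 : 0 < kap / k%:R by rewrite divr_gt0// ltr0n.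
have h j : exists qS : {q : nat & set (q.-tuple letter)},
    prob mu ((P j `\` [set x | projT2 qS (prefix_word x (projT1 qS))]) `|`
     ([set x | projT2 qS (prefix_word x (projT1 qS))] `\` P j)) < kap / k%:R.
  have [q [S hS]] := cylinder_approximation mu (mP j) kk0.
  by exists (existT _ q S).
have [qS hqS] := choice h.
pose D j := (P j `\` [set x | projT2 (qS j) (prefix_word x (projT1 (qS j)))]) `|`
     ([set x | projT2 (qS j) (prefix_word x (projT1 (qS j)))] `\` P j).
have mD j : measurable (D j).
  by apply: measurableU; apply: measurableD => //; exact: measurable_prefix.
pose q := (\max_j projT1 (qS j))%N.
pose S j (w : q.-tuple letter) := exists x : X, prefix_word x q = w /\
  projT2 (qS j) (prefix_word x (projT1 (qS j))).
have SE j (x : X) : S j (prefix_word x q) <->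
    projT2 (qS j) (prefix_word x (projT1 (qS j))).
  split=> [[y [/eq_prefix_word yx]]|hx]; last by exists x.
  rewrite (_ : prefix_word y _ = prefix_word x (projT1 (qS j)))//.
  apply/eq_prefix_word => i hi; apply: yx; apply: leq_trans hi _.
  exact: (leq_bigmax j).
pose code w := odflt j0 [pick j | `[< S j w >]].
have codeP x : (forall j, ~ D j x) -> code (prefix_word x q) = lab x.
  move=> hD; have Slab : S (lab x) (prefix_word x q).
    apply/SE; apply: contrapT => nS; apply: (hD (lab x)); left; split => //.
    exact/labP.
  rewrite /code; case: pickP => [j /asboolP /SE Sj|/(_ (lab x))]; last first.
    by move/asboolP.
  apply/esym/labP; apply: contrapT => nP; apply: (hD j).
  by right; split.
have mB : measurable [set x | lab x != code (prefix_word x q)].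
  rewrite (_ : [set _ | _] = \bigcup_(j in [set: 'I_k])
     (P j `&` [set x | code (prefix_word x q) <> j])).
    apply: fin_bigcup_measurable => // j _; apply: measurableI => //.
    exact: (@measurable_prefix _ q (fun w => code w <> j)).
  apply/seteqP; split => [x /= /eqP hx|x [j _ [/labP <- /= /eqP]]].
    by exists (lab x) => //; split; [exact/labP|exact/nesym].
  by rewrite eq_sym.
exists q, code; split => //.
have := @prob_bigcap _ _ _ mu _ (enum 'I_k) (fun j => ~` D j) (kap / k%:R).
have -> : [set x | forall i, i \in enum 'I_k -> (~` D i) x] =
  ~` \bigcup_(j in [set: 'I_k]) D j.
  apply/seteqP; split => [x hx [j _]|x hx j _ Dj].
    by apply: hx; rewrite mem_enum.
  by apply: hx; exists j.
rewrite size_enum_ord probC; last exact: fin_bigcup_measurable.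
rewrite mulrCA divff ?mulr1 ?pnatr_eq0 -?lt0n// => hle.
apply: (@le_trans _ _ (prob mu (\bigcup_(j in [set: 'I_k]) D j))).
  apply: prob_le => //; first exact: fin_bigcup_measurable.
  move=> x /= /eqP hx; apply: contrapT => nD; apply: hx; apply/esym/codeP.
  by move=> j Dj; apply: nD; exists j.
rewrite -[leRHS](subKr 1) lerBrDl -lerBrDr; apply: hle.
  by move=> j; exact: measurableC.
by move=> j _; rewrite probC// lerD2l lerN2 ltW// hqS.
Qed.

(** Read the itinerary of a point through [P] off its letters by the
    approximate code. Few of the first [n] labels are wrong, so that the
    itineraries of the points with prefix in [E] lie in Hamming balls around
    the #|E| decoded ones. This small set of itineraries has nearly full
    measure, and the entropy of their distribution is about [n] times the
    entropy of [P]. *)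
Lemma entropy_count (e : R) :
  cvgn (fun n : nat => n%:R^-1 * join_entropy (@left_shift M) mu P n) -> 0 < e ->
  exists2 del, 0 < del & exists n1 : nat, forall n, (n1 <= n)%N ->
    forall E : {set n.-tuple letter},
      1 - del <= prob mu [set x | prefix_word x n \in E] ->
      expR (n%:R * (partition_entropy (@left_shift M) mu P - e)) <= #|E|%:R.
Proof.
move=> hcvg e0; set hh := partition_entropy _ _ _.
have [lab labP] := partition_label.
have [mP _ _] := hP.
have k0 : (0 < k)%N by case: k (lab (fun=> ord0)) => // -[].
have k0' : 0 < k%:R :> R by rewrite ltr0n.
have lnk0 : 0 <= ln k%:R :> R by rewrite ln_ge0// ler1n.
(* The exponent [s] makes the factor for the Hamming balls small; the proportion
   [bet] of wrong labels is then negligible against [1 / s], and the exceptional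
   measure [del] against the logarithm of the number of labels. *)
pose s : R := 16 * k%:R / e.
have s0 : 0 < s by rewrite divr_gt0// mulr_gt0.
have ks : k%:R * expR (- s) <= e / 16.
  have h1 : s <= expR s by apply: le_trans (expR_ge1Dx _); rewrite lerDr.
  rewrite expRN ler_pdivrMr ?expR_gt0//.
  apply: (@le_trans _ _ (e / 16 * s)); last by rewrite ler_wpM2l// divr_ge0// ltW.
  have -> : e / 16 * s = k%:R by rewrite /s; field; rewrite gt_eqF.
  by [].
pose bet : R := e / (16 * s).
have bet0 : 0 < bet by rewrite divr_gt0// mulr_gt0.
pose del : R := e / (16 * (ln k%:R + 1) + 4 * e).
have den0 : 0 < 16 * (ln k%:R + 1) + 4 * e by lra.
have del0 : 0 < del by rewrite divr_gt0.
have del4 : del <= 4^-1.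
  by rewrite ler_pdivrMr//; lra.
have dell : del * ln k%:R <= e / 16.
  rewrite mulrAC ler_pdivrMr//.
  have -> : e / 16 * (16 * (ln k%:R + 1) + 4 * e) = e * ln k%:R + e + e * e / 4 by field.
  have : 0 <= e * e by rewrite mulr_ge0 ?ltW. 
  lra.
pose kap : R := bet * del.
have kap0 : 0 < kap by rewrite mulr_gt0.
have [q [code [mB hB]]] := partition_coding labP kap0.
exists del => //.
have [n2 _ hn2] : \forall n \near \oo,
    hh - e / 8 <= n%:R^-1 * join_entropy (@left_shift M) mu P n.
  have /cvgrPdist_le /(_ (e / 8)) : n%:R^-1 * join_entropy (@left_shift M) mu P n
     @[n --> \oo] --> hh by [].
  rewrite divr_gt0// => /(_ isT); apply: filterS => n /=.
  by rewrite ler_norml; lra.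
have [n3 hn3] : exists n3 : nat, (ln 2 + q%:R * `|hh|) / (e / 4) < n3%:R.
  exists (Num.bound ((ln 2 + q%:R * `|hh|) / (e / 4))); apply: archi_boundP.
  by rewrite divr_ge0 ?addr_ge0 ?mulr_ge0 ?ln_ge0 ?ler1n// ltW.
exists (q + maxn n2.+1 n3)%N => n qn E hE.
have [N nE] : exists N, n = (N + q)%N by exists (n - q)%N; clear -qn; lia.
have [N2 N0 N3] : [/\ (n2 <= N)%N, (0 < N)%N & (n3 <= N)%N].
  by clear -qn nE; split; lia.
have NR0 : 0 < N%:R :> R by rewrite ltr0n.
pose B := [set x | lab x != code (prefix_word x q)].
pose name (x : X) : N.-tuple 'I_k := [tuple lab (iter i (@left_shift M) x) | i < N].
have cellE w : join_cell (@left_shift M) P w = [set x | name x = w].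
  apply/seteqP; split => x /= hx.
    apply: eq_from_tnth => i; rewrite tnth_mktuple.
    exact/labP/hx.
  by move=> i; apply/labP; rewrite -hx tnth_mktuple.
have mname w : measurable [set x | name x = w].
  rewrite -cellE (_ : join_cell _ _ _ = \bigcap_(i in [set: 'I_N])
     (iter i (@left_shift M) @^-1` P (tnth w i))).
    apply: fin_bigcap_measurable => // i _; apply: measurable_preimage_iter => //.
    exact: measurable_left_shift.
  by apply/seteqP; split => [x hx i _|x hx i]; exact: hx.
pose cname (w : n.-tuple letter) : N.-tuple 'I_k :=
  [tuple code [tuple nth ord0 w (i + j) | j < q] | i < N].
pose F : {set N.-tuple 'I_k} :=
  [set v | [exists w in E, ((hamming (cname w) v)%:R : R) <= bet * N%:R]]%SET.
have cnameE x i : tnth (cname (prefix_word x n)) i =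
    code (prefix_word (iter i (@left_shift M) x) q).
  rewrite tnth_mktuple; congr code; apply: eq_from_tnth => j.
  rewrite !tnth_mktuple iter_left_shift val_prefix_word nth_mkseq//.
  by rewrite nE; have h1 := ltn_ord i; have h2 := ltn_ord j; clear -h1 h2; lia.
have hamE x : (hamming (cname (prefix_word x n)) (name x))%:R =
    \sum_(i < N) \1_B (iter i (@left_shift M) x) :> R.
  rewrite natr_sum; apply: eq_bigr => i _; rewrite cnameE tnth_mktuple indicE.
  congr (_%:R); congr (nat_of_bool _); rewrite eq_sym.
  by apply/idP/idP => [?|]; rewrite inE.
have mF : measurable [set x | name x \in F].
  rewrite (_ : [set _ | _] = \bigcup_(w in [set w | w \in F]) [set x | name x = w]).
    by apply: fin_bigcup_measurable => //; exact: finite_finset.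
  by apply/seteqP; split => [x xF|x [w wF /= ->]//]; exists (name x).
have pF : 1 - (del + del) <= prob mu [set x | name x \in F].
  have mG : measurable [set x | bet * N%:R < \sum_(i < N) \1_B (iter i (@left_shift M) x)].
    rewrite (_ : [set _ | _] = setT `&` ((fun x => \sum_(i < N) \1_B (iter i (@left_shift M) x) : R)
       @^-1` `]bet * N%:R, +oo[%classic)).
      have : measurable_fun setT (fun x => \sum_(i < N) \1_B (iter i (@left_shift M) x) : R).
        apply: measurable_sum => i.
        rewrite (_ : (fun _ => _) = \1_(iter i (@left_shift M) @^-1` B)).
          apply/measurable_indic/measurable_preimage_iter => //.
          exact: measurable_left_shift.
        by apply/funext => x; rewrite !indicE.
      exact.
    by apply/seteqP; split => y /=; rewrite in_itv/= andbT// => -[].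
  have hmk : prob mu [set x | bet * N%:R < \sum_(i < N) \1_B (iter i (@left_shift M) x)] <= del.
    have := visits_markov (@measurable_left_shift M) inv N mB
      (mulr_ge0 (ltW bet0) (ltW NR0)).
    set p := prob _ _ => hp.
    rewrite -(ler_pM2l (mulr_gt0 bet0 NR0)); apply: le_trans hp _.
    have -> : bet * N%:R * del = N%:R * kap by rewrite /kap; ring.
    by rewrite ler_wpM2l// ltW.
  have mE : measurable [set x | prefix_word x n \in E].
    exact: (@measurable_prefix _ n (fun w => w \in E)).
  have := prob_setI mE (measurableC mG) hE; rewrite probC// => /(_ del).
  rewrite lerD2l lerN2 => /(_ hmk) /le_trans; apply; apply: prob_le => //.
    by apply: measurableI => //; exact: measurableC.
  move=> x [/= xE /negP]; rewrite -leNgt -hamE => hx.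
  by rewrite inE; apply/existsP; exists (prefix_word x n); rewrite xE.
have F0 : (0 < #|F|)%N.
  rewrite lt0n; apply/negP => /eqP /cards0_eq F0.
  move: pF; rewrite F0 (_ : [set _ | _] = set0) ?prob0; last first.
    by apply/seteqP; split => x //=; rewrite inE.
  lra.
have cardF : #|F|%:R <= #|E|%:R * expR (N%:R * (k%:R * expR (- s)) + s * (bet * N%:R)).
  rewrite expRD mulrA -ler_pdivrMr ?expR_gt0// -expRN.
  apply: (@le_trans _ _ (\sum_(w in E) \sum_(v : N.-tuple 'I_k)
      expR (- s * (hamming (cname w) v)%:R))); last first.
    apply: le_trans (ler_sum _ (fun w _ => sum_hamming (cname w) s)) _.
    by rewrite sumr_const -[leLHS]mulr_natl.
  rewrite exchange_big /= [leRHS](bigID (mem F))/=.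
  rewrite -[leLHS]addr0; apply: lerD; last first.
    by apply: sumr_ge0 => v _; apply: sumr_ge0 => w _; exact: expR_ge0.
  rewrite mulr_natl -sumr_const; apply: ler_sum => v.
  rewrite inE => /existsP[w /andP[wE hw]]; rewrite (bigD1 w)//=.
  rewrite ler_wpDr//; first by apply: sumr_ge0 => ? _; exact: expR_ge0.
  by rewrite ler_expR mulNr lerN2 ler_wpM2l// ltW.
have E0 : (0 < #|E|)%N.
  rewrite lt0n; apply/negP => /eqP E0; move: cardF; rewrite E0 mul0r.
  by rewrite lern0 -leqn0 leqNgt F0.
pose p w := prob mu [set x | name x = w].
have Hp : join_entropy (@left_shift M) mu P N = - \sum_w p w * ln (p w).
  by rewrite /join_entropy; congr (- _); apply: eq_bigr => w _; rewrite cellE.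
have psum (G : {set N.-tuple 'I_k}) : \sum_(w in G) p w = prob mu [set x | name x \in G].
  by rewrite prob_finite_sum.
have p1 : \sum_w p w = 1.
  rewrite -(probT mu) -[in RHS](_ : [set x | name x \in [set: N.-tuple 'I_k]%SET] = setT).
    by rewrite -psum; apply: eq_bigl => w; rewrite inE.
  by apply/seteqP; split => x //= _; rewrite inE.
have := finite_entropy_le (fun w => prob_ge0 mu _) p1 F0.
rewrite -Hp psum card_tuple card_ord natrX lnXn// -[ln _ *+ N]mulr_natl => hent.
have hN := hn2 N N2; rewrite -ler_pdivrMl ?invr_gt0// invrK in hN.
have lnF : ln #|F|%:R <= ln #|E|%:R + (N%:R * (k%:R * expR (- s)) + s * (bet * N%:R)).
  rewrite -[X in _ + X]expRK -lnM ?posrE ?expR_gt0 ?ltr0n// ler_ln// posrE ?ltr0n//.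
  by rewrite mulr_gt0 ?expR_gt0 ?ltr0n.
rewrite -[leRHS]lnK ?posrE ?ltr0n// ler_expR.
have h1 : N%:R * (k%:R * expR (- s)) <= N%:R * (e / 16) by rewrite ler_wpM2l// ltW.
have h2 : s * (bet * N%:R) = N%:R * (e / 16).
  by rewrite /bet; field; rewrite gt_eqF.
have h3 : (1 - prob mu [set x | name x \in F]) * (N%:R * ln k%:R) <= N%:R * (e / 8).
  apply: (@le_trans _ _ ((del + del) * (N%:R * ln k%:R))).
    by apply: ler_wpM2r; [exact: mulr_ge0 (ltW NR0) lnk0|lra].
  by rewrite mulrCA; apply: ler_wpM2l; [exact: ltW|lra].
have h4 : ln 2 + q%:R * `|hh| <= N%:R * (e / 4).
  rewrite -ler_pdivrMr ?divr_gt0//; apply: le_trans (ltW hn3) _.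
  by rewrite ler_nat.
have h5 : q%:R * hh <= q%:R * `|hh| by rewrite ler_wpM2l// ler_norm.
have h6 : 0 <= q%:R * e by rewrite mulr_ge0// ltW.
have h7 : n%:R = N%:R + q%:R :> R by rewrite nE natrD.
have h8 : 0 <= N%:R * e by rewrite mulr_ge0// ltW.
rewrite h7; clear -h1 h2 h3 h4 h5 h6 h8 lnF hN hent; lra.
Qed.

End Shift.

End EntropyCount.

(** * Two by two matrices: norms, contracted directions, invariant cones *)

Section TwoByTwo.
Variable R : realType.

Lemma ord2P (P : 'I_2 -> Prop) : P 0 -> P 1 -> forall i, P i.
Proof.
move=> P0 P1 [[|[|//]] hi].
  by rewrite (_ : Ordinal hi = 0)//; exact: val_inj.
by rewrite (_ : Ordinal hi = 1)//; exact: val_inj.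
Qed.

Lemma sum_ord2 (V : nmodType) (F : 'I_2 -> V) : \sum_i F i = F 0 + F 1.
Proof.
by rewrite big_ord_recl big_ord1; congr (F _ + F _); exact: val_inj.
Qed.

Lemma mulmx2E m p (A : 'M[R]_(m, 2)) (B : 'M[R]_(2, p)) i j :
  (A *m B) i j = A i 0 * B 0 j + A i 1 * B 1 j.
Proof. by rewrite mxE sum_ord2. Qed.

Lemma det2E (A : 'M[R]_2) : \det A = A 0 0 * A 1 1 - A 0 1 * A 1 0.
Proof.
rewrite (expand_det_row _ 0) sum_ord2 /cofactor !det_mx11 !mxE.
have l0 : lift 0 0 = 1 :> 'I_2 by exact: val_inj.
have l1 : lift 1 0 = 0 :> 'I_2 by exact: val_inj.
by rewrite l0 l1 addn0 add0n expr0 expr1; ring.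
Qed.

Definition l1norm m n (X : 'M[R]_(m, n)) : R := \sum_i \sum_j `|X i j|.

Lemma l1norm_ge0 m n (X : 'M[R]_(m, n)) : 0 <= l1norm X.
Proof. by apply: sumr_ge0 => i _; exact: sumr_ge0. Qed.

Lemma le_l1norm m n (X : 'M[R]_(m, n)) i j : `|X i j| <= l1norm X.
Proof.
rewrite /l1norm (bigD1 i)//= (bigD1 j)//= -addrA lerDl.
by rewrite addr_ge0// ?sumr_ge0// => k _; exact: sumr_ge0.
Qed.

Lemma l1norm_gt0 m n (X : 'M[R]_(m, n)) : X != 0 -> 0 < l1norm X.
Proof.
move=> X0; rewrite lt_def l1norm_ge0 andbT; apply: contraNneq X0 => h.
apply/eqP/matrixP => i j; rewrite mxE; apply/eqP; rewrite -normr_le0 -h.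
exact: le_l1norm.
Qed.

Lemma l1normD m n (X Y : 'M[R]_(m, n)) : l1norm (X + Y) <= l1norm X + l1norm Y.
Proof.
rewrite -big_split /=; apply: ler_sum => i _.
by rewrite -big_split /=; apply: ler_sum => j _; rewrite mxE ler_normD.
Qed.

Lemma l1normZ m n (a : R) (X : 'M[R]_(m, n)) : l1norm (a *: X) = `|a| * l1norm X.
Proof.
rewrite /l1norm mulr_sumr; apply: eq_bigr => i _; rewrite mulr_sumr.
by apply: eq_bigr => j _; rewrite mxE normrM.
Qed.

Lemma l1normM m n p (X : 'M[R]_(m, n)) (Y : 'M[R]_(n, p)) :
  l1norm (X *m Y) <= l1norm X * l1norm Y.
Proof.
apply: (@le_trans _ _ (\sum_i \sum_j \sum_k `|X i k| * `|Y k j|)).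
  apply: ler_sum => i _; apply: ler_sum => j _; rewrite mxE.
  apply: le_trans (ler_norm_sum _ _ _) _.
  by apply: ler_sum => k _; rewrite normrM.
rewrite {1}/l1norm mulr_suml; apply: ler_sum => i _.
rewrite exchange_big mulr_suml; apply: ler_sum => k _.
rewrite -mulr_sumr ler_wpM2l// /l1norm (bigD1 k)//= lerDl.
by apply: sumr_ge0 => l _; exact: sumr_ge0.
Qed.

Lemma l1norm2E (X : 'M[R]_2) :
  l1norm X = `|X 0 0| + `|X 0 1| + (`|X 1 0| + `|X 1 1|).
Proof. by rewrite /l1norm !sum_ord2. Qed.

Lemma l1norm_col2E (u : 'cV[R]_2) : l1norm u = `|u 0 0| + `|u 1 0|.
Proof. by rewrite /l1norm sum_ord2 !big_ord1. Qed.

Lemma l1norm_mul_l1norm m n p q (X : 'M[R]_(m, n)) (Y : 'M[R]_(p, q)) :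
  l1norm X * l1norm Y = \sum_i \sum_j \sum_k \sum_l `|X i j * Y k l|.
Proof.
rewrite /l1norm mulr_suml; apply: eq_bigr => i _; rewrite mulr_suml.
apply: eq_bigr => j _; rewrite mulr_sumr; apply: eq_bigr => k _.
by rewrite mulr_sumr; apply: eq_bigr => l _; rewrite normrM.
Qed.

(** An entry of [Y X V] times one of [X] is a product of entries of [X V] and
    [Y X] up to a multiple of the determinant. Summed over all entries, this
    shows that the norm is nearly multiplicative across a factor [X] with small
    determinant. *)
Lemma tensor_identity m p (Y : 'M[R]_(m, 2)) (X : 'M[R]_2) (V : 'M[R]_(2, p))
    a b i k :
  (Y *m X *m V) a b * X i k = (X *m V) i b * (Y *m X) a k +
    (if i == k then 1 else -1) * \det X * (Y a (1 - i) * V (1 - k) b).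
Proof.
rewrite !mulmx2E det2E; move: i k; apply: ord2P; apply: ord2P => /=.
- by rewrite subr0; ring.
- by rewrite subr0 subrr; ring.
- by rewrite subr0 subrr; ring.
- by rewrite subrr; ring.
Qed.

Lemma sum_flip (V : nmodType) (F : 'I_2 -> V) : \sum_i F (1 - i) = \sum_i F i.
Proof. by rewrite !sum_ord2 subr0 subrr addrC. Qed.

Lemma tensor_remainder m p (Y : 'M[R]_(m, 2)) (V : 'M[R]_(2, p)) (d : R) :
  \sum_a \sum_b \sum_i \sum_k
    `|(if i == k then 1 else -1) * d * (Y a (1 - i) * V (1 - k) b)| =
  `|d| * (l1norm Y * l1norm V).
Proof.
rewrite l1norm_mul_l1norm mulr_sumr; apply: eq_bigr => a _.
rewrite exchange_big /= mulr_sumr.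
rewrite -[RHS]sum_flip; apply: eq_bigr => i _.
rewrite exchange_big /= mulr_sumr -[RHS]sum_flip; apply: eq_bigr => k _.
rewrite mulr_sumr; apply: eq_bigr => b _.
by rewrite !normrM; case: ifP => _; rewrite ?normrN normr1 mul1r.
Qed.

Lemma sum_exchange4 m p (F : 'I_m -> 'I_p -> 'I_2 -> 'I_2 -> R) :
  \sum_a \sum_b \sum_i \sum_k F a b i k = \sum_i \sum_b \sum_a \sum_k F a b i k.
Proof.
under eq_bigr do rewrite exchange_big /=.
rewrite exchange_big /=; apply: eq_bigr => i _.
by rewrite exchange_big.
Qed.

Lemma quasi_multiplicative_le m p (Y : 'M[R]_(m, 2)) (X : 'M[R]_2) (V : 'M[R]_(2, p)) :
  l1norm (Y *m X *m V) * l1norm X <=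
  l1norm (X *m V) * l1norm (Y *m X) + `|\det X| * (l1norm Y * l1norm V).
Proof.
rewrite l1norm_mul_l1norm [l1norm (X *m V) * _]l1norm_mul_l1norm.
rewrite -(sum_exchange4 (fun a b i k => `|(X *m V) i b * (Y *m X) a k|)).
rewrite -tensor_remainder -big_split; apply: ler_sum => a _.
rewrite -big_split; apply: ler_sum => b _.
rewrite -big_split; apply: ler_sum => i _.
rewrite -big_split; apply: ler_sum => k _.
by rewrite tensor_identity; exact: ler_normD.
Qed.

Lemma quasi_multiplicative_ge m p (Y : 'M[R]_(m, 2)) (X : 'M[R]_2) (V : 'M[R]_(2, p)) :
  l1norm (X *m V) * l1norm (Y *m X) <=
  l1norm (Y *m X *m V) * l1norm X + `|\det X| * (l1norm Y * l1norm V).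
Proof.
rewrite l1norm_mul_l1norm [l1norm (Y *m X *m V) * _]l1norm_mul_l1norm.
rewrite -(sum_exchange4 (fun a b i k => `|(X *m V) i b * (Y *m X) a k|)).
rewrite -tensor_remainder -big_split; apply: ler_sum => a _.
rewrite -big_split; apply: ler_sum => b _.
rewrite -big_split; apply: ler_sum => i _.
rewrite -big_split; apply: ler_sum => k _.
rewrite tensor_identity; set s := (if _ then _ else _) * _ * _.
have := ler_normB ((X *m V) i b * (Y *m X) a k + s) s.
by rewrite addrK.
Qed.

Lemma det_le_l1norm (X : 'M[R]_2) : `|\det X| <= l1norm X ^+ 2.
Proof.
rewrite det2E l1norm2E; apply: le_trans (ler_normB _ _) _; rewrite !normrM.
by have := normr_ge0 (X 0 0); have := normr_ge0 (X 0 1);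
  have := normr_ge0 (X 1 0); have := normr_ge0 (X 1 1); nra.
Qed.

(** The second vector of the basis annihilates the row of [B] that contains the
    largest entry; the other row maps
    it to [\det B] divided by that entry, up to sign. *)
Lemma contracted_basis (B : 'M[R]_2) : B != 0 ->
  exists2 P : 'M[R]_2, P \in unitmx &
    [/\ l1norm P <= 3, l1norm (invmx P) <= 3 &
        l1norm (col 1 (B *m P)) <= 4 * `|\det B| / l1norm B].
Proof.
move=> B0; have nB := l1norm_gt0 B0.
have [i [k hmax]] : exists i k, forall j l, `|B j l| <= `|B i k|.
  have [p _ hp] := arg_maxP (fun p : 'I_2 * 'I_2 => `|B p.1 p.2|)
    (isT : xpredT ((0 : 'I_2), (0 : 'I_2))).
  by exists p.1, p.2 => j l; exact: (hp (j, l)).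
have [c hc] : exists c, c = B i k by exists (B i k).
have c4 : l1norm B <= 4 * `|c|.
  by rewrite hc l1norm2E; have := hmax 0 0; have := hmax 0 1;
    have := hmax 1 0; have := hmax 1 1; lra.
have c0 : 0 < `|c| by lra.
have c0' : c != 0 by rewrite -normr_gt0.
have [be hbe] : exists be, be = B i (1 - k) / c by exists (B i (1 - k) / c).
have be1 : `|be| <= 1 by rewrite hbe normrM normfV ler_pdivrMr// mul1r hc hmax.
(* in the coordinates of P the maximal row of B is c times the first one *)
pose P : 'M[R]_2 := \matrix_(a, b)
  (if b == 0 then (if a == k then 1 else 0) else (if a == k then - be else 1)).
pose Q : 'M[R]_2 := \matrix_(a, b)
  (if a == 0 then (if b == k then 1 else be) else (if b == k then 0 else 1)).
have k01 : k = 0 \/ k = 1 by apply: (ord2P (P := fun k => k = 0 \/ k = 1)); [left|right].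
have i01 : i = 0 \/ i = 1 by apply: (ord2P (P := fun k => k = 0 \/ k = 1)); [left|right].
have QP : Q *m P = 1%:M.
  apply/matrixP => a b; rewrite mulmx2E !mxE {hmax hc hbe}.
  by case: k01 => ->; move: a b; apply: ord2P; apply: ord2P => /=; ring.
have [_ uP] := mulmx1_unit QP.
have iP : invmx P = Q by rewrite -[LHS]mul1mx -QP mulmxK.
exists P => //; rewrite iP; split.
- rewrite l1norm2E !mxE; case: k01 => -> /=;
    rewrite ?normrN ?normr0 ?normr1; lra.
- rewrite l1norm2E !mxE; case: k01 => -> /=;
    rewrite ?normrN ?normr0 ?normr1; lra.
have -> : l1norm (col 1 (B *m P)) = `|\det B / c|.
  rewrite l1norm_col2E det2E !mxE !sum_ord2 !mxE {uP iP QP Q P}.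
  case: k01 hc hbe => -> /=; case: i01 => -> /= hc hbe;
    rewrite hbe ?subr0 ?subrr -?hc.
  - rewrite (_ : c * - _ + _ = 0); last by field.
    by rewrite normr0 add0r; congr `|_|; field.
  - rewrite (_ : c * - _ + _ = 0); last by field.
    by rewrite normr0 addr0 -normrN; congr `|_|; field.
  - rewrite (_ : B 0 0 * 1 + _ = 0); last by field.
    by rewrite normr0 add0r -normrN; congr `|_|; field.
  - rewrite (_ : B 1 0 * 1 + _ = 0); last by field.
    by rewrite normr0 addr0; congr `|_|; field.
rewrite normrM normfV ler_pdivrMr// mulrAC ler_pdivlMr//.
by rewrite [leRHS]mulrAC mulrC ler_wpM2r.
Qed.

Definition positive_mx (X : 'M[R]_2) := forall i j, 0 < X i j.

Section DominatedEntry.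
Variables eta tau : R.
Hypotheses (eta0 : 0 < eta) (eta1 : eta <= 1) (tau1 : tau <= eta ^+ 2).

(** The columns are the extremal rays [(2 eta, 1)] and [(2 eta, -1)]. *)
Definition ray_mx : 'M[R]_2 :=
  \matrix_(i, j) (if i == 0 then 2 * eta else (if j == 0 then 1 else -1)).

Lemma invmx_ray : invmx ray_mx = \matrix_(i, j)
  (if j == 0 then (4 * eta)^-1 else (if i == 0 then 2^-1 else - 2^-1)) /\
  ray_mx \in unitmx.
Proof.
set L : 'M[R]_2 := \matrix_(i, j) _.
have eta0' : eta != 0 by rewrite gt_eqF.
have LK : L *m ray_mx = 1%:M.
  apply/matrixP => a b; rewrite mulmx2E !mxE.
  by move: a b; apply: ord2P; apply: ord2P => /=; field.
have [_ uK] := mulmx1_unit LK.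
by split=> //; rewrite -[LHS]mul1mx -LK mulmxK.
Qed.

(** Such a matrix maps the cone of the vectors with [2 eta |w1| <= w0] into its
    interior or into the opposite of the latter. *)
Definition dominated_entry (G : 'M[R]_2) :=
  `|G 0 1| + `|G 1 1| <= tau * l1norm G /\ 4 * eta * l1norm G <= `|G 0 0|.

Let etaM (x y : R) : x <= y -> eta * x <= eta * y.
Proof. by rewrite ler_pM2l. Qed.

(** On the cone, the top coordinate of [G *m w] is at least a multiple of
    [`|G 0 0| * w 0 0], and this controls both norms. *)
Lemma dominated_entry_growth G (w : 'cV[R]_2) : dominated_entry G ->
  2 * eta * `|w 1 0| <= w 0 0 -> eta ^+ 2 * l1norm G * l1norm w <= l1norm (G *m w).
Proof.
move=> [h1 h2] hw.
have n1 := normr_ge0 (w 1 0); have nG := l1norm_ge0 G.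
have w00 : 0 <= w 0 0 by apply: le_trans hw; rewrite !mulr_ge0// ltW.
have tG : tau * l1norm G <= eta ^+ 2 * l1norm G by rewrite ler_wpM2r.
apply: le_trans (le_l1norm _ 0 0); rewrite mulmx2E.
have hh : `|G 0 0| * w 0 0 - `|G 0 1| * `|w 1 0| <= `|G 0 0 * w 0 0 + G 0 1 * w 1 0|.
  rewrite -[in X in X - _](ger0_norm w00) -!normrM.
  have := ler_normB (G 0 0 * w 0 0 + G 0 1 * w 1 0) (G 0 1 * w 1 0).
  by rewrite addrK; lra.
apply: le_trans hh.
have t0 := ler_wpM2r w00 h2.
have t1 : `|G 0 1| * `|w 1 0| <= eta ^+ 2 * l1norm G * `|w 1 0|.
  rewrite ler_wpM2r//; have := normr_ge0 (G 1 1); move: h1 tG.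
  by move: (l1norm G) (`|G 0 1|) (`|G 1 1|) => a b c; lra.
have t2 : eta * l1norm G * (2 * eta * `|w 1 0|) <= eta * l1norm G * w 0 0.
  by rewrite ler_wpM2l// mulr_ge0// ltW.
have t3 : 0 <= eta * l1norm G * w 0 0 by rewrite !mulr_ge0// ltW.
have t4 : eta * (eta * l1norm G * w 0 0) <= eta * l1norm G * w 0 0.
  by rewrite ler_piMl.
rewrite l1norm_col2E (ger0_norm w00).
rewrite expr2 in t1 *; move: t0 t1 t2 t3 t4; clear.
by move: (l1norm G) (w 0 0) (`|w 1 0|) (`|G 0 0|) (`|G 0 1|) => a b c d e; lra.
Qed.

Lemma dominated_entry_positive G : 0 < l1norm G -> dominated_entry G ->
  exists2 s : R, s = 1 \/ s = -1 &
    positive_mx (s *: (invmx ray_mx *m G *m ray_mx)).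
Proof.
move=> nG [h1 h2].
have tG : tau * l1norm G <= eta ^+ 2 * l1norm G by rewrite ler_wpM2r// ltW.
have eG' : 0 < eta ^+ 2 * l1norm G by rewrite mulr_gt0// exprn_gt0.
have E1 : eta ^+ 2 * `|G 1 0| <= eta ^+ 2 * l1norm G.
  by apply: ler_wpM2l; [rewrite exprn_ge0// ltW|exact: le_l1norm].
have E2 := etaM h2.
have E3 : eta * `|G 1 1| <= `|G 1 1| by rewrite ler_piMl.
have main (s : R) : s = 1 \/ s = -1 -> `|G 0 0| = s * G 0 0 ->
   positive_mx (s *: (invmx ray_mx *m G *m ray_mx)).
  move=> s1 sG.
  have bnd a : s * a <= `|a| /\ - `|a| <= s * a.
    have := ler_norm a; have := ler_norm (- a); rewrite normrN.
    by case: s1 => ->; rewrite ?mul1r ?mulN1r; move: (`|a|) => b; lra.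
  have key (e1 e2 : R) : e1 = 1 \/ e1 = -1 -> e2 = 1 \/ e2 = -1 ->
    0 < (2 * eta * (s * G 0 0) + e2 * (s * G 0 1)) +
       e1 * (2 * eta) * (2 * eta * (s * G 1 0) + e2 * (s * G 1 1)).
    rewrite -sG expr2 in E1 tG eG' *.
    have [a1 a2] := bnd (G 0 1); have [b1 b2] := bnd (G 1 1).
    have [c1 c2] := bnd (G 1 0).
    have c1' := etaM (etaM c1); have c2' := etaM (etaM c2).
    have b1' := etaM b1; have b2' := etaM b2.
    move: h1 E1 E2 E3 tG eG' a1 a2 b1' b2' c1' c2'; clear.
    move: (l1norm G) (`|G 0 1|) (`|G 1 1|) (`|G 0 0|) (`|G 1 0|) (s * G 0 1)
      (s * G 1 0) (s * G 1 1) => a b c d e f g h.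
    by move=> ? ? ? ? ? ? ? ? ? ? ? ? []-> []->; lra.
  move=> i j; rewrite mxE !mulmx2E invmx_ray.1 !mxE.
  have i4 : 0 < (4 * eta)^-1 by rewrite invr_gt0 mulr_gt0.
  have eta0' : eta != 0 by rewrite gt_eqF.
  have fact e1 e2 : e1 = 1 \/ e1 = -1 -> e2 = 1 \/ e2 = -1 ->
    0 < s * (((4 * eta)^-1 * G 0 0 + e1 * 2^-1 * G 1 0) * (2 * eta) +
          ((4 * eta)^-1 * G 0 1 + e1 * 2^-1 * G 1 1) * e2).
    move=> he1 he2; have := mulr_gt0 i4 (key e1 e2 he1 he2).
    by congr (_ < _); field.
  move: i j; apply: ord2P; apply: ord2P => /=.
  - by have := fact 1 1 (or_introl erefl) (or_introl erefl); rewrite mul1r.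
  - by have := fact 1 (-1) (or_introl erefl) (or_intror erefl); rewrite mul1r.
  - by have := fact (-1) 1 (or_intror erefl) (or_introl erefl); rewrite mulN1r.
  - by have := fact (-1) (-1) (or_intror erefl) (or_intror erefl); rewrite mulN1r.
have [g0|g0] := leP 0 (G 0 0).
  by exists 1; [left|apply: main; [left|rewrite mul1r ger0_norm]].
by exists (-1); [right|apply: main; [right|rewrite mulN1r ltr0_norm]].
Qed.

(** In the basis of the extremal rays of its cone, preserving the cone means
    that all entries have the same sign. The two changes of basis cost bounded
    factors of the norm. *)
Lemma dominated_entry_cone (P : 'M[R]_2) : P \in unitmx ->
  l1norm P <= 3 -> l1norm (invmx P) <= 3 ->
  exists2 Q : 'M[R]_2, Q \in unitmx &
  exists2 g, 0 < g & forall X : 'M[R]_2, 0 < l1norm X ->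
    dominated_entry (invmx P *m X *m P) ->
    (exists2 s : R, s = 1 \/ s = - 1 & positive_mx (s *: (invmx Q *m X *m Q))) /\
    forall v : 'cV[R]_2, (forall i, 0 <= v i 0) ->
      g * l1norm X * l1norm (Q *m v) <= l1norm (X *m (Q *m v)).
Proof.
move=> uP nP nP'; have [_ uK] := invmx_ray.
exists (P *m ray_mx); first by rewrite unitmx_mul uP.
exists (eta ^+ 2 / 81); first by rewrite divr_gt0// exprn_gt0.
move=> X nX; set G := invmx P *m X *m P => hG.
have XE : X = P *m G *m invmx P.
  by rewrite /G !mulmxA mulmxV// mul1mx -mulmxA mulmxV// mulmx1.
have GX : l1norm X <= 9 * l1norm G.
  rewrite XE; apply: le_trans (l1normM _ _) _.
  have h : l1norm (P *m G) <= 3 * l1norm G.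
    by apply: le_trans (l1normM _ _) _; rewrite ler_wpM2r// l1norm_ge0.
  apply: (@le_trans _ _ (3 * l1norm G * 3)); last by rewrite mulrAC; lra.
  by apply: ler_pM => //; exact: l1norm_ge0.
have nG : 0 < l1norm G by move: nX GX; move: (l1norm G) (l1norm X) => a b; lra.
split.
  rewrite (_ : invmx _ *m X *m _ = invmx ray_mx *m G *m ray_mx).
    exact: dominated_entry_positive.
  have -> : invmx (P *m ray_mx) = invmx ray_mx *m invmx P.
    have h : invmx ray_mx *m invmx P *m (P *m ray_mx) = 1%:M.
      by rewrite mulmxA -(mulmxA (invmx ray_mx)) mulVmx// mulmx1 mulVmx.
    by rewrite -[LHS]mul1mx -h mulmxK// unitmx_mul uP.
  by rewrite /G !mulmxA.
move=> v v0.
have w0 : 2 * eta * `|(ray_mx *m v) 1 0| <= (ray_mx *m v) 0 0.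
  rewrite !mulmx2E !mxE /=; have := v0 0; have := v0 1.
  move: (v 0 0) (v 1 0) => a b a0 b0.
  have : `|1 * a + -1 * b| <= a + b by rewrite ler_norml; lra.
  by move=> /etaM; move: (`|_|) => c; lra.
rewrite -(mulmxA P); move: (ray_mx *m v) w0 => w w0.
have -> : X *m (P *m w) = P *m (G *m w) by rewrite {1}XE -!mulmxA mulKmx.
have hGw := dominated_entry_growth hG w0.
have hPGw : l1norm (G *m w) <= 3 * l1norm (P *m (G *m w)).
  rewrite -[X in l1norm X <= _](mulKmx uP (G *m w)).
  by apply: le_trans (l1normM _ _) _; rewrite ler_wpM2r// l1norm_ge0.
have hPw : l1norm (P *m w) <= 3 * l1norm w.
  by apply: le_trans (l1normM _ _) _; rewrite ler_wpM2r// l1norm_ge0.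
have e2 : 0 <= eta ^+ 2 by rewrite exprn_ge0// ltW.
have s1 : eta ^+ 2 / 81 * l1norm X * l1norm (P *m w) <=
   eta ^+ 2 / 81 * (9 * l1norm G) * (3 * l1norm w).
  apply: ler_pM => //; try exact: l1norm_ge0.
    by rewrite mulr_ge0 ?l1norm_ge0// divr_ge0.
  by rewrite ler_wpM2l// divr_ge0.
move: hGw hPGw s1; clear; move: (eta ^+ 2) (l1norm X) (l1norm G) (l1norm w)
  (l1norm (P *m w)) (l1norm (G *m w)) (l1norm (P *m (G *m w))) => a b c d e f g.
lra.
Qed.

End DominatedEntry.

End TwoByTwo.

(** * Blocks that align a product with a cone *)

Lemma l1norm_row_le (R : realType) m n (X : 'M[R]_(m, n)) i :
  l1norm (row i X) <= l1norm X.
Proof.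
rewrite /l1norm big_ord1 [leRHS](bigD1 i)//= -[leLHS]addr0.
apply: lerD; last by apply: sumr_ge0 => k _; exact: sumr_ge0.
by apply: ler_sum => j _; rewrite mxE.
Qed.

Lemma l1norm_col_le (R : realType) m n (X : 'M[R]_(m, n)) j :
  l1norm (col j X) <= l1norm X.
Proof.
apply: ler_sum => i _; rewrite big_ord1 mxE (bigD1 j)//= lerDl.
exact: sumr_ge0.
Qed.

Lemma mulmx_col_row (R : realType) m p (Y : 'M[R]_(m, 2)) (X : 'M[R]_(2, p)) :
  Y *m X = col 0 Y *m row 0 X + col 1 Y *m row 1 X.
Proof. by apply/matrixP => i j; rewrite mulmx2E !mxE !big_ord1 !mxE. Qed.

(** Here [B] is the matrix of a block, [X] that of a word that begins with the
    block and is followed by it, [Y] that of what comes after the word, and [Z]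
    that of what comes before it. The two inequalities with the factors 36 say
    that little norm is lost at the two occurrences of the block; the two with
    [z] say that the determinant of [X] is small in comparison with its norms. *)
Definition aligns (R : realType) (eta : R) (B P : 'M[R]_2) : Prop :=
  forall (X Q Y Z : 'M[R]_2) (z : R), X = Q *m B ->
    [/\ 0 < l1norm X, 0 < l1norm (Y *m X) & 0 < l1norm (X *m Z)] ->
    36 * (36 * eta) * l1norm (Y *m Q) * l1norm B <= l1norm (Y *m X) ->
    36 * (36 * eta) * l1norm B * l1norm (X *m Z) <= l1norm (B *m X *m Z) ->
    z <= eta ^+ 2 / 100 / 10 ->
    `|\det X| * (l1norm Y * 3) <= z * (l1norm X * l1norm (Y *m X)) ->
    `|\det X| * l1norm Z <= z * (l1norm X * l1norm (X *m Z)) ->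
    dominated_entry eta (eta ^+ 2) (invmx P *m X *m P).

(** As [X] starts with [B] and [Y *m X] is not much smaller than the product of
    the norms, [X] nearly annihilates the vector that [B] contracts: the second
    column is small. As [B *m X] is not much smaller than the product of the
    norms either, the image of [X] is not contracted by [B]: the entry in the
    first row is large. *)
Lemma aligned_block_dominated (R : realType) (B : 'M[R]_2) (eta : R) :
  B != 0 -> 0 < eta <= 1 -> `|\det B| <= eta ^+ 3 * l1norm B ^+ 2 ->
  exists2 P : 'M[R]_2, P \in unitmx &
    [/\ l1norm P <= 3, l1norm (invmx P) <= 3 & aligns eta B P].
Proof.
move=> B0 /andP[eta0 eta1] detB; have nB := l1norm_gt0 B0.
have [P uP [nP nP' hP]] := contracted_basis B0.
exists P => //; split=> // X Q Y Z z XE [nX nYX nXZ] hstart hend hz hY hZ.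
set G := invmx P *m X *m P.
have c0 : 0 < eta ^+ 2 by rewrite exprn_gt0.
set s := col 1 P.
have sE : s = P *m delta_mx 1 0 by rewrite /s colE.
have ns : l1norm s <= 3.
  exact: le_trans (l1norm_col_le _ _) nP.
have Bs : l1norm (B *m s) <= 4 * eta ^+ 3 * l1norm B.
  rewrite sE mulmxA -colE; apply: le_trans hP _; rewrite ler_pdivrMr//.
  move: detB; rewrite expr2; move: (`|_|) (l1norm B) (eta ^+ 3) => a b c; lra.
have Xs : l1norm (X *m s) <= eta ^+ 2 / 100 * l1norm X.
  have h1 : l1norm (Y *m X *m s) <= eta ^+ 2 / 100 / 2 * l1norm (Y *m X).
    rewrite XE -!mulmxA (mulmxA Y Q); apply: le_trans (l1normM _ _) _.
    apply: le_trans (ler_wpM2l (l1norm_ge0 _) Bs) _; rewrite mulmxA.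
    rewrite -(mulmxA Y) -XE; have := mulr_ge0 (ltW c0) (ltW nYX).
    have := ler_wpM2l (ltW c0) hstart.
    rewrite -[eta ^+ 3]/(eta * eta ^+ 2); move: (l1norm (Y *m Q)) => a.
    by move: (l1norm (Y *m X)) (l1norm B) (eta ^+ 2) => b c d; lra.
  have := quasi_multiplicative_ge Y X s.
  have h2 := ler_wpM2r (l1norm_ge0 X) h1.
  have h3 : `|\det X| * (l1norm Y * l1norm s) <= eta ^+ 2 / 100 / 10 * (l1norm X * l1norm (Y *m X)).
    apply: (@le_trans _ _ (`|\det X| * (l1norm Y * 3))).
      by do 2 (rewrite ler_wpM2l ?l1norm_ge0//).
    apply: le_trans hY _; rewrite ler_wpM2r// mulr_ge0// ltW//.
  move=> h4; rewrite -(ler_pM2r nYX).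
  have h5 : 0 <= eta ^+ 2 * (l1norm X * l1norm (Y *m X)) by rewrite !mulr_ge0 ?l1norm_ge0// ltW.
  move: h2 h3 h4 h5; move: (l1norm (X *m s)) (l1norm (Y *m X)) (l1norm X) (eta ^+ 2)
    (`|\det X| * _) (l1norm (Y *m X *m s)) => a b c d e f; lra.
have BX : 18 * (36 * eta) * l1norm B * l1norm X <= l1norm (B *m X).
  have h1 := quasi_multiplicative_le B X Z.
  have h2 := ler_wpM2r (l1norm_ge0 X) hend.
  have h3 := ler_wpM2l (ltW nB) hZ.
  have h4 : z <= 18 * (36 * eta).
    apply: le_trans hz _; have : eta ^+ 2 <= eta by rewrite expr2 ler_piMl// ltW.
    lra.
  have h5 : z * (l1norm B * (l1norm X * l1norm (X *m Z))) <=
     18 * (36 * eta) * (l1norm B * (l1norm X * l1norm (X *m Z))).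
    by rewrite ler_wpM2r// !mulr_ge0// ltW.
  rewrite -(ler_pM2r nXZ).
  move: h1 h2 h3 h5; move: (`|\det X|) (l1norm (B *m X *m Z)) (l1norm (B *m X))
     (l1norm X) (l1norm B) (l1norm (X *m Z)) (l1norm Z) => a b c d e f g; lra.
have XE' : X = P *m G *m invmx P.
  by rewrite /G !mulmxA mulmxV// mul1mx -mulmxA mulmxV// mulmx1.
have GX : l1norm X <= 9 * l1norm G.
  rewrite XE'; apply: le_trans (l1normM _ _) _.
  have h : l1norm (P *m G) <= 3 * l1norm G.
    by apply: le_trans (l1normM _ _) _; rewrite ler_wpM2r// l1norm_ge0.
  apply: (@le_trans _ _ (3 * l1norm G * 3)); last by rewrite mulrAC; lra.
  by apply: ler_pM => //; exact: l1norm_ge0.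
have XG : l1norm G <= 9 * l1norm X.
  apply: le_trans (l1normM _ _) _.
  have h : l1norm (invmx P *m X) <= 3 * l1norm X.
    by apply: le_trans (l1normM _ _) _; rewrite ler_wpM2r// l1norm_ge0.
  apply: (@le_trans _ _ (3 * l1norm X * 3)); last by rewrite mulrAC; lra.
  by apply: ler_pM => //; exact: l1norm_ge0.
have G1 : `|G 0 1| + `|G 1 1| <= 3 * l1norm (X *m s).
  have <- : l1norm (invmx P *m (X *m s)) = `|G 0 1| + `|G 1 1|.
    by rewrite sE !mulmxA -/G -colE l1norm_col2E !mxE.
  by apply: le_trans (l1normM _ _) _; rewrite ler_wpM2r// l1norm_ge0.
have nG := l1norm_ge0 G.
have om23 : eta ^+ 2 <= eta by rewrite expr2 ler_piMl// ltW.
have om3 : eta ^+ 3 <= eta 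
  by rewrite -[eta ^+ 3]/(eta * eta ^+ 2); apply: ler_piMr; [exact: ltW|exact: le_trans om23 eta1].
have dom1 : `|G 0 1| + `|G 1 1| <= eta ^+ 2 * l1norm G.
  apply: le_trans G1 _.  have := ler_wpM2l (ltW c0) GX; move: Xs.
  have := mulr_ge0 (ltW c0) nG.
  move: (l1norm (X *m s)) (eta ^+ 2) (l1norm X) (l1norm G) => a b c d; lra.
split => //.
have h1 : l1norm (B *m X) <= 3 * l1norm (B *m P *m G).
  rewrite {1}XE' !mulmxA mulrC; apply: le_trans (l1normM _ _) _.
  by rewrite ler_wpM2l// l1norm_ge0.
have BPG : B *m P *m G = (B *m P *m delta_mx 0 0) *m row 0 G + (B *m s) *m row 1 G.
  by rewrite mulmx_col_row (colE 0) (colE 1) sE (mulmxA B).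
have r0 : l1norm (row 0 G) = `|G 0 0| + `|G 0 1|.
  by rewrite /l1norm big_ord1 sum_ord2 !(mxE _ (fun _ j => G 0 j)).
have r1 : l1norm (row 1 G) <= l1norm G.
  exact: l1norm_row_le.
have h2 : l1norm (B *m P *m G) <= l1norm B * 3 * (`|G 0 0| + `|G 0 1|) +
    4 * eta ^+ 3 * l1norm B * l1norm G.
  rewrite {1}BPG; apply: le_trans (l1normD _ _) _; apply: lerD.
    rewrite -r0; apply: le_trans (l1normM _ _) _; rewrite ler_wpM2r ?l1norm_ge0//.
    rewrite -mulmxA; apply: le_trans (l1normM _ _) _; rewrite ler_wpM2l ?l1norm_ge0//.
    by rewrite -colE; exact: le_trans (l1norm_col_le _ _) nP.
  apply: le_trans (l1normM _ _) _; apply: ler_pM => //; exact: l1norm_ge0.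
have h3 : 18 * (36 * eta) * l1norm X <= 3 * (3 * (`|G 0 0| + `|G 0 1|) + 4 * eta ^+ 3 * l1norm G).
  rewrite -(ler_pM2l nB); move: BX h1 h2; clear.
  move: (l1norm (B *m X)) (l1norm (B *m P *m G)) (l1norm B) (l1norm X) (l1norm G)
    (`|G 0 0|) (`|G 0 1|) (eta ^+ 3) => a b c d e f g h; lra.
have h4 := ler_wpM2l (ltW eta0) XG.
have h5 := ler_wpM2r nG om3.
have h6 := ler_wpM2r nG om23.
have h7 := normr_ge0 (G 1 1).
have h8 := mulr_ge0 (ltW eta0) nG.
move: h3 h4 h5 h6 h7 h8 dom1; clear.
move: (l1norm X) (l1norm G) (`|G 0 0|) (`|G 0 1|) (`|G 1 1|) (eta ^+ 3) (eta ^+ 2).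
by move=> a b c d e f g; lra.
Qed.

Section Words.
Variables (R : realType) (M : nat) (A : 'I_M.+1 -> 'M[R]_2).
Hypothesis hA : forall j, A j \in unitmx.
Notation letter := 'I_M.+1.
Notation Aw := (word_matrix A).

Lemma foldl_word_matrix (B : 'M[R]_2) (w : seq letter) :
  foldl (fun B j => A j *m B) B w = Aw w *m B.
Proof.
elim: w B => [|a w IH] B /=; first by rewrite /word_matrix /= mul1mx.
by rewrite IH [in RHS]/word_matrix /= IH mulmx1 mulmxA.
Qed.

Lemma word_matrix_cat u v : Aw (u ++ v) = Aw v *m Aw u.
Proof. by rewrite {1}/word_matrix foldl_cat foldl_word_matrix. Qed.

Lemma word_matrix1 a : Aw [:: a] = A a.
Proof. by rewrite /word_matrix /= mulmx1. Qed.

Lemma word_matrix_unit w : Aw w \in unitmx.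
Proof.
elim/last_ind: w => [|w a IH]; first by rewrite unitmx1.
by rewrite -cats1 word_matrix_cat unitmx_mul word_matrix1 hA.
Qed.

Lemma unitmx2_neq0 (X : 'M[R]_2) : X \in unitmx -> X != 0.
Proof. by apply: contraTneq => ->; rewrite unitmxE det0 unitr0. Qed.

Lemma word_matrix_neq0 w : Aw w != 0.
Proof. exact/unitmx2_neq0/word_matrix_unit. Qed.

Definition log_norm w : R := ln (l1norm (Aw w)).

Definition log_det w : R := ln `|\det (Aw w)|.

Lemma l1norm_word_gt0 w : 0 < l1norm (Aw w).
Proof. exact/l1norm_gt0/word_matrix_neq0. Qed.

Lemma expR_log_norm w : expR (log_norm w) = l1norm (Aw w).
Proof. by rewrite lnK// posrE l1norm_word_gt0. Qed.

Lemma abs_det_word_gt0 w : 0 < `|\det (Aw w)|.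
Proof. by rewrite normr_gt0 -unitfE -unitmxE word_matrix_unit. Qed.

Lemma expR_log_det w : expR (log_det w) = `|\det (Aw w)|.
Proof. by rewrite lnK// posrE abs_det_word_gt0. Qed.

Lemma log_norm_cat_le u v : log_norm (u ++ v) <= log_norm u + log_norm v.
Proof.
rewrite /log_norm word_matrix_cat -lnM ?posrE ?l1norm_word_gt0//.
rewrite ler_ln ?posrE ?mulr_gt0 ?l1norm_word_gt0//.
  by rewrite mulrC l1normM.
by rewrite -word_matrix_cat l1norm_word_gt0.
Qed.

Lemma log_det_cat u v : log_det (u ++ v) = log_det u + log_det v.
Proof.
rewrite /log_det word_matrix_cat det_mulmx normrM lnM ?posrE ?abs_det_word_gt0//.
exact: addrC.
Qed.

(** A letter changes the logarithm by a bounded amount, on either side, because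
    its matrix is invertible. *)
Lemma log_norm_bound : exists2 C : R, 1 <= C & forall u v,
  [/\ log_norm u - C * (size v)%:R <= log_norm (u ++ v),
      log_norm v - C * (size u)%:R <= log_norm (u ++ v),
      log_norm (u ++ v) <= log_norm u + C * (size v)%:R &
      log_norm (u ++ v) <= log_norm v + C * (size u)%:R] /\
  `|log_norm [::]| <= C.
Proof.
pose C : R := 1 + \sum_j (`|ln (l1norm (A j))| + `|ln (l1norm (invmx (A j)))|).
have bnd j : `|ln (l1norm (A j))| <= C /\ `|ln (l1norm (invmx (A j)))| <= C.
  rewrite /C (bigD1 j)//=; set t := \sum_(_ | _) _.
  have t0 : 0 <= t by apply: sumr_ge0 => i _; rewrite addr_ge0.
  have := normr_ge0 (ln (l1norm (A j))).
  have := normr_ge0 (ln (l1norm (invmx (A j)))); lra.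
have C1 : 1 <= C by rewrite lerDl sumr_ge0// => i _; rewrite addr_ge0.
have nAi j : 0 < l1norm (invmx (A j)) by rewrite l1norm_gt0// unitmx2_neq0// unitmx_inv.
have nA j : 0 < l1norm (A j) by rewrite l1norm_gt0// unitmx2_neq0.
have up1 a : log_norm [:: a] <= C.
  by rewrite /log_norm word_matrix1; apply: le_trans (ler_norm _) (bnd a).1.
have r1 u a : log_norm u - C <= log_norm (u ++ [:: a]).
  rewrite /log_norm word_matrix_cat word_matrix1 lerBlDr.
  have {1}-> : Aw u = invmx (A a) *m (A a *m Aw u) by rewrite mulKmx.
  have n0 : 0 < l1norm (A a *m Aw u).
    by rewrite -(word_matrix1 a) -word_matrix_cat l1norm_word_gt0.
  apply: (@le_trans _ _ (ln (l1norm (invmx (A a)) * l1norm (A a *m Aw u)))).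
    rewrite ler_ln ?posrE ?mulr_gt0 ?l1normM//.
    by rewrite mulKmx// l1norm_word_gt0.
  rewrite lnM ?posrE// addrC lerD2l.
  by apply: le_trans (ler_norm _) (bnd a).2.
have l1 u a : log_norm u - C <= log_norm (a :: u).
  rewrite /log_norm -cat1s word_matrix_cat word_matrix1 lerBlDr.
  have {1}-> : Aw u = Aw u *m A a *m invmx (A a) by rewrite mulmxK.
  have n0 : 0 < l1norm (Aw u *m A a).
    by rewrite -(word_matrix1 a) -word_matrix_cat l1norm_word_gt0.
  apply: (@le_trans _ _ (ln (l1norm (Aw u *m A a) * l1norm (invmx (A a))))).
    rewrite ler_ln ?posrE ?mulr_gt0 ?l1normM//.
    by rewrite mulmxK// l1norm_word_gt0.
  rewrite lnM ?posrE// lerD2l.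
  by apply: le_trans (ler_norm _) (bnd a).2.
exists C => // u v; split; last first.
  rewrite /log_norm /word_matrix /= l1norm2E !mxE /= !normr0 !normr1 addr0 add0r.
  have p2 : 0 < 1 + 1 :> R by lra.
  rewrite ger0_norm; last by rewrite ln_ge0//; lra.
  by apply: le_trans C1; have := ln_le_sub1 p2; lra.
split.
- elim/last_ind: v => [|v a IH]; first by rewrite cats0 mulr0 subr0.
  rewrite -cats1 catA; apply: le_trans (r1 _ a); rewrite size_cat natrD mulrDr mulr1.
  by move: IH; lra.
- elim: u => [|a u IH]; first by rewrite mulr0 subr0.
  rewrite cat_cons; apply: le_trans (l1 _ a) => /=.
  by rewrite -natr1 mulrDr mulr1; move: IH; lra.
- elim/last_ind: v => [|v a IH]; first by rewrite cats0 mulr0 addr0.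
  rewrite -cats1 catA; apply: le_trans (log_norm_cat_le _ _) _.
  by rewrite size_cat natrD mulrDr mulr1; have := up1 a; move: IH; lra.
- elim: u => [|a u IH]; first by rewrite mulr0 addr0.
  rewrite cat_cons -cat1s; apply: le_trans (log_norm_cat_le _ _) _.
  by rewrite /= -natr1 mulrDr mulr1; have := up1 a; move: IH; lra.
Qed.

Lemma log_det_le w : log_det w <= 2 * log_norm w.
Proof.
rewrite [2 * _](_ : _ = log_norm w + log_norm w); last by ring.
rewrite -lnM ?posrE ?l1norm_word_gt0//.
rewrite ler_ln ?posrE ?mulr_gt0 ?l1norm_word_gt0 ?abs_det_word_gt0//.
by rewrite -expr2 det_le_l1norm.
Qed.

Lemma log_det_bound : exists2 C : R, 1 <= C & forall w, `|log_det w| <= C * (size w)%:R.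
Proof.
pose C : R := 1 + \sum_j `|log_det [:: j]|.
exists C; first by rewrite lerDl sumr_ge0.
elim=> [|a w IH].
  by rewrite /log_det /word_matrix /= det1 normr1 ln1 normr0 mulr0.
rewrite -cat1s log_det_cat; apply: le_trans (ler_normD _ _) _.
rewrite /= -natr1 mulrDr mulr1 addrC lerD// /C (bigD1 a)//=.
have : 0 <= \sum_(i < M.+1 | i != a) `|log_det [:: i]| by exact: sumr_ge0.
by move: (`|_|) => b; lra.
Qed.

End Words.

(** * Counting the places where a subadditive sequence loses much *)

Section LossCounting.
Variables (R : realType) (f : nat -> nat -> R) (C : R) (l N : nat).
Hypothesis C0 : 0 <= C.
Hypothesis f_left : forall i m n, f i m - C * n%:R <= f i (m + n).
Hypothesis f_bound : forall i n, f i n <= C * n.+1%:R.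
Hypothesis f_sub : forall i m n, f i (m + n) <= f i m + f (i + m) n.

(** The number [f i m] stands for the logarithm of the norm along the times from
    [i] to [i + m]. The loss is the defect of additivity when a window of length
    [l] at time [t] is split off from the part of the orbit up to its end, or
    from the part that starts with it. *)
Definition loss_at_end t := f t l + f 0 t - f 0 (t + l).
Definition loss_at_start t :=
  f t l + f (t + l) (N + l - (t + l)) - f t (N + l - t).

Lemma telescope_shift (g : nat -> R) :
  \sum_(t < N) (g (t + l)%N - g t) = \sum_(i < l) (g (N + i)%N - g i).
Proof.
elim: N => [|n IH]; first by rewrite big_ord0 big1// => i _; rewrite subrr.
rewrite big_ord_recr /= IH.
have shift : \sum_(i < l) (g (n.+1 + i)%N - g (n + i)%N) = g (n + l)%N - g n.
  elim: l => [|k IHk]; first by rewrite big_ord0 addn0 subrr.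
  by rewrite big_ord_recr /= IHk addSnnS addnS; ring.
rewrite -shift -big_split; apply: eq_bigr => i _ /=; ring.
Qed.

(** The sum of the values of prefixes telescopes and leaves [l] times the value
    of the whole orbit, up to a bounded error. *)
Lemma sum_loss_at_end : \sum_(t < N) loss_at_end t <=
  \sum_(t < N) f t l - l%:R * f 0 N + l%:R * (3 * C * l.+1%:R).
Proof.
have -> : \sum_(t < N) loss_at_end t =
   \sum_(t < N) f t l - \sum_(t < N) (f 0 (t + l)%N - f 0 t).
  by rewrite -sumrB; apply: eq_bigr => t _; rewrite /loss_at_end; ring.
rewrite (telescope_shift (f 0)) -addrA lerD2l.
have : \sum_(i < l) (f 0 N - 3 * C * l.+1%:R) <= \sum_(i < l) (f 0 (N + i)%N - f 0 i).
  apply: ler_sum => i _; have := f_left 0 N i; have := f_bound 0 i.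
  have h1 : C * i%:R <= C * l.+1%:R by rewrite ler_wpM2l// ler_nat ltnW// ltnS ltnW.
  have h2 : C * i.+1%:R <= C * l.+1%:R by rewrite ler_wpM2l// ler_nat ltnS ltnW.
  have h3 : 0 <= C * l.+1%:R by rewrite mulr_ge0.
  by move: h1 h2 h3; lra.
rewrite sumr_const card_ord -[_ *+ _]mulr_natl mulrBr; lra.
Qed.

Lemma sum_loss_at_start : \sum_(t < N) loss_at_start t <=
  \sum_(t < N) f t l - l%:R * f 0 N + l%:R * (3 * C * l.+1%:R).
Proof.
pose g t := f t (N + l - t)%N.
have -> : \sum_(t < N) loss_at_start t =
   \sum_(t < N) f t l + \sum_(t < N) (g (t + l)%N - g t).
  by rewrite -big_split; apply: eq_bigr => t _; rewrite /loss_at_start /g /=; ring.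
rewrite (telescope_shift g) -addrA lerD2l.
have : \sum_(i < l) (g (N + i)%N - g i) <= \sum_(i < l) (3 * C * l.+1%:R - f 0 N).
  apply: ler_sum => i _; rewrite /g.
  have il : (N + l - i = N - i + l)%N \/ (N <= i)%N.
    by have := ltn_ord i; case: (leqP N i) => [?|?]; [right|left]; lia.
  have -> : (N + l - (N + i) = l - i)%N by lia.
  have hA := f_bound (N + i) (l - i)%N.
  have hB := f_left 0 N l.
  have e0 : f 0 (N + l) <= f 0 i + f i (N + l - i).
    have := f_sub 0 i (N + l - i); rewrite add0n subnKC//.
    by have := ltn_ord i; lia.
  have hD := f_bound 0 i.
  have h1 : C * (l - i).+1%:R + C * i%:R <= C * l.+1%:R.
    by rewrite -mulrDr ler_wpM2l// -natrD ler_nat; have := ltn_ord i; lia.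
  have h2 : C * i.+1%:R <= C * l.+1%:R by rewrite ler_wpM2l// ler_nat ltnS ltnW.
  have h3 : C * l%:R <= C * l.+1%:R by rewrite ler_wpM2l// ler_nat.
  have h4 : 0 <= C * i%:R by rewrite mulr_ge0.
  by move: hA hB e0 hD h1 h2 h3 h4; lra.
rewrite sumr_const card_ord -[_ *+ _]mulr_natl mulrBr; lra.
Qed.

Lemma loss_at_end_ge0 t : 0 <= loss_at_end t.
Proof. by have := f_sub 0 t l; rewrite /loss_at_end add0n; lra. Qed.

Lemma loss_at_start_ge0 t : (t < N)%N -> 0 <= loss_at_start t.
Proof.
move=> tN; have := f_sub t l (N + l - (t + l))%N; rewrite /loss_at_start.
have -> : (l + (N + l - (t + l)) = N + l - t)%N by lia.
by lra.
Qed.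

Lemma markov_count (h : nat -> R) (c : R) : 0 <= c ->
  (forall t, (t < N)%N -> 0 <= h t) ->
  c * \sum_(t < N) (c < h t)%R%:R <= \sum_(t < N) h t.
Proof.
move=> c0 h0; rewrite mulr_sumr; apply: ler_sum => t _.
by case: ltP => [/ltW|_]; rewrite ?mulr1// mulr0; exact: h0.
Qed.

End LossCounting.

Section CommonState.
Variables (R : realType) (W : finType) (blk : nat -> W) (good : {set W}).
Variables (p : {set W} -> R) (startok endok : pred nat) (a s : nat).

(** Otherwise the good states would be the union of those that occur in the first
    window with bad start only and those that occur in the last with bad end
    only; each of these sets is rarely visited, hence has small weight. *)
Lemma common_state :
  (forall X Y, p (X :|: Y) <= p X + p Y) -> 7 / 8 <= p good ->
  (forall X, a%:R * (p X - 8^-1) <= \sum_(t < a) (blk t \in X)%:R) ->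
  (forall X, a%:R * (p X - 8^-1) <= \sum_(t < a) (blk (s + t)%N \in X)%:R) ->
  \sum_(t < a) (~~ startok t)%:R < a%:R / 4 :> R ->
  \sum_(t < a) (~~ endok (s + t)%N)%:R < a%:R / 4 :> R ->
  exists j m, [/\ (j < a)%N, (m < a)%N, blk j = blk (s + m)%N, blk j \in good &
                  startok j && endok (s + m)%N].
Proof.
move=> psub pg f1 f2 b1 b2; apply: contrapT => hn.
pose X := [set w in good | [forall t : 'I_a, (blk t == w) ==> ~~ startok t]]%SET.
pose Y := [set w in good | [forall t : 'I_a, (blk (s + t)%N == w) ==> ~~ endok (s + t)%N]]%SET.
have XY : X :|: Y = good.
  apply/setP => w; rewrite !inE -andb_orr; case wg : (w \in good) => //=.
  apply: contrapT => /negP; rewrite negb_or !negb_forall => /andP[].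
  move=> /existsP[j]; rewrite negb_imply negbK => /andP[/eqP jw js].
  move=> /existsP[m]; rewrite negb_imply negbK => /andP[/eqP mw me].
  by apply: hn; exists j, m; split; rewrite ?ltn_ord ?jw ?mw ?wg ?js ?me.
have cX : \sum_(t < a) (blk t \in X)%:R <= \sum_(t < a) (~~ startok t)%:R :> R.
  apply: ler_sum => t _; rewrite ler_nat inE.
  case: (boolP [forall _, _]); last by rewrite andbF.
  by move=> /forallP/(_ t); rewrite eqxx /= => ->; rewrite leq_b1.
have cY : \sum_(t < a) (blk (s + t)%N \in Y)%:R <= \sum_(t < a) (~~ endok (s + t)%N)%:R :> R.
  apply: ler_sum => t _; rewrite ler_nat inE.
  case: (boolP [forall _, _]); last by rewrite andbF.
  by move=> /forallP/(_ t); rewrite eqxx /= => ->; rewrite leq_b1.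
have := psub X Y; rewrite XY => hXY.
have h1 := le_trans (f1 X) cX; have h2 := le_trans (f2 Y) cY.
have a0 : 0 <= a%:R :> R by [].
have h3 := ler_wpM2l a0 (le_trans pg hXY).
by move: h1 h2 h3 b1 b2 a0; clear; move: (a%:R : R) (p X) (p Y) => x y z; lra.
Qed.

End CommonState.

(** * Invariance of integrals, the Fekete lemma, singular values *)

Lemma Rintegral_iter (d : measure_display) (T : measurableType d) (R : realType)
    (mu : probability T R) (f : T -> T) (g : T -> R) (K : R) n :
  measurable_fun setT f -> invariant_measure f mu -> measurable_fun setT g ->
  (forall x, `|g x| <= K) -> \int[mu]_x g (iter n f x) = \int[mu]_x g x.
Proof.
move=> mf inv mg gK; have mn := measurable_iter mf n.
have mgn : measurable_fun setT (g \o iter n f) by exact: measurableT_comp.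
rewrite /Rintegral; congr fine.
have := @integral_pushforward _ _ _ _ R _ mn mu setT (EFin \o g).
rewrite preimage_setT => <- //; last 2 first.
- exact/measurable_EFinP.
- by apply: (@bounded_integrable _ _ _ mu (g \o iter n f) K) => // x; exact: gK.
apply: eq_measure_integral => B mB _; transitivity (mu (iter n f @^-1` B)) => //.
transitivity ((prob mu B)%:E); last exact/esym/probE.
rewrite -(prob_preimage_iter mf inv n mB).
exact/probE/measurable_preimage_iter.
Qed.

Section Fekete.
Variable R : realType.

Lemma fekete (u : nat -> R) (c : R) :
  (forall m n, u (m + n)%N <= u m + u n) ->
  (forall n, - (c * n.+1%:R) <= u n) ->
  exists2 lam : R, (forall n, n%:R * lam <= u n) &
    n%:R^-1 * u n @[n --> \oo] --> lam.
Proof.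
move=> subu lbu.
pose E : set R := [set n.+1%:R^-1 * u n.+1 | n in [set: nat]].
have E0 : E !=set0 by exists (1%:R^-1 * u 1%N); exists 0%N.
have Elb : has_lbound E.
  exists (- (`|c| * 2)) => _ [n _ <-].
  rewrite ler_pdivlMl ?ltr0Sn//; apply: le_trans (lbu n.+1).
  rewrite mulrN lerN2; apply: (@le_trans _ _ (`|c| * n.+2%:R)).
    by rewrite ler_wpM2r// ler_norm.
  rewrite mulrCA ler_wpM2l// -natrM ler_nat; lia.
exists (inf E).
  move=> [|n].
    by rewrite mul0r; have := subu 0%N 0%N; rewrite addn0; lra.
  rewrite -ler_pdivlMl ?ltr0Sn//; apply: ge_inf => //; by exists n.
apply/cvgrPdist_le => /= e e0.
have [_ [k _ <-] hk] : exists2 x, E x & x < inf E + e / 2.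
  by apply: inf_adherent; [rewrite divr_gt0|split].
set lam := inf E in hk *.
pose B := \sum_(r < k.+1) `|u r|.
have B0 : 0 <= B by apply: sumr_ge0.
have hB r : (r < k.+1)%N -> u r <= B.
  move=> rk; apply: le_trans (ler_norm _) _.
  by rewrite /B (bigD1 (Ordinal rk))//= lerDl; apply: sumr_ge0.
have hq q r : u (q * k.+1 + r)%N <= q%:R * u k.+1 + u r.
  elim: q => [|q IH]; first by rewrite mul0n mul0r add0n add0r.
  rewrite mulSn -addnA; apply: le_trans (subu _ _) _.
  by rewrite -[q.+1]addn1 natrD mulrDl mul1r; move: IH; lra.
pose K : R := B + k.+1%:R * `|lam + e / 2|.
have K0 : 0 <= K by rewrite addr_ge0// mulr_ge0.
exists (Num.bound (K / (e / 2))).+1 => // n /= hn.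
have n0 : 0 < n%:R :> R by rewrite ltr0n; apply: leq_trans hn.
have lo : lam <= n%:R^-1 * u n.
  case: n n0 {hn} => [|n _]; first by rewrite ltxx.
  by apply: ge_inf => //; exists n.
have hi : u n <= n%:R * (lam + e / 2) + K.
  have rk : (n %% k.+1 < k.+1)%N by rewrite ltn_mod.
  have := hq (n %/ k.+1)%N (n %% k.+1)%N; rewrite -divn_eq => h.
  have hk' : u k.+1 <= k.+1%:R * (lam + e / 2).
    by rewrite -ler_pdivrMl ?ltr0Sn// ltW.
  have h1 : (n %/ k.+1)%:R * u k.+1 <= (n %/ k.+1)%:R * (k.+1%:R * (lam + e / 2)).
    by rewrite ler_wpM2l.
  have h2 : n%:R = (n %/ k.+1)%:R * k.+1%:R + (n %% k.+1)%:R :> R.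
    by rewrite -natrM -natrD -divn_eq.
  have h3 : - ((n %% k.+1)%:R * (lam + e / 2)) <= k.+1%:R * `|lam + e / 2|.
    apply: (@le_trans _ _ ((n %% k.+1)%:R * `|lam + e / 2|)).
      by rewrite -mulrN ler_wpM2l// ler_normr lexx orbT.
    by rewrite ler_wpM2r// ler_nat ltnW.
  have h4 := hB _ rk.
  rewrite h2 /K; move: h h1 h3 h4; clear; lra.
have hK : K <= n%:R * (e / 2).
  rewrite -ler_pdivrMr ?divr_gt0//.
  apply/ltW; apply: lt_le_trans (archi_boundP _) _.
    by rewrite divr_ge0// divr_ge0// ltW.
  by rewrite ler_nat ltnW.
rewrite distrC ger0_norm ?subr_ge0// lerBlDr ler_pdivrMl//.
move: hi hK; clear; lra.
Qed.

End Fekete.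

Section SingularValues.
Variable R : realType.

Lemma eigenvalue2P (S : 'M[R]_2) (t : R) :
  eigenvalue S t <-> t ^+ 2 - (S 0 0 + S 1 1) * t + \det S = 0.
Proof.
have -> : t ^+ 2 - (S 0 0 + S 1 1) * t + \det S = \det (S - t%:M).
  by rewrite !det2E !mxE /= mulr1n mulr0n !subr0; ring.
split=> [/eigenvalueP[v hv v0]|/eqP/det0P[v v0 hv]].
  apply/eqP/det0P; exists v => //.
  by rewrite mulmxBr hv mul_mx_scalar subrr.
apply/eigenvalueP; exists v => //; apply/eqP; rewrite -subr_eq0.
by rewrite -mul_mx_scalar -mulmxBr hv.
Qed.

(** The eigenvalues of [B^T *m B] are the roots of a quadratic polynomial with
    product [\det B ^+ 2] and with sum the sum of the squares of the entries. *)
Lemma singular_values_bounds (B : 'M[R]_2) : B \in unitmx ->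
  [/\ 0 < alpha1 B, 0 < alpha2 B, alpha1 B * alpha2 B = `|\det B|,
      alpha1 B <= l1norm B & l1norm B <= 4 * alpha1 B].
Proof.
move=> uB; set S := B^T *m B.
pose p := S 0 0 + S 1 1; pose q := \det B ^+ 2.
have S00 : S 0 0 = B 0 0 ^+ 2 + B 1 0 ^+ 2 by rewrite mulmx2E !mxE; ring.
have S11 : S 1 1 = B 0 1 ^+ 2 + B 1 1 ^+ 2 by rewrite mulmx2E !mxE; ring.
have dS : \det S = q by rewrite det_mulmx det_tr.
have d0 : \det B != 0 by rewrite -unitfE -unitmxE.
have q0 : 0 < q by rewrite lt_def sqr_ge0 andbT expf_neq0.
have D0 : 0 <= p ^+ 2 - 4 * q.
  rewrite /p /q S00 S11 det2E.
  have -> : (B 0 0 ^+ 2 + B 1 0 ^+ 2 + (B 0 1 ^+ 2 + B 1 1 ^+ 2)) ^+ 2 -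
    4 * (B 0 0 * B 1 1 - B 0 1 * B 1 0) ^+ 2 =
    ((B 0 0 - B 1 1) ^+ 2 + (B 1 0 + B 0 1) ^+ 2) *
    ((B 0 0 + B 1 1) ^+ 2 + (B 1 0 - B 0 1) ^+ 2) by ring.
  by rewrite mulr_ge0 ?addr_ge0 ?sqr_ge0.
pose r := Num.sqrt (p ^+ 2 - 4 * q).
have r0 : 0 <= r by exact: sqrtr_ge0.
have r2 : r ^+ 2 = p ^+ 2 - 4 * q by rewrite sqr_sqrtr.
have p0 : 0 < p.
  have p0 : 0 <= p by rewrite /p S00 S11 !addr_ge0 ?sqr_ge0.
  rewrite lt_def p0 andbT; apply: contraTneq q0 => p00; rewrite -leNgt.
  by move: D0; rewrite p00; lra.
have rp : r < p.
  rewrite -(ltr_pXn2r (n := 2)) ?nnegrE ?(ltW p0)// r2; lra.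
pose t1 := (p + r) / 2; pose t2 := (p - r) / 2.
have t2pos : 0 < t2 by rewrite divr_gt0// subr_gt0.
have t12 : t2 <= t1 by rewrite /t1 /t2; lra.
have t1pos : 0 < t1 by exact: lt_le_trans t12.
have tq : t1 * t2 = q.
  have -> : t1 * t2 = (p ^+ 2 - r ^+ 2) / 4 by rewrite /t1 /t2; field.
  by rewrite r2; field.
have eig t : eigenvalue S t <-> t = t1 \/ t = t2.
  rewrite eigenvalue2P dS -/p.
  have -> : t ^+ 2 - p * t + q = (t - t1) * (t - t2).
    by rewrite -tq /t1 /t2; field.
  split=> [/eqP|[->|->]]; last 2 first.
  - by rewrite subrr mul0r.
  - by rewrite subrr mulr0.
  by rewrite mulf_eq0 !subr_eq0 => /orP[]/eqP; [left|right].
have sv : singular_values B = [set Num.sqrt t1; Num.sqrt t2].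
  apply/seteqP; split => [_ [t /= /eig[->|->] <-]|_ [->|->]]; [by left|by right| |].
  - by exists t1 => //=; apply/eig; left.
  - by exists t2 => //=; apply/eig; right.
have s12 : Num.sqrt t2 <= Num.sqrt t1 by rewrite ler_wsqrtr.
have a1 : alpha1 B = Num.sqrt t1.
  rewrite /alpha1 sv; apply/eqP; rewrite eq_le; apply/andP; split.
    by apply: ge_sup => [|_ [->|->]//]; exists (Num.sqrt t1); left.
  by apply: ub_le_sup; [exists (Num.sqrt t1) => _ [->|->]|left].
have a2 : alpha2 B = Num.sqrt t2.
  rewrite /alpha2 sv; apply/eqP; rewrite eq_le; apply/andP; split.
    by apply: ge_inf; [exists (Num.sqrt t2) => _ [->|->]|right].
  by apply: lb_le_inf => [|_ [->|->]//]; exists (Num.sqrt t1); left.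
have nB0 := l1norm_ge0 B.
have a10 : 0 <= Num.sqrt t1 by exact: sqrtr_ge0.
have sq1 : Num.sqrt t1 ^+ 2 = t1 by rewrite sqr_sqrtr// ltW.
have pn : p <= l1norm B ^+ 2 /\ l1norm B ^+ 2 <= 4 * p.
  rewrite /p S00 S11 l1norm2E -!(real_normK (num_real (B _ _))).
  move: (normr_ge0 (B 0 0)) (normr_ge0 (B 0 1)) (normr_ge0 (B 1 0)) (normr_ge0 (B 1 1)).
  move: (`|_|) (`|_|) (`|_|) (`|_|) => a b c d a0 b0 c0 d0'.
  split.
    have : 0 <= a * b /\ 0 <= c * d by rewrite !mulr_ge0.
    have : 0 <= a * c /\ 0 <= b * d by rewrite !mulr_ge0.
    have : 0 <= a * d /\ 0 <= b * c by rewrite !mulr_ge0.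
    move=> [? ?] [? ?] [? ?]; rewrite !expr2; lra.
  have := sqr_ge0 (a - b); have := sqr_ge0 (c - d); have := sqr_ge0 (a - c).
  have := sqr_ge0 (b - d); have := sqr_ge0 (a - d); have := sqr_ge0 (b - c).
  by rewrite !expr2; lra.
split.
- by rewrite a1 sqrtr_gt0.
- by rewrite a2 sqrtr_gt0.
- by rewrite a1 a2 -sqrtrM ?(ltW t1pos)// tq sqrtr_sqr.
- rewrite a1 -(ler_pXn2r (n := 2)) ?nnegrE// sq1.
  by apply: le_trans pn.1; rewrite /t1; lra.
- rewrite a1 -(ler_pXn2r (n := 2)) ?nnegrE ?mulr_ge0// exprMn sq1.
  by apply: le_trans pn.2 _; rewrite /t1 expr2; lra.
Qed.

End SingularValues.

(** * Lyapunov exponents in terms of norms and determinants *)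

Section Lyapunov.
Variables (R : realType) (M : nat) (A : 'I_M.+1 -> 'M[R]_2).
Hypothesis hA : forall j, A j \in unitmx.
Notation X := (borel_shift_space M).
Notation T := (@left_shift M).

Lemma mkseq_add (x : X) m n :
  mkseq x (m + n) = mkseq x m ++ mkseq (iter m T x) n.
Proof.
rewrite /mkseq iotaD map_cat add0n; congr (_ ++ _).
rewrite -[m in iota m]addn0 iotaDl -map_comp; apply: eq_map => i /=.
by rewrite iter_left_shift.
Qed.

Lemma measurable_word_fun (G : seq 'I_M.+1 -> R) n :
  measurable_fun setT (fun x : X => G (mkseq x n)).
Proof.
by apply: (@measurable_fun_dep _ _ _ n) => x y xy; rewrite -!val_prefix_word xy.
Qed.

Lemma word_fun_bounded (G : seq 'I_M.+1 -> R) n :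
  exists K, forall x : X, `|G (mkseq x n)| <= K.
Proof.
exists (\sum_(w : n.-tuple 'I_M.+1) `|G w|) => x.
rewrite -val_prefix_word (bigD1 (prefix_word x n))//= lerDl.
exact: sumr_ge0.
Qed.

Variable mu : probability X R.

Lemma integrable_word_fun (G : seq 'I_M.+1 -> R) n :
  mu.-integrable setT (EFin \o (fun x : X => G (mkseq x n))).
Proof.
have [K hK] := word_fun_bounded G n.
exact: bounded_integrable (measurable_word_fun G n) hK.
Qed.

Hypothesis inv : invariant_measure T mu.

Lemma Rintegral_word_fun_shift (G : seq 'I_M.+1 -> R) m n :
  \int[mu]_x G (mkseq (iter m T x) n) = \int[mu]_x G (mkseq x n).
Proof.
have [K hK] := word_fun_bounded G n.
exact: (Rintegral_iter m (@measurable_left_shift M) inv (measurable_word_fun G n) hK).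
Qed.

Lemma Rintegral_subadditive (G : seq 'I_M.+1 -> R) m n :
  (forall u v, G (u ++ v) <= G u + G v) ->
  \int[mu]_x G (mkseq x (m + n)) <=
  \int[mu]_x G (mkseq x m) + \int[mu]_x G (mkseq x n).
Proof.
move=> subG; rewrite -(Rintegral_word_fun_shift G m n).
have i2 : mu.-integrable setT (EFin \o (fun x : X => G (mkseq (iter m T x) n))).
  have [K hK] := word_fun_bounded G n.
  apply: bounded_integrable (K) _ _ => [|x]; last exact: hK.
  apply: (measurableT_comp (measurable_word_fun G n)).
  by apply: measurable_iter; exact: measurable_left_shift.
have i1 := integrable_word_fun G m.
rewrite -RintegralD//; apply: le_Rintegral => //.
- exact: integrable_word_fun.
- by have := integrableD measurableT i1 i2.
- by move=> x _; rewrite mkseq_add.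
Qed.

Lemma Rintegral_additive (G : seq 'I_M.+1 -> R) n :
  (forall u v, G (u ++ v) = G u + G v) ->
  \int[mu]_x G (mkseq x n) = n%:R * \int[mu]_x G (mkseq x 1).
Proof.
move=> addG; have G0 : G [::] = 0 by have := addG [::] [::]; rewrite cats0; lra.
have NG u v : - G (u ++ v) <= - G u + - G v by rewrite addG; lra.
have GG u v : G (u ++ v) <= G u + G v by rewrite addG.
have IN k : \int[mu]_x (- G (mkseq x k)) = - \int[mu]_x G (mkseq x k).
  under eq_Rintegral do rewrite -mulN1r.
  by rewrite RintegralZl ?mulN1r//; exact: integrable_word_fun.
elim: n => [|n IH].
  by rewrite mul0r -[RHS](Rintegral_cstT mu 0); congr Rintegral; apply/funext.
have h1 := Rintegral_subadditive n 1 GG.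
have h2 := Rintegral_subadditive (G := fun w => - G w) n 1 NG.
rewrite !IN in h2; rewrite -(addn1 n) natrD mulrDl mul1r -IH; lra.
Qed.

(** The largest singular value is the norm up to a bounded factor, the product of
    the two is the absolute value of the determinant, and the logarithm of the
    latter is additive. *)
Lemma lyapunov_exponents : exists lam D : R,
  [/\ lyapunov (@alpha1 R) A mu = lam, lyapunov (@alpha2 R) A mu = D - lam,
      D <= 2 * lam,
      forall n, n%:R * lam <= \int[mu]_x log_norm A (mkseq x n) &
      forall n, \int[mu]_x log_det A (mkseq x n) = n%:R * D] /\
  n%:R^-1 * \int[mu]_x log_norm A (mkseq x n) @[n --> \oo] --> lam.
Proof.
have [C C1 hC] := log_norm_bound hA.
pose u n := \int[mu]_x log_norm A (mkseq x n).
have ln_ge n (x : X) : - (C * n.+1%:R) <= log_norm A (mkseq x n).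
  have [[_ h _ _] h0] := hC (mkseq x n) [::].
  rewrite cats0 size_mkseq in h; rewrite -natr1 mulrDr mulr1.
  by move: h0; rewrite ler_norml; lra.
have u_ge n : - (C * n.+1%:R) <= u n.
  rewrite -[leLHS](Rintegral_cstT mu); apply: le_Rintegral => //.
  - exact: (@bounded_integrable _ _ _ mu _ `|- (C * n.+1%:R)|).
  - exact: integrable_word_fun.
have [lam lam_le lam_cvg] := fekete
  (fun m n => Rintegral_subadditive m n (log_norm_cat_le hA)) u_ge.
pose D := \int[mu]_x log_det A (mkseq x 1).
have hD n : \int[mu]_x log_det A (mkseq x n) = n%:R * D.
  exact: Rintegral_additive (log_det_cat hA).
pose v n := \int[mu]_x ln (alpha1 (cocycle A x n)).
pose la1 w := ln (alpha1 (word_matrix A w)).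
have sv w := singular_values_bounds (word_matrix_unit hA w).
have ln40 : 0 <= ln 4 :> R by rewrite ln_ge0//; lra.
have la_le w : la1 w <= log_norm A w.
  by have [a1 _ _ h _] := sv w; rewrite ler_ln ?posrE// l1norm_word_gt0.
have la_ge w : log_norm A w - ln 4 <= la1 w.
  have [a1 _ _ _ h] := sv w; rewrite lerBlDl -lnM ?posrE//.
  by rewrite ler_ln ?posrE ?mulr_gt0// l1norm_word_gt0.
have v_le n : v n <= u n.
  apply: le_Rintegral => //; [exact: (integrable_word_fun la1)|exact: integrable_word_fun|].
  by move=> x _; exact: la_le.
have v_ge n : u n - ln 4 <= v n.
  rewrite -[X in _ - X <= _](Rintegral_cstT mu) -RintegralB//; last 2 first.
  - exact: integrable_word_fun.
  - exact: (@bounded_integrable _ _ _ mu _ `|ln 4|).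
  apply: le_Rintegral => //.
  - exact: (integrable_word_fun (fun w => log_norm A w - ln 4)).
  - exact: (integrable_word_fun la1).
have v_cvg : n%:R^-1 * v n @[n --> \oo] --> lam.
  apply/cvgrPdist_le => /= e e0.
  have e20 : 0 < e / 2 by rewrite divr_gt0.
  move/cvgrPdist_le : lam_cvg => /(_ _ e20)[n1 _ hn1].
  exists (maxn n1 (Num.bound (ln 4 / (e / 2)))).+1 => // n /= hn.
  have n0 : 0 < n%:R :> R by rewrite ltr0n; apply: leq_trans hn.
  have := hn1 n; rewrite /= => /(_ _)-/(_ _)/= h.
  have {}h : `|lam - n%:R^-1 * u n| <= e / 2.
    by apply: h; apply: leq_trans (ltnW hn); exact: leq_maxl.
  have h4 : n%:R^-1 * ln 4 <= e / 2.
    rewrite mulrC ler_pdivrMr// mulrC -ler_pdivrMr//.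
    apply/ltW; apply: lt_le_trans (archi_boundP _) _; first by rewrite divr_ge0// ltW.
    by rewrite ler_nat; apply: leq_trans (ltnW hn); exact: leq_maxr.
  have ni : 0 <= n%:R^-1 :> R by rewrite invr_ge0.
  have h1 := ler_wpM2l ni (v_le n); have h2 := ler_wpM2l ni (v_ge n).
  rewrite mulrBr in h2; move: h; rewrite !ler_norml => /andP[h5 h6].
  by apply/andP; split; move: h4 h1 h2 h5 h6; clear; lra.
exists lam, D; split=> //; split=> //.
- exact: cvg_lim.
- apply: cvg_lim => //.
  have : D - n%:R^-1 * v n @[n --> \oo] --> D - lam by apply: cvgB => //; exact: cvg_cst.
  apply: cvg_trans; apply: near_eq_cvg.
  exists 1%N => // -[//|n] _ /=.
  have -> : \int[mu]_x ln (alpha2 (cocycle A x n.+1)) = n.+1%:R * D - v n.+1.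
    rewrite -hD -RintegralB//; last 2 first.
    - exact: integrable_word_fun.
    - exact: (integrable_word_fun la1).
    congr Rintegral; apply/funext => x; rewrite /cocycle.
    have [a1 a2 h _ _] := sv (mkseq x n.+1).
    by rewrite /log_det -h lnM ?posrE// addrAC subrr add0r.
  by rewrite mulrBr mulKf// pnatr_eq0.
- have h n : n.+1%:R * D <= n.+1%:R * (2 * (n.+1%:R^-1 * u n.+1)).
    rewrite mulrCA mulVKf ?pnatr_eq0// -hD -RintegralZl//; last exact: integrable_word_fun.
    apply: le_Rintegral => //; first exact: integrable_word_fun.
      exact: (integrable_word_fun (fun w => 2 * log_norm A w)).
    by move=> x _; exact: log_det_le.
  have cvg2 : 2 * (n%:R^-1 * u n) @[n --> \oo] --> 2 * lam.
    by apply: cvgM => //; exact: cvg_cst.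
  apply: (ler_cvg_to (cvg_cst D) cvg2).
  by exists 1%N => // -[//|n] _ /=; have := h n; rewrite ler_pM2l// ltr0Sn.
Qed.

End Lyapunov.

(** * A subword of a typical orbit that preserves a cone *)

Section Segments.
Variables (R : realType) (M : nat) (A : 'I_M.+1 -> 'M[R]_2).
Hypothesis hA : forall j, A j \in unitmx.
Notation letter := 'I_M.+1.

Definition segment (x : nat -> letter) i n : seq letter :=
  mkseq (fun k => x (i + k)%N) n.

Lemma size_segment x i n : size (segment x i n) = n.
Proof. exact: size_mkseq. Qed.

Lemma segment_add x i m n :
  segment x i (m + n) = segment x i m ++ segment x (i + m) n.
Proof.
rewrite /segment /mkseq iotaD map_cat add0n; congr (_ ++ _).
rewrite -[m in iota m]addn0 iotaDl -map_comp; apply: eq_map => k /=.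
by rewrite addnA.
Qed.

Lemma mkseq_iter (x : borel_shift_space M) i n :
  mkseq (iter i (@left_shift M) x) n = segment x i n.
Proof. by apply: eq_map => k; rewrite iter_left_shift. Qed.

Variables (C : R).
Hypothesis C1 : 1 <= C.
Hypothesis hC : forall u v,
  [/\ log_norm A u - C * (size v)%:R <= log_norm A (u ++ v),
      log_norm A v - C * (size u)%:R <= log_norm A (u ++ v),
      log_norm A (u ++ v) <= log_norm A u + C * (size v)%:R &
      log_norm A (u ++ v) <= log_norm A v + C * (size u)%:R] /\
  `|log_norm A [::]| <= C.
Hypothesis hC' : forall w, `|log_det A w| <= C * (size w)%:R.

Lemma log_norm_le w : log_norm A w <= C * (size w).+1%:R.
Proof.
have [[_ _ _ h] h0] := hC w [::]; rewrite cats0 in h.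
by rewrite -natr1 mulrDr mulr1; move: h0; rewrite ler_norml; lra.
Qed.

Section TypicalOrbit.
Variables (x : nat -> letter) (l q a : nat) (lam D del s : R).
Notation N := (q * a + a)%N.
Notation F i n := (log_norm A (segment x i n)).
Notation blk t := (segment x t l).
Hypothesis s0 : 0 < s.
Hypothesis F_lower : N%:R * (lam - del) <= F 0 N.
Hypothesis F_average : \sum_(t < N) F t l <= N%:R * (l%:R * (lam + del)).
Hypothesis a_large : l%:R * (N%:R * (2 * del) + 3 * C * l.+1%:R) < s * (a%:R / 4).

Let f_left i m n : F i m - C * n%:R <= F i (m + n).
Proof. by rewrite segment_add; have [[+ _ _ _] _] := hC (segment x i m) (segment x (i + m) n);
  rewrite size_segment. Qed.

Let f_sub i m n : F i (m + n) <= F i m + F (i + m) n.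
Proof. by rewrite segment_add; exact: log_norm_cat_le. Qed.

Let f_bound i n : F i n <= C * n.+1%:R.
Proof. by have := log_norm_le (segment x i n); rewrite size_segment. Qed.

(** By subadditivity the value on the whole orbit is, up to a boundary term, at
    most [l^-1] times the sum of the values on the windows. *)
Lemma F_upper : (0 < l)%N -> F 0 N <= N%:R * (lam + del) + 3 * C * l.+1%:R.
Proof.
move=> l0; have l0' : 0 < l%:R :> R by rewrite ltr0n.
have C0 := le_trans ler01 C1.
have := @sum_loss_at_end R (fun i n => F i n) C l N C0 f_left f_bound.
have : 0 <= \sum_(t < N) loss_at_end (fun i n => F i n) l t.
  by apply: sumr_ge0 => t _; apply: loss_at_end_ge0.
move=> h1 h2; rewrite -(ler_pM2l l0'); move: h1 h2 F_average; lra.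
Qed.

Let few_losses (h : nat -> R) : (forall t, (t < N)%N -> 0 <= h t) ->
  \sum_(t < N) h t <= \sum_(t < N) F t l - l%:R * F 0 N + l%:R * (3 * C * l.+1%:R) ->
  \sum_(t < N) (s < h t)%R%:R < a%:R / 4 :> R.
Proof.
move=> h0 hh; rewrite -(ltr_pM2l s0).
apply: le_lt_trans (markov_count (ltW s0) h0) _.
apply: le_lt_trans hh _; apply: le_lt_trans a_large.
have := ler_wpM2l (ler0n R l) F_lower; move: F_average; lra.
Qed.

Let sum_shift (h : nat -> bool) c n : (c + n <= N)%N ->
  \sum_(t < n) (h (c + t)%N)%:R <= \sum_(t < N) (h t)%:R :> R.
Proof.
move=> cn; rewrite -(big_mkord xpredT (fun t => (h (c + t)%N)%:R)).
rewrite -(big_mkord xpredT (fun t => (h t)%:R)).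
have := big_addn 0 (c + n) c xpredT (fun i => (h i)%:R : R).
rewrite addKn add0n => e1.
rewrite [leLHS](_ : _ = \sum_(c <= i < c + n) (h i)%:R); last first.
  by rewrite e1; apply: eq_bigr => t _; rewrite addnC.
rewrite [leRHS](big_cat_nat (n := c)) //=; last by apply: leq_trans cn; exact: leq_addr.
rewrite [X in _ <= _ + X](big_cat_nat (n := (c + n)%N)) //=; last exact: leq_addr.
by rewrite addrCA lerDl addr_ge0// sumr_ge0.
Qed.

Definition block t : l.-tuple letter := [tuple x (t + i)%N | i < l].

Lemma val_block t : val (block t) = blk t.
Proof. by rewrite /segment /mkseq -val_enum_ord -map_comp. Qed.

(** The losses are nonnegative with a small sum, so that less than a quarter of
    the positions in each of the two windows loses more than [s]. *)
Lemma recurrent_good_block (p : {set l.-tuple letter} -> R) (good : {set l.-tuple letter}) :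
  (forall X Y, p (X :|: Y) <= p X + p Y) -> 7 / 8 <= p good ->
  (forall X, a%:R * (p X - 8^-1) <= \sum_(t < a) (block t \in X)%:R) ->
  (forall X, a%:R * (p X - 8^-1) <= \sum_(t < a) (block (q * a + t) \in X)%:R) ->
  exists j m, [/\ (j < a)%N, (q * a <= m < q * a + a)%N, block j \in good,
    block m = block j &
    F j l + F (j + l) (N + l - (j + l)) - s <= F j (N + l - j) /\
    F m l + F 0 m - s <= F 0 (m + l)].
Proof.
move=> psub pg f1 f2; have C0 := le_trans ler01 C1.
pose ls t := loss_at_start (fun i n => F i n) l N t.
pose le t := loss_at_end (fun i n => F i n) l t.
have b1 : \sum_(t < a) (~~ (ls t <= s))%:R < a%:R / 4 :> R.
  have := @few_losses ls _ (@sum_loss_at_start R (fun i n => F i n) C l N C0 f_left f_bound f_sub).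
  have ls0 t : (t < N)%N -> 0 <= ls t by move=> tN; exact: loss_at_start_ge0.
  move=> /(_ ls0).
  apply: le_lt_trans; have := @sum_shift (fun t => s < ls t) 0 a.
  rewrite add0n leq_addl => /(_ isT); apply: le_trans.
  by apply: ler_sum => t _; rewrite add0n -ltNge.
have b2 : \sum_(t < a) (~~ (le (q * a + t)%N <= s))%:R < a%:R / 4 :> R.
  have := @few_losses le _ (@sum_loss_at_end R (fun i n => F i n) C l N C0 f_left f_bound).
  have le0 t : (t < N)%N -> 0 <= le t by move=> _; exact: loss_at_end_ge0.
  move=> /(_ le0).
  apply: le_lt_trans; have := @sum_shift (fun t => s < le t) (q * a) a.
  rewrite leqnn => /(_ isT); apply: le_trans.
  by apply: ler_sum => t _; rewrite -ltNge.
have [j [m [ja ma jm jg /andP[h1 h2]]]] := @common_state R _ block good p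
  (fun t => ls t <= s) (fun t => le t <= s) a (q * a) psub pg f1 f2 b1 b2.
exists j, (q * a + m)%N; split => //.
  by rewrite leq_addr ltn_add2l.
by split; move: h1 h2; rewrite /ls /le /loss_at_start /loss_at_end; lra.
Qed.

Variables (eta : R) (p : {set l.-tuple letter} -> R) (good : {set l.-tuple letter}).
Variable P : l.-tuple letter -> 'M[R]_2.
Hypothesis eta0 : 0 < eta.
Hypothesis s_eta : expR (- s) = 36 * (36 * eta).
Hypothesis p_sub : forall X Y, p (X :|: Y) <= p X + p Y.
Hypothesis p_good : 7 / 8 <= p good.
Hypothesis freq_start : forall X,
  a%:R * (p X - 8^-1) <= \sum_(t < a) (block t \in X)%:R.
Hypothesis freq_end : forall X,
  a%:R * (p X - 8^-1) <= \sum_(t < a) (block (q * a + t) \in X)%:R.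
Hypothesis P_aligns : forall b, b \in good -> aligns eta (word_matrix A b) (P b).
Hypothesis det_close : `|log_det A (segment x 0 N) - N%:R * D| <= N%:R * del.
Hypothesis long_orbit : (a + l <= q * a)%N.
Hypothesis contraction : N%:R * (D + del) + C * (6 * a%:R + 2 * l%:R + 1) + 2 <=
  2 * (N%:R * (lam - del)) + ln (eta ^+ 2 / 100 / 10).

(** The word runs from the first occurrence of the block to the second. The
    determinant has become so small along it that the remainders in the
    inequalities for the norm of a product are negligible. *)
Lemma typical_subword : exists j m,
  [/\ (j < a)%N, (q * a <= m < q * a + a)%N & block j \in good] /\
  let w := segment x j (m - j) in
  [/\ dominated_entry eta (eta ^+ 2) (invmx (P (block j)) *m word_matrix A w *m P (block j)),
      N%:R * (lam - del) - 2 * (C * a%:R) <= log_norm A w,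
      log_norm A w <= log_norm A (segment x 0 N) + 2 * (C * a%:R) &
      `|log_det A w - N%:R * D| <= N%:R * del + 2 * (C * a%:R)].
Proof.
have C0 := le_trans ler01 C1.
have [j [m [ja mN jg mj [hs he]]]] := recurrent_good_block p_sub p_good freq_start freq_end.
exists j, m; split; first by [].
have jm : (j + l <= m)%N by clear -ja mN long_orbit; lia.
have [m1 m2] : (q * a <= m)%N /\ (m < q * a + a)%N by case/andP: mN.
set w := segment x j (m - j).
have wE : w = segment x j l ++ segment x (j + l) (m - j - l).
  by rewrite -segment_add; congr segment; clear -jm; lia.
have e0m : segment x 0 m = segment x 0 j ++ w.
  by rewrite /w -[X in _ ++ segment x X _]add0n -segment_add; congr segment; clear -jm; lia.
have e0N : segment x 0 N = segment x 0 m ++ segment x m (N - m).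
  by rewrite -[X in _ ++ segment x X _]add0n -segment_add; congr segment; clear -m2; lia.
have e0Nl : segment x 0 (N + l) = segment x 0 j ++ segment x j (N + l - j).
  by rewrite -[X in _ ++ segment x X _]add0n -segment_add; congr segment; clear -m2 jm; lia.
have ejN : segment x j (N + l - j) = w ++ segment x m (N + l - m).
  have -> : (N + l - j = (m - j) + (N + l - m))%N by clear -m2 jm; lia.
  by rewrite segment_add; congr (_ ++ segment x _ _); clear -jm; lia.
have ejlN : segment x (j + l) (N + l - (j + l)) =
    segment x (j + l) (m - j - l) ++ segment x m (N + l - m).
  have -> : (N + l - (j + l) = (m - j - l) + (N + l - m))%N by clear -m2 jm; lia.
  by rewrite segment_add; congr (_ ++ segment x _ _); clear -jm; lia.
have e0ml : segment x 0 (m + l) = segment x 0 m ++ segment x m l.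
  by rewrite segment_add.
have bj : segment x j l = block j :> seq letter by rewrite -val_block.
have bm : segment x m l = block j :> seq letter by rewrite -mj -val_block.
have jR : j%:R <= a%:R :> R by rewrite ler_nat ltnW.
have NmR : (N - m)%:R <= a%:R :> R by rewrite ler_nat; clear -m1 m2; lia.
have NmlR : (N + l - m)%:R <= a%:R + l%:R :> R by rewrite -natrD ler_nat; clear -m1 m2; lia.
have CjR := ler_wpM2l C0 jR; have CNmR := ler_wpM2l C0 NmR; have CNml := ler_wpM2l C0 NmlR.
have [[g1 g2 g3 g4] _] := hC (segment x 0 j) w.
rewrite -e0m size_segment in g1 g2 g3 g4.
have [[g5 g6 g7 g8] _] := hC (segment x 0 m) (segment x m (N - m)).
rewrite -e0N size_segment in g5 g7.
have [[_ _ _ g9] _] := hC (segment x 0 j) (segment x j (N + l - j)).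
rewrite -e0Nl size_segment in g9.
have g10 := f_left 0 N l.
have Fw_ge : N%:R * (lam - del) - 2 * (C * a%:R) <= log_norm A w.
  move: F_lower g7 g4 CjR CNmR; lra.
have Fw_le : log_norm A w <= log_norm A (segment x 0 N) + 2 * (C * a%:R).
  move: g5 g2 CjR CNmR; lra.
have Ldw : `|log_det A w - N%:R * D| <= N%:R * del + 2 * (C * a%:R).
  have := log_det_cat hA (segment x 0 m) (segment x m (N - m)).
  rewrite -e0N {1}e0m log_det_cat// => e1.
  have := hC' (segment x 0 j); have := hC' (segment x m (N - m)).
  move: det_close CjR CNmR e1; rewrite !size_segment !ler_norml.
  move=> /andP[? ?] ? ? ? /andP[? ?] /andP[? ?].
  by apply/andP; split; lra.
split => //.
have FY := log_norm_le (segment x m (N + l - m)).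
have FZ := log_norm_le (segment x 0 j).
rewrite size_segment -natr1 mulrDr mulr1 in FY.
rewrite size_segment -natr1 mulrDr mulr1 in FZ.
have Ldw' : log_det A w <= N%:R * D + N%:R * del + 2 * (C * a%:R).
  by move: Ldw; rewrite ler_norml; lra.
have XE : word_matrix A w = word_matrix A (segment x (j + l) (m - j - l)) *m
    word_matrix A (block j).
  by rewrite wE word_matrix_cat bj.
have YXE : word_matrix A (segment x m (N + l - m)) *m word_matrix A w =
  word_matrix A (segment x j (N + l - j)) by rewrite ejN word_matrix_cat.
have YQE : word_matrix A (segment x m (N + l - m)) *m
    word_matrix A (segment x (j + l) (m - j - l)) =
  word_matrix A (segment x (j + l) (N + l - (j + l))) by rewrite ejlN word_matrix_cat.
have XZE : word_matrix A w *m word_matrix A (segment x 0 j) =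
  word_matrix A (segment x 0 m) by rewrite e0m word_matrix_cat.
have BXZE : word_matrix A (block j) *m word_matrix A w *m word_matrix A (segment x 0 j) =
  word_matrix A (segment x 0 (m + l)).
  by rewrite -mulmxA XZE e0ml word_matrix_cat bm.
have eta2 : 0 < eta ^+ 2 / 100 / 10 by rewrite !divr_gt0// exprn_gt0.
apply: (P_aligns jg (Y := word_matrix A (segment x m (N + l - m)))
  (Z := word_matrix A (segment x 0 j)) (z := eta ^+ 2 / 100 / 10) XE); rewrite ?YXE ?YQE ?XZE ?BXZE.
- by split; exact: l1norm_word_gt0.
- rewrite -s_eta -!expR_log_norm// -!expRD ler_expR; move: hs; rewrite bj; lra.
- rewrite -s_eta -!expR_log_norm// -!expRD ler_expR; move: he; rewrite bm; lra.
- by [].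
- have l3 : 3 <= expR 2 :> R by have := @expR_ge1Dx R 2; lra.
  apply: (@le_trans _ _ (expR (log_det A w + (log_norm A (segment x m (N + l - m)) + 2)))).
    rewrite expRD expR_log_det// ler_wpM2l// expRD expR_log_norm// ler_wpM2l//.
    exact: l1norm_ge0.
  rewrite -[X in _ <= X * _]lnK ?posrE// -!expR_log_norm// -!expRD ler_expR.
  move: contraction Ldw' FY Fw_ge g9 g10 CjR CNml F_lower; lra.
- rewrite -expR_log_det// -[X in _ <= X * _]lnK ?posrE// -!expR_log_norm// -!expRD ler_expR.
  have cl : 0 <= C * l%:R by rewrite mulr_ge0.
  move: contraction Ldw' FZ Fw_ge g7 CjR CNmR F_lower cl C0; lra.
Qed.

End TypicalOrbit.
End Segments.

(** * Events of probability tending to one *)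

Section Likely.
Variables (R : realType) (M : nat).
Notation letter := 'I_M.+1.
Notation X := (borel_shift_space M).
Notation T := (@left_shift M).
Variable mu : probability X R.
Hypotheses (inv : invariant_measure T mu) (erg : ergodic T mu).

Definition likely (E : nat -> set X) : Prop :=
  (forall a, measurable (E a)) /\
  forall e, 0 < e -> exists a0, forall a, (a0 <= a)%N -> 1 - e <= prob mu (E a).

Lemma likelyI E F : likely E -> likely F -> likely (fun a => E a `&` F a).
Proof.
move=> [mE hE] [mF hF]; split; first by move=> a; exact: measurableI.
move=> e e0; have e20 : 0 < e / 2 by rewrite divr_gt0.
have [a1 h1] := hE _ e20; have [a2 h2] := hF _ e20.
exists (maxn a1 a2) => a; rewrite geq_max => /andP[a1a a2a].
by rewrite [e]splitr; apply: prob_setI => //; [exact: h1|exact: h2].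
Qed.

Lemma likely_forall (I : finType) (E : I -> nat -> set X) :
  (forall i, likely (E i)) -> likely (fun a => [set x | forall i, E i a x]).
Proof.
move=> hE; split=> [a|e e0].
  rewrite (_ : [set _ | _] = \bigcap_(i in [set: I]) E i a).
    by apply: fin_bigcap_measurable => // i _; exact: (hE i).1.
  by apply/seteqP; split => x hx i; [move=> _|]; exact: hx.
have e1 : 0 < e / #|I|.+1%:R by rewrite divr_gt0.
have /choice[a0 ha0] : forall i, exists a0, forall a, (a0 <= a)%N ->
    1 - e / #|I|.+1%:R <= prob mu (E i a) by move=> i; exact: (hE i).2.
exists (\max_i a0 i)%N => a ha.
have := @prob_bigcap _ _ _ mu _ (enum I) (fun i => E i a) (e / #|I|.+1%:R)
  (fun i => (hE i).1 a).
rewrite (_ : [set x | forall i, i \in enum I -> E i a x] =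
  [set x | forall i, E i a x]); last first.
  by apply/seteqP; split => x hx i => [|_]; [apply: hx; rewrite mem_enum|exact: hx].
have hEa i : i \in enum I -> 1 - e / #|I|.+1%:R <= prob mu (E i a).
  by move=> _; apply: ha0; apply: leq_trans ha; exact: (leq_bigmax i).
move=> /(_ hEa); apply: le_trans.
rewrite lerD2l lerN2 -cardE mulrCA ler_piMr ?(ltW e0)// ler_pdivrMr// mul1r.
by rewrite ler_nat.
Qed.

Lemma likely_shift (c : nat -> nat) E : likely E ->
  likely (fun a => iter (c a) T @^-1` E a).
Proof.
move=> [mE hE]; have mT := @measurable_left_shift M.
split=> [a|e /hE[a0 h]]; first exact: measurable_preimage_iter.
by exists a0 => a /h; rewrite prob_preimage_iter.
Qed.

Lemma likely_sub E F : likely E -> (forall a, measurable (F a)) ->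
  (forall a, E a `<=` F a) -> likely F.
Proof.
move=> [mE hE] mF EF; split=> // e /hE[a0 h]; exists a0 => a /h /le_trans; apply.
exact: prob_le.
Qed.

Lemma likely_subadditive (g : nat -> X -> R) (C lam del : R) (k : nat -> nat) :
  (forall n, measurable_fun setT (g n)) ->
  (forall m n x, g (m + n)%N x <= g m x + g n (iter m T x)) ->
  (forall x, `|g 0%N x| <= C) -> (forall n x, `|g n.+1 x - g n (T x)| <= C) ->
  (forall n, n%:R * lam <= \int[mu]_x g n x) -> 0 < del ->
  (forall a, (a <= k a)%N) ->
  likely (fun a => [set x | (k a)%:R * (lam - del) <= g (k a) x]).
Proof.
move=> mg subg g0 gS hlam del0 hk; split=> [a|e e0].
  rewrite (_ : [set _ | _] = setT `&` (g (k a) @^-1` `[(k a)%:R * (lam - del), +oo[%classic)).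
    exact: mg.
  by apply/seteqP; split => y /=; rewrite in_itv/= andbT// => -[].
have [N0 hN0] := subadditive_process_lower_bound (@measurable_left_shift M) inv erg
  mg subg g0 gS hlam del0 e0.
by exists N0 => a ha; apply: hN0; apply: leq_trans ha (hk a).
Qed.

Lemma likely_birkhoff (phi : X -> R) (K del : R) (k : nat -> nat) :
  measurable_fun setT phi -> (forall x, `|phi x| <= K) -> 0 < del ->
  (forall a, (a <= k a)%N) ->
  likely (fun a => [set x | (k a)%:R * (\int[mu]_x phi x - del) <=
                            \sum_(t < k a) phi (iter t T x)]).
Proof.
move=> mphi phiK del0 hk; have mT := @measurable_left_shift M.
have mphin t : measurable_fun setT (fun x : X => phi (iter t T x)).
  by apply: (measurableT_comp mphi); exact: measurable_iter.
have sumS n x : \sum_(t < n.+1) phi (iter t T x) =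
    phi x + \sum_(t < n) phi (iter t T (T x)).
  by rewrite big_ord_recl /=; congr (_ + _); apply: eq_bigr => i _; rewrite -iterSr.
apply: (@likely_subadditive (fun n x => \sum_(t < n) phi (iter t T x)) K) => //.
- by move=> n; exact: measurable_sum.
- move=> m n x; rewrite big_split_ord/= lerD2l.
  by apply: ler_sum => t _; rewrite addnC iterD.
- by move=> x; rewrite big_ord0 normr0 (le_trans (normr_ge0 _) (phiK x)).
- by move=> n x; rewrite sumS addrK.
- move=> n; rewrite (@Rintegral_sum _ _ _ mu _ _ (fun (t : 'I_n) x => phi (iter t T x)) (fun=> K))//.
  under eq_bigr do rewrite (Rintegral_iter _ mT inv mphi phiK).
  by rewrite sumr_const card_ord mulr_natl.
Qed.

End Likely.

Lemma pigeonhole_fiber (V L : finType) (E : {set V}) (phi : V -> L) (v0 : V) :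
  v0 \in E -> exists2 c, c \in phi @: E & (#|E| <= #|L| * #|[set v in E | phi v == c]|)%N.
Proof.
move=> v0E; pose n c := #|[set v in E | phi v == c]|%SET.
have [c _ hc] := arg_maxnP n (isT : xpredT (phi v0)).
have hle : (#|E| <= #|L| * n c)%N.
  rewrite -sum1_card (partition_big phi xpredT)//=.
  rewrite -sum_nat_const; apply: leq_sum => d _.
  rewrite sum1_card (_ : #|_| = n d); first exact: hc.
  by apply: eq_card => v; rewrite !inE.
exists c => //; have : (0 < n c)%N.
  rewrite lt0n; apply: contraTneq hle => ->; rewrite muln0 -ltnNge.
  by rewrite card_gt0; apply/set0Pn; exists v0.
rewrite card_gt0 => /set0Pn[v]; rewrite inE => /andP[vE /eqP <-].
exact: imset_f.
Qed.

(** * Typical behaviour of norms, determinants and block frequencies *)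

Section TypicalEvents.
Variables (R : realType) (M : nat) (A : 'I_M.+1 -> 'M[R]_2).
Hypothesis hA : forall j, A j \in unitmx.
Notation letter := 'I_M.+1.
Notation X := (borel_shift_space M).
Notation T := (@left_shift M).
Variable mu : probability X R.
Hypotheses (full : fully_supported mu) (inv : invariant_measure T mu)
  (erg : ergodic T mu).
Variables lam D : R.
Hypothesis lam_le : forall n, n%:R * lam <= \int[mu]_x log_norm A (mkseq x n).
Hypothesis lam_cvg :
  n%:R^-1 * \int[mu]_x log_norm A (mkseq x n) @[n --> \oo] --> lam.
Hypothesis D_int : forall n, \int[mu]_x log_det A (mkseq x n) = n%:R * D.
Hypothesis gap : D < 2 * lam.

Lemma likely_log_norm (del : R) (k : nat -> nat) : 0 < del ->
  (forall a, (a <= k a)%N) ->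
  likely mu (fun a => [set x | (k a)%:R * (lam - del) <= log_norm A (mkseq x (k a))]).
Proof.
move=> del0 hk; have [C C1 hC] := log_norm_bound hA.
apply: (@likely_subadditive _ _ mu inv erg (fun n x => log_norm A (mkseq x n)) C) => //.
- by move=> n; exact: measurable_word_fun.
- by move=> m n x; rewrite mkseq_add; exact: log_norm_cat_le.
- by move=> x; have [_] := hC [::] [::].
- move=> n x; rewrite -(add1n n) mkseq_add /=.
  have [[_ h1 _ h2] _] := hC (mkseq x 1) (mkseq (T x) n).
  rewrite size_mkseq mulr1 in h1 h2; rewrite ler_norml; move: h1 h2; lra.
Qed.

Lemma likely_log_norm_average l (del : R) (k : nat -> nat) : 0 < del ->
  (forall a, (a <= k a)%N) ->
  likely mu (fun a => [set x | \sum_(t < k a) log_norm A (mkseq (iter t T x) l) <=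
     (k a)%:R * (\int[mu]_x log_norm A (mkseq x l) + del)]).
Proof.
move=> del0 hk.
have [K hK] := word_fun_bounded (fun w => - log_norm A w) l.
have := likely_birkhoff inv erg (measurable_word_fun (fun w => - log_norm A w) l) hK del0 hk.
congr (likely mu _); apply/funext => a; congr mkset; apply/funext => x.
rewrite sumrN; under eq_Rintegral do rewrite -mulN1r.
rewrite RintegralZl//; last exact: integrable_word_fun.
by apply/propext; split; rewrite lerNr; lra.
Qed.

Lemma sum_log_det n (x : X) :
  \sum_(t < n) log_det A (mkseq (iter t T x) 1) = log_det A (mkseq x n).
Proof.
elim: n => [|n IH].
  by rewrite big_ord0 /log_det /word_matrix /= det1 normr1 ln1.
by rewrite big_ord_recr /= IH -(addn1 n) mkseq_add log_det_cat.
Qed.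

Lemma likely_log_det (del : R) (k : nat -> nat) : 0 < del ->
  (forall a, (a <= k a)%N) ->
  likely mu (fun a => [set x | `|log_det A (mkseq x (k a)) - (k a)%:R * D| <= (k a)%:R * del]).
Proof.
move=> del0 hk.
have [K hK] := word_fun_bounded (log_det A) 1.
have [K' hK'] := word_fun_bounded (fun w => - log_det A w) 1.
have h1 := likely_birkhoff inv erg (measurable_word_fun (log_det A) 1) hK del0 hk.
have h2 := likely_birkhoff inv erg (measurable_word_fun (fun w => - log_det A w) 1) hK' del0 hk.
have := likelyI h1 h2; congr (likely mu _); apply/funext => a.
rewrite /setI; congr mkset; apply/funext => x /=.
have -> : \int[mu]_x - log_det A (mkseq x 1) = - D.
  under eq_Rintegral do rewrite -mulN1r.
  by rewrite RintegralZl ?D_int ?mul1r ?mulN1r//; exact: integrable_word_fun.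
rewrite D_int mul1r sumrN sum_log_det ler_norml; apply/propext; split.
  by move=> [h3 h4]; apply/andP; split; move: h3 h4; lra.
by move=> /andP[h3 h4]; split; move: h3 h4; lra.
Qed.

Definition block_prob l (Y : {set l.-tuple letter}) : R :=
  prob mu [set x | prefix_word x l \in Y].

Lemma measurable_block l (Y : {set l.-tuple letter}) :
  measurable [set x : X | prefix_word x l \in Y].
Proof. exact: (@measurable_prefix _ l (fun w => w \in Y)). Qed.

Lemma block_prob_sub l (Y Z : {set l.-tuple letter}) :
  block_prob (Y :|: Z) <= block_prob Y + block_prob Z.
Proof.
apply: le_trans (probU mu (measurable_block Y) (measurable_block Z)).
apply: prob_le; first exact: measurable_block.
  by apply: measurableU; exact: measurable_block.
by move=> x /=; rewrite inE => /orP[]; [left|right].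
Qed.

Lemma likely_frequency l (Y : {set l.-tuple letter}) (del : R) (c : nat -> nat) : 0 < del ->
  likely mu (fun a => [set x | a%:R * (block_prob Y - del) <=
     \sum_(t < a) (prefix_word (iter (c a + t) T x) l \in Y)%:R]).
Proof.
move=> del0.
have bnd (x : X) : `|(prefix_word x l \in Y)%:R : R| <= 1.
  by case: (_ \in _); rewrite ?normr1 ?normr0.
have mphi : measurable_fun setT (fun x : X => (prefix_word x l \in Y)%:R : R).
  by apply: (@measurable_fun_dep _ _ _ l) => x y ->.
have := likely_shift inv c (likely_birkhoff inv erg mphi bnd del0 (fun a => leqnn a)).
congr (likely mu _); apply/funext => a; rewrite /preimage; congr mkset.
apply/funext => x /=; congr (_ * (_ - _) <= _).
  rewrite /block_prob -Rintegral_indic; last exact: measurable_block.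
  congr Rintegral; apply/funext => y; rewrite indicE; congr (_%:R); congr nat_of_bool.
  by apply/idP/idP => [h|]; rewrite inE.
by apply: eq_bigr => t _; rewrite addnC iterD.
Qed.

Lemma cylinder_prob_gt0 n (w : n.-tuple letter) : 0 < block_prob [set w]%SET.
Proof.
have -> : block_prob [set w]%SET = prob mu [set x | prefix_word x n = w].
  by congr prob; apply/seteqP; split => x /=; rewrite inE => /eqP.
rewrite -lte_fin -probE; last first.
  exact: (@measurable_prefix _ n (fun v => v = w)).
apply: full; last first.
  exists (fun i => nth ord0 w i); apply: eq_from_tnth => i.
  by rewrite tnth_mktuple -tnth_nth.
have h m : (m <= n)%N -> open [set x : shift_space M |
    forall i, (i < m)%N -> x i = nth ord0 w i].
  elim: m => [_|m IH mn].
    by rewrite (_ : [set _ | _] = setT); [exact: openT|apply/seteqP; split].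
  rewrite (_ : [set _ | _] = [set x : shift_space M |
    forall i, (i < m)%N -> x i = nth ord0 w i] `&` [set x | x m = nth ord0 w m]).
    by apply: openI; [exact/IH/ltnW|exact: open_coordinate].
  apply/seteqP; split => [x hx|x [h1 h2] i].
    by split => [i im|]; apply: hx => //; exact: leqW.
  by rewrite ltnS leq_eqVlt => /orP[/eqP->|/h1].
have := h n (leqnn n); congr open; apply/seteqP; split => x /=.
  by move=> hx; apply: eq_from_tnth => i; rewrite tnth_mktuple (tnth_nth ord0) hx.
by move=> <- i im; rewrite val_prefix_word nth_mkseq.
Qed.

(** The frequency of each word is positive because the measure has full support. *)
Lemma likely_visits n (c : nat -> nat) : likely mu (fun a => [set x | (a > 0)%N ->
  forall w : n.-tuple letter, exists2 t, (t < a)%N & prefix_word (iter (c a + t) T x) n = w]).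
Proof.
have h (w : n.-tuple letter) := likely_frequency [set w]%SET c (divr_gt0 (cylinder_prob_gt0 w) (ltr0n R 2)).
apply: (likely_sub (likely_forall h)).
  move=> a; case: a => [|a].
    by rewrite (_ : [set _ | _] = setT); [exact: measurableT|apply/seteqP; split].
  pose m := (c a.+1 + a.+1 + n)%N.
  apply: (@measurable_dep _ m) => x y /eq_prefix_word xy hx _ w.
  have [t ta <-] := hx isT w; exists t => //.
  apply/eq_prefix_word => i ilt; rewrite !iter_left_shift; apply/esym/xy.
  by rewrite /m; clear -ta ilt; lia.
move=> a x hx a0 w; apply: contrapT => hn.
have := hx w; rewrite /= big1; last first.
  move=> t _; rewrite inE; case: eqP => // e; exfalso; apply: hn.
  by exists t.
apply/negP; rewrite -ltNge mulr_gt0 ?ltr0n//.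
by have := cylinder_prob_gt0 w; lra.
Qed.

Definition contraction_rate : R := (2 * lam - D) / 12.

(** The two factors 36 are those in [aligns]: a loss of at most
    [contraction_rate * l] then satisfies the inequalities there. *)
Definition block_eta (l : nat) : R := expR (- (contraction_rate * l%:R)) / 36 / 36.

(** In terms of matrices, the determinant is at most [block_eta l ^+ 3] times
    the squared norm. *)
Definition good_blocks l : {set l.-tuple letter} :=
  [set b : l.-tuple letter | log_det A b <= 2 * log_norm A b + 3 * ln (block_eta l)]%SET.

Lemma contraction_rate_gt0 : 0 < contraction_rate.
Proof. by rewrite divr_gt0// subr_gt0. Qed.

Lemma block_eta_gt0 l : 0 < block_eta l.
Proof. by rewrite !divr_gt0// expR_gt0. Qed.

Lemma block_eta_le1 l : block_eta l <= 1.
Proof.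
have : expR (- (contraction_rate * l%:R)) <= 1.
  by rewrite -expR0 ler_expR oppr_le0 mulr_ge0// ltW// contraction_rate_gt0.
rewrite /block_eta; move: (expR _) => y; lra.
Qed.

Lemma ln_block_eta l : ln (block_eta l) = - (contraction_rate * l%:R) - 2 * ln 36.
Proof.
have p36 : 0 < 36 :> R by lra.
have p36' : 0 < 36^-1 :> R by rewrite invr_gt0.
by rewrite !lnM ?posrE ?mulr_gt0 ?expR_gt0// expRK lnV ?posrE//; ring.
Qed.

(** Typically the logarithm of the determinant is about [l * D], that of the
    squared norm about [l * 2 lam], and [good_blocks] requires a gap of only
    about a quarter of the difference. *)
Lemma many_good_blocks (del : R) : 0 < del -> exists l : nat,
  [/\ (0 < l)%N, \int[mu]_x log_norm A (mkseq x l) <= l%:R * (lam + del) &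
      7 / 8 <= block_prob (good_blocks l)].
Proof.
move=> del0; have r0 := contraction_rate_gt0.
have e16 : 0 < 16^-1 :> R by rewrite invr_gt0.
have [m1 /(_ _ e16)[a1 h1]] := likely_log_norm (divr_gt0 r0 (ltr0n R 2)) (fun a => leqnn a).
have [m2 /(_ _ e16)[a2 h2]] := likely_log_det r0 (fun a => leqnn a).
move/cvgrPdist_le : lam_cvg => /(_ _ del0)[a3 _ h3].
have [a4 h4] : exists a4 : nat, ln 36 / contraction_rate < a4%:R.
  exists (Num.bound (ln 36 / contraction_rate)); apply: archi_boundP.
  by rewrite divr_ge0 ?(ltW r0)// ln_ge0//; lra.
pose l := (maxn (maxn a1 a2) (maxn a3 a4)).+1.
have [l1 l2 l3 l4] : [/\ (a1 <= l)%N, (a2 <= l)%N, (a3 <= l)%N & (a4 <= l)%N].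
  by rewrite /l; clear; split; lia.
have l0 : 0 < l%:R :> R by rewrite ltr0n.
exists l; split => //.
  have := h3 l l3; rewrite /= ler_norml => /andP[h _].
  by rewrite -ler_pdivrMl//; move: h; lra.
have := prob_setI (m1 l) (m2 l) (h1 l l1) (h2 l l2).
have -> : 1 - (16^-1 + 16^-1) = 7 / 8 :> R by field.
move=> /le_trans; apply; apply: prob_le; first exact: measurableI.
  exact: measurable_block.
move=> x [/= x1 x2]; rewrite inE val_prefix_word ln_block_eta.
have h5 : ln 36 <= contraction_rate * l%:R.
  rewrite mulrC -ler_pdivrMr//; apply: le_trans (ltW h4) _.
  by rewrite ler_nat.
have h6 : l%:R * (2 * lam - D) = 12 * (contraction_rate * l%:R).
  by rewrite /contraction_rate; field.
have h7 : 0 <= ln 36 :> R by rewrite ln_ge0//; lra.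
have h8 : 0 <= contraction_rate * l%:R by rewrite mulr_ge0// ltW.
by move: x1 x2; rewrite ler_norml => x1 /andP[_ x2]; move: x1 x2 h5 h6 h7 h8; lra.
Qed.

Lemma good_block_cone l (b : l.-tuple letter) : exists PQg : 'M[R]_2 * 'M[R]_2 * R,
  b \in good_blocks l ->
  let: (P, Q, g) := PQg in
  [/\ aligns (block_eta l) (word_matrix A b) P, Q \in unitmx, 0 < g &
    forall X : 'M[R]_2, 0 < l1norm X ->
    dominated_entry (block_eta l) (block_eta l ^+ 2) (invmx P *m X *m P) ->
    (exists2 s : R, s = 1 \/ s = - 1 & positive_mx (s *: (invmx Q *m X *m Q))) /\
    forall v : 'cV[R]_2, (forall i, 0 <= v i 0) ->
      g * l1norm X * l1norm (Q *m v) <= l1norm (X *m (Q *m v))].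
Proof.
have [bg|] := boolP (b \in good_blocks l); last by exists (0, 0, 0).
have e0 := block_eta_gt0 l; have e1 := block_eta_le1 l.
have e01 : 0 < block_eta l <= 1 by apply/andP.
have [|P uP [nP nP' hP]] := aligned_block_dominated (word_matrix_neq0 hA b) e01.
  rewrite -expR_log_det// -expR_log_norm// -[X in X ^+ 3]lnK ?posrE//.
  rewrite -!expRM_natl -expRD ler_expR; move: bg; rewrite inE; lra.
have [Q uQ [g g0 hQ]] := dominated_entry_cone e0 e1 (lexx _) uP nP nP'.
by exists (P, Q, g).
Qed.

End TypicalEvents.

(** * Cone words on typical orbits *)

Section Budgets.
Variable R : realFieldType.
Implicit Types a n q N : R.

(** In this group of estimates [(q + 1) a] is the length of the orbit, [a] that
    of the windows at its ends, and [n] that of the word in between. All errors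
    are multiples of [a] and are absorbed by [ep * q * a]. *)
Lemma trimming_error z N n a : N - 2 * a <= n -> n <= N ->
  `|N * z - n * z| <= 2 * a * `|z|.
Proof. by move=> h1 h2; rewrite -mulrBl normrM ler_wpM2r// ger0_norm; lra. Qed.

Lemma scale_dominates (C lam D Lam ep : R) : 1 <= C -> C + `|lam| + `|D| + 1 <= Lam ->
  ep <= 2 * lam - D -> [/\ 1 <= Lam, C <= Lam, ep <= 2 * Lam, `|lam| <= Lam & `|D| <= Lam].
Proof.
move=> C1 hL he; have h1 := normr_ge0 lam; have h2 := normr_ge0 D.
have h3 := ler_norm lam; have := ler_norm (- D); rewrite normrN => h4.
by split; lra.
Qed.

Lemma loss_budget (ep c C a l1 : R) : 0 < C -> 0 < l1 -> ep * a / 12 <= c * a ->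
  300 * C * l1 < ep * a -> 2 * (ep * a / 200) + 3 * C * l1 < c * a / 4.
Proof. by move=> C0 l0; have := mulr_gt0 C0 l0; lra. Qed.

Variables (lam D ep Lam C q a l z : R).
Hypothesis EP : 100 * Lam * a <= ep * q * a.
Hypothesis LC : C * a <= Lam * a.
Hypothesis La : a <= Lam * a.
Hypothesis epa0 : 0 <= ep * a.
Hypothesis epa : ep * a <= 2 * Lam * a.
Hypothesis a_large : C * (2 * l + 1) + 2 - z <= a.

Lemma contraction_budget :
  ep * (q * a + a) <= (2 * lam - D) * (q * a + a) ->
  (q * a + a) * D + ep * a / 200 + C * (6 * a + 2 * l + 1) + 2 <=
  2 * ((q * a + a) * lam - ep * a / 200) + z.
Proof. move: EP LC La epa0 epa a_large; lra. Qed.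

Lemma growth_budget F n b : (q * a + a) * lam - ep * a / 200 - 2 * (C * a) <= F ->
  - a <= b -> `|lam| * a <= Lam * a ->
  `|(q * a + a) * lam - n * lam| <= 2 * a * `|lam| -> (q * a + a) - 2 * a <= n ->
  0 < ep -> n * (lam - ep) <= b + F.
Proof.
move=> hF hb hl + hn ep0; rewrite ler_norml => /andP[h1 h2].
have := ler_wpM2l (ltW ep0) hn; move: EP LC La epa0 epa; lra.
Qed.

Lemma norm_budget F G n c : F <= G + 2 * (C * a) ->
  G <= (q * a + a) * lam + ep * a / 200 + c -> 100 * c < ep * a ->
  `|lam| * a <= Lam * a ->
  `|(q * a + a) * lam - n * lam| <= 2 * a * `|lam| -> (q * a + a) - 2 * a <= n ->
  0 < ep -> F <= n * (lam + ep).
Proof.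
move=> hF hG hc hl + hn ep0; rewrite ler_norml => /andP[h1 h2].
have := ler_wpM2l (ltW ep0) hn; move: EP LC La epa0 epa; lra.
Qed.

Lemma det_budget F n : `|F - (q * a + a) * D| <= ep * a / 200 + 2 * (C * a) ->
  `|D| * a <= Lam * a ->
  `|(q * a + a) * D - n * D| <= 2 * a * `|D| -> (q * a + a) - 2 * a <= n ->
  0 < ep -> `|F - n * D| <= n * ep.
Proof.
rewrite !ler_norml => /andP[h3 h4] hD /andP[h1 h2] hn ep0.
have := ler_wpM2l (ltW ep0) hn => h5.
by apply/andP; split; move: EP LC La epa0 epa h1 h2 h3 h4 h5 hD; lra.
Qed.

End Budgets.

Section ConeWords.
Variables (R : realType) (M : nat) (A : 'I_M.+1 -> 'M[R]_2).
Hypothesis hA : forall j, A j \in unitmx.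
Notation letter := 'I_M.+1.
Notation X := (borel_shift_space M).
Notation T := (@left_shift M).
Variables lam D : R.

(** The cone is the image under [Q] of the nonnegative quadrant; the sign [s]
    allows a word to map it into its opposite. *)
Definition cone_word (Q : 'M[R]_2) (e : R) (n0 : nat) (w : seq letter) : Prop :=
  [/\ exists2 s : R, s = 1 \/ s = -1 &
        positive_mx (s *: (invmx Q *m word_matrix A w *m Q)),
      forall v : 'cV[R]_2, (forall i, 0 <= v i 0) ->
        expR ((size w)%:R * (lam - e)) * l1norm (Q *m v) <=
        l1norm (word_matrix A w *m (Q *m v)),
      log_norm A w <= (size w)%:R * (lam + e),
      `|log_det A w - (size w)%:R * D| <= (size w)%:R * e &
      forall k : n0.-tuple letter, infix k w].

Lemma infix_segment (x : nat -> letter) i n j k :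
  (i <= j)%N -> (j + k <= i + n)%N -> infix (segment x j k) (segment x i n).
Proof.
move=> ij jk; have -> : (n = (j - i) + (k + (i + n - (j + k))))%N by lia.
rewrite !segment_add subnKC//; apply: infix_infix.
Qed.

Variables (C : R).
Hypothesis C1 : 1 <= C.
Hypothesis hC : forall u v,
  [/\ log_norm A u - C * (size v)%:R <= log_norm A (u ++ v),
      log_norm A v - C * (size u)%:R <= log_norm A (u ++ v),
      log_norm A (u ++ v) <= log_norm A u + C * (size v)%:R &
      log_norm A (u ++ v) <= log_norm A v + C * (size u)%:R] /\
  `|log_norm A [::]| <= C.
Hypothesis hC' : forall w, `|log_det A w| <= C * (size w)%:R.
Hypothesis gap : D < 2 * lam.

Lemma typical_orbit_cone_word (x : nat -> letter) (l q a n0 : nat) (ep Lam : R)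
    (p : {set l.-tuple letter} -> R)
    (P Q : l.-tuple letter -> 'M[R]_2) (g : l.-tuple letter -> R) :
  let del := ep / 200 / q.+1%:R in
  let N := (q * a + a)%N in
  0 < ep -> ep <= 2 * lam - D -> C + `|lam| + `|D| + 1 <= Lam ->
  100 * Lam <= ep * q%:R -> (3 <= q)%N -> (0 < l)%N -> (l <= a)%N -> (n0 <= a)%N ->
  300 * C * l.+1%:R < ep * a%:R ->
  C * (2 * l%:R + 1) + 2 - ln (block_eta lam D l ^+ 2 / 100 / 10) <= a%:R ->
  (forall b, `|ln (g b)| <= a%:R) ->
  N%:R * (lam - del) <= log_norm A (segment x 0 N) ->
  \sum_(t < N) log_norm A (segment x t l) <= N%:R * (l%:R * (lam + del)) ->
  `|log_det A (segment x 0 N) - N%:R * D| <= N%:R * del ->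
  (forall Y Z, p (Y :|: Z) <= p Y + p Z) -> 7 / 8 <= p (good_blocks A lam D l) ->
  (forall Y, a%:R * (p Y - 8^-1) <= \sum_(t < a) (block x l t \in Y)%:R) ->
  (forall Y, a%:R * (p Y - 8^-1) <= \sum_(t < a) (block x l (q * a + t) \in Y)%:R) ->
  (forall b, b \in good_blocks A lam D l ->
    [/\ aligns (block_eta lam D l) (word_matrix A b) (P b), Q b \in unitmx, 0 < g b &
    forall X : 'M[R]_2, 0 < l1norm X ->
    dominated_entry (block_eta lam D l) (block_eta lam D l ^+ 2) (invmx (P b) *m X *m P b) ->
    (exists2 s : R, s = 1 \/ s = - 1 & positive_mx (s *: (invmx (Q b) *m X *m Q b))) /\
    forall v : 'cV[R]_2, (forall i, 0 <= v i 0) ->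
      g b * l1norm X * l1norm (Q b *m v) <= l1norm (X *m (Q b *m v))]) ->
  (forall k : n0.-tuple letter, exists2 t, (t < a)%N & segment x (a + t) n0 = k) ->
  exists j m, [/\ (j < a)%N, (q * a <= m < q * a + a)%N &
    block x l j \in good_blocks A lam D l /\
    cone_word (Q (block x l j)) ep n0 (segment x j (m - j))].
Proof.
move=> del N ep0 epg hLam hq q3 l0 la n0a hK1 hK2 hg hF hS hD psub pg f1 f2 hPQ hk.
have C0 := le_trans ler01 C1.
pose s := contraction_rate lam D * l%:R.
have r0 := contraction_rate_gt0 gap.
have l0' : 0 < l%:R :> R by rewrite ltr0n.
have s0 : 0 < s by rewrite mulr_gt0.
have eta0 := block_eta_gt0 lam D l.
have q0 : 0 < q.+1%:R :> R by rewrite ltr0n.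
have NE : N%:R = q%:R * a%:R + a%:R :> R by rewrite natrD natrM.
have Ndel : N%:R * del = ep * a%:R / 200.
  have -> : N%:R = q.+1%:R * a%:R :> R by rewrite NE -natr1; ring.
  by rewrite /del; field; rewrite gt_eqF.
have a0 : 0 <= a%:R :> R by [].
have EP := ler_wpM2r a0 hq.
have [Lam1 CL ep2 L1 L2] := scale_dominates C1 hLam epg.
have LC : C * a%:R <= Lam * a%:R by rewrite ler_wpM2r.
have La : a%:R <= Lam * a%:R by rewrite ler_peMl.
have La1 : `|lam| * a%:R <= Lam * a%:R by rewrite ler_wpM2r.
have La2 : `|D| * a%:R <= Lam * a%:R by rewrite ler_wpM2r.
have epa : ep * a%:R <= 2 * Lam * a%:R by rewrite ler_wpM2r.
have epa0 : 0 <= ep * a%:R by rewrite mulr_ge0// ltW.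
have a_large : l%:R * (N%:R * (2 * del) + 3 * C * l.+1%:R) < s * (a%:R / 4).
  have -> : s * (a%:R / 4) = l%:R * (contraction_rate lam D * a%:R / 4).
    by rewrite /s; ring.
  rewrite ltr_pM2l//.
  have h1 : ep * a%:R / 12 <= contraction_rate lam D * a%:R.
    by rewrite mulrAC ler_wpM2r// /contraction_rate ler_wpM2r.
  have -> : N%:R * (2 * del) = 2 * (N%:R * del) by ring.
  by rewrite Ndel; apply: loss_budget h1 hK1; [exact: lt_le_trans ltr01 C1|rewrite ltr0n].
have s_eta : expR (- s) = 36 * (36 * block_eta lam D l).
  by rewrite /block_eta /s; field.
have gN : ep * N%:R <= (2 * lam - D) * N%:R by rewrite ler_wpM2r.
have contr : N%:R * (D + del) + C * (6 * a%:R + 2 * l%:R + 1) + 2 <=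
  2 * (N%:R * (lam - del)) + ln (block_eta lam D l ^+ 2 / 100 / 10).
  rewrite mulrBr mulrDr Ndel NE.
  by apply: (contraction_budget EP LC La) => //; rewrite -NE.
have long : (a + l <= q * a)%N by clear -la q3; nia.
have [j [m [[ja mN jg] [hdom Fge Fle Ld]]]] := typical_subword hA C1 hC hC' s0 hF hS
  a_large eta0 s_eta psub pg f1 f2 (fun b bg => let: And4 h _ _ _ := hPQ b bg in h)
  hD long contr.
have Fup := F_upper hA C1 hC hS l0.
exists j, m; split => //; split => //.
have [_ uQ gb0 hb] := hPQ _ jg.
have [hpos hgrow] := hb _ (l1norm_word_gt0 hA _) hdom.
have [m1 m2] : (q * a <= m)%N /\ (m < q * a + a)%N by case/andP: mN.
set n := (m - j)%N in Fge Fle Ld hdom hpos hgrow *.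
have [n1 n2] : N%:R - 2 * a%:R <= n%:R :> R /\ n%:R <= N%:R :> R.
  rewrite lerBlDr -natrM -natrD !ler_nat /n /N; clear -m1 m2 ja; split; lia.
have n0' : 0 <= n%:R :> R by [].
rewrite /cone_word size_segment; split => //.
- move=> v v0; apply: le_trans (hgrow v v0); rewrite ler_wpM2r ?l1norm_ge0//.
  rewrite -[X in _ <= X * _]lnK ?posrE// -expR_log_norm// -expRD ler_expR.
  have := hg (block x l j); rewrite ler_norml => /andP[hg1 _].
  rewrite mulrBr Ndel NE in Fge.
  apply: (growth_budget EP LC La epa0 epa Fge) => //; last by rewrite -NE.
  by apply: trimming_error; rewrite -NE.
- rewrite mulrDr Ndel NE in Fup.
  apply: (norm_budget EP LC La epa0 epa Fle Fup) => //; last by rewrite -NE.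
    by have -> : 100 * (3 * C * l.+1%:R) = 300 * C * l.+1%:R by ring.
  by apply: trimming_error; rewrite -NE.
- rewrite Ndel NE in Ld.
  apply: (det_budget EP LC La epa0 epa Ld) => //; last by rewrite -NE.
  by apply: trimming_error; rewrite -NE.
- move=> k; have [t ta <-] := hk k; apply: infix_segment; clear -ta ja m1 m2 n0a q3.
    by lia.
  by rewrite /n; nia.
Qed.

End ConeWords.

(** * Exponentially many cone words of the same length *)

Lemma counting_budget (R : realFieldType) (hh e LM a q l n : R) :
  0 <= a -> 0 <= LM -> 0 < e -> 0 <= l -> l <= a ->
  20 * (1 + LM + `|hh| + e) <= e * q ->
  q * a + a - 2 * a <= n -> n <= q * a + a ->
  n * (hh - e) <= (q * a + a + l) * (hh - e / 4) - (2 * a + (2 * a + 2 * l) * LM).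
Proof.
move=> a0 LM0 e0 l0 la /(ler_wpM2r a0) hq n1 n2.
have h1 := ler_wpM2l (ltW e0) n1.
have h2 := ler_wpM2r LM0 la; have h3 := ler_wpM2l (ltW e0) la.
have h4 : - (3 * a * `|hh|) <= (q * a + a + l - n) * hh.
  rewrite lerNl -mulrN; apply: le_trans (ler_norm _) _.
  by rewrite normrM normrN ler_wpM2r// ger0_norm; lra.
have h5 := mulr_ge0 a0 LM0; have h6 := mulr_ge0 a0 (ltW e0).
have h7 := mulr_ge0 a0 (normr_ge0 hh); lra.
Qed.

Section ManyConeWords.
Variables (R : realType) (M : nat) (A : 'I_M.+1 -> 'M[R]_2).
Hypothesis hA : forall j, A j \in unitmx.
Notation letter := 'I_M.+1.
Notation X := (borel_shift_space M).
Notation T := (@left_shift M).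
Variable mu : probability X R.
Hypotheses (full : fully_supported mu) (inv : invariant_measure T mu)
  (erg : ergodic T mu).
Variables lam D : R.
Hypothesis lam_le : forall n, n%:R * lam <= \int[mu]_x log_norm A (mkseq x n).
Hypothesis lam_cvg :
  n%:R^-1 * \int[mu]_x log_norm A (mkseq x n) @[n --> \oo] --> lam.
Hypothesis D_int : forall n, \int[mu]_x log_det A (mkseq x n) = n%:R * D.
Hypothesis gap : D < 2 * lam.

Lemma block_prefix_word (x : X) l t : block x l t = prefix_word (iter t T x) l.
Proof. by apply: val_inj; rewrite val_block val_prefix_word mkseq_iter. Qed.

Lemma nat_above (r : R) : exists a0 : nat, forall a, (a0 <= a)%N -> r < a%:R.
Proof.
exists (Num.bound `|r|) => a ha; apply: le_lt_trans (ler_norm r) _.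
by apply: lt_le_trans (archi_boundP (normr_ge0 r)) _; rewrite ler_nat.
Qed.

Lemma log_norm_det_bound : exists C, [/\ 1 <= C, forall u v,
  [/\ log_norm A u - C * (size v)%:R <= log_norm A (u ++ v),
      log_norm A v - C * (size u)%:R <= log_norm A (u ++ v),
      log_norm A (u ++ v) <= log_norm A u + C * (size v)%:R &
      log_norm A (u ++ v) <= log_norm A v + C * (size u)%:R] /\
  `|log_norm A [::]| <= C & forall w, `|log_det A w| <= C * (size w)%:R].
Proof.
have [C1 C11 h1] := log_norm_bound hA; have [C2 C21 h2] := log_det_bound hA.
have s1 (w : seq letter) : C1 * (size w)%:R <= (C1 + C2) * (size w)%:R.
  by rewrite ler_wpM2r// lerDl (le_trans ler01).
have s2 (w : seq letter) : C2 * (size w)%:R <= (C1 + C2) * (size w)%:R.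
  by rewrite ler_wpM2r// lerDr (le_trans ler01).
exists (C1 + C2); split.
- by apply: le_trans C11 _; rewrite lerDl (le_trans ler01).
- move=> u v; have [[g1 g2 g3 g4] g5] := h1 u v.
  have := s1 u; have := s1 v => sv su; split; last first.
    by apply: le_trans g5 _; rewrite lerDl (le_trans ler01).
  split.
  + by apply: le_trans g1; rewrite lerD2l lerN2.
  + by apply: le_trans g2; rewrite lerD2l lerN2.
  + by apply: le_trans g3 _; rewrite lerD2l.
  + by apply: le_trans g4 _; rewrite lerD2l.
- by move=> w; apply: le_trans (h2 w) (s2 w).
Qed.

(** All hypotheses of the deterministic statement hold with probability tending
    to one, because each is an instance of the lower bound for subadditive
    processes. *)
Lemma likely_cone_word (n0 : nat) (ep Lam : R) : 0 < ep -> ep <= 2 * lam - D ->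
  exists2 q : nat, Lam <= ep * q%:R & exists2 l : nat, (0 < l)%N &
  exists Q : l.-tuple letter -> 'M[R]_2,
  exists2 E : nat -> set X, likely mu E & exists a0 : nat, forall a, (a0 <= a)%N ->
   forall x, E a x -> exists j m, [/\ (j < a)%N, (q * a <= m < q * a + a)%N,
    Q (block x l j) \in unitmx &
    cone_word A lam D (Q (block x l j)) ep n0 (segment x j (m - j))].
Proof.
move=> ep0 epg; have [C [C1 hC hC']] := log_norm_det_bound.
(* The constant [Lam] asked for may be negative; this one bounds all rates. *)
pose Lam' := `|Lam| + (C + `|lam| + `|D| + 1).
have [q0 hq0] := nat_above (100 * Lam' / ep); pose q := q0.+3.
have hq : 100 * Lam' <= ep * q%:R.
  by rewrite -ler_pdivrMl// mulrC ltW// hq0// /q; lia.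
have Lam0 : 0 <= C + `|lam| + `|D| + 1 by rewrite !addr_ge0// (le_trans ler01).
have hL : Lam <= Lam' by rewrite (le_trans (ler_norm _))// lerDl.
have L0 : 0 <= Lam' by rewrite addr_ge0.
exists q.
  by apply: le_trans hL (le_trans _ hq); rewrite ler_peMl// ler1n.
pose del := ep / 200 / q.+1%:R.
have del0 : 0 < del := divr_gt0 (divr_gt0 ep0 (ltr0n R 200)) (ltr0n R q.+1).
have [l [l0 hl hp]] := many_good_blocks hA inv erg lam_le lam_cvg D_int gap (divr_gt0 del0 (ltr0n R 2)).
exists l => //.
have /choice[PQg hPQg] := good_block_cone hA gap (l := l).
exists (fun b => (PQg b).1.2).
pose k a := (q * a + a)%N.
have hk a : (a <= k a)%N by rewrite leq_addl.
have l0' : 0 < l%:R :> R by rewrite ltr0n.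
have del2 := mulr_gt0 l0' (divr_gt0 del0 (ltr0n R 2)).
have e8 : 0 < 8^-1 :> R by rewrite invr_gt0.
have h1 := likely_log_norm hA inv erg lam_le del0 hk.
have h2 := likely_log_norm_average A inv erg l del2 hk.
have h3 := likely_log_det hA inv erg D_int del0 hk.
have h4 := likely_forall (fun Y : {set l.-tuple letter} => likely_frequency inv erg Y (fun=> 0%N) e8).
have h5 := likely_forall (fun Y : {set l.-tuple letter} => likely_frequency inv erg Y (fun a => q * a)%N e8).
have h6 := likely_visits full inv erg n0 id.
apply: (ex_intro2 _ _ _ (likelyI (likelyI (likelyI h1 h2) (likelyI h3 h4)) (likelyI h5 h6))).
have [a1 ha1] := nat_above (300 * C * l.+1%:R / ep).
have [a2 ha2] := nat_above (C * (2 * l%:R + 1) + 2 - ln (block_eta lam D l ^+ 2 / 100 / 10)).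
have [a3 ha3] := nat_above (\sum_b `|ln (PQg b).2|).
exists (a1 + a2 + a3 + l + n0)%N => a ha x [[[x1 x2] [x3 x4]] [x5 x6]].
have [a1a a2a a3a la n0a] : [/\ a1 <= a, a2 <= a, a3 <= a, l <= a & n0 <= a]%N.
  by clear -ha; split; lia.
have a0 : (0 < a)%N by exact: leq_trans l0 la.
have h7 : forall b, b \in good_blocks A lam D l ->
    [/\ aligns (block_eta lam D l) (word_matrix A b) (PQg b).1.1, (PQg b).1.2 \in unitmx,
    0 < (PQg b).2 &
    forall X : 'M[R]_2, 0 < l1norm X ->
    dominated_entry (block_eta lam D l) (block_eta lam D l ^+ 2)
      (invmx (PQg b).1.1 *m X *m (PQg b).1.1) ->
    (exists2 s : R, s = 1 \/ s = - 1 &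
       positive_mx (s *: (invmx (PQg b).1.2 *m X *m (PQg b).1.2))) /\
    forall v : 'cV[R]_2, (forall i, 0 <= v i 0) ->
      (PQg b).2 * l1norm X * l1norm ((PQg b).1.2 *m v) <= l1norm (X *m ((PQg b).1.2 *m v))].
  by move=> b /hPQg; case: (PQg b) => -[P Q] g.
suff [j [m [jm1 jm2 [jm3 jm4]]]] : exists j m, [/\ (j < a)%N, (q * a <= m < q * a + a)%N &
    block x l j \in good_blocks A lam D l /\
    cone_word A lam D (PQg (block x l j)).1.2 ep n0 (segment x j (m - j))].
  by exists j, m; split=> //; have [] := h7 _ jm3.
apply: (@typical_orbit_cone_word _ _ _ hA lam D C C1 hC hC' gap x l q a n0 ep Lam'
    (@block_prob _ _ mu l) (fun b => (PQg b).1.1) (fun b => (PQg b).1.2) (fun b => (PQg b).2)).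
all: try assumption.
- by rewrite lerDr.
- by [].
- by rewrite -ltr_pdivrMl// mulrC; exact: ha1.
- exact/ltW/ha2.
- move=> b; apply: le_trans (ltW (ha3 _ a3a)).
  by rewrite (bigD1 b)//= lerDl sumr_ge0.
- apply: le_trans (ler_wpM2l (ler0n R _) (_ : _ <= l%:R * (lam + del))).
    move: x2; rewrite /= /k; congr (_ <= _).
    by apply: eq_bigr => t _; rewrite mkseq_iter.
  rewrite [X in _ * (_ + X)]splitr addrA mulrDr.
  by rewrite lerD2r.
- exact: block_prob_sub.
- by move=> Y; under eq_bigr do rewrite block_prefix_word; exact: x4.
- by move=> Y; under eq_bigr do rewrite block_prefix_word; exact: x5.
- move=> w; have [t ta <-] := x6 a0 w; exists t => //.
  by rewrite val_prefix_word mkseq_iter.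
Qed.

Lemma cone_word_weaken Q (e e' : R) n0 w : e <= e' ->
  cone_word A lam D Q e n0 w -> cone_word A lam D Q e' n0 w.
Proof.
move=> ee' [h1 h2 h3 h4 h5]; have hw := ler_wpM2l (ler0n R (size w)) ee'.
split => //.
- move=> v /h2; apply: le_trans; apply: ler_wpM2r; first exact: l1norm_ge0.
  by rewrite ler_expR !mulrBr lerD2l lerN2.
- by apply: le_trans h3 _; rewrite !mulrDr lerD2l.
- exact: le_trans h4 hw.
Qed.

(** A typical prefix is determined by its cone word together with the block, the
    position of the word, and the letters in the two windows. The number of these
    data is exponential in the length of the windows only, so that some value is
    shared by a set of prefixes that is almost as large as the set of all typical
    ones. *)
Lemma many_cone_words (hh : R) :
  (forall e, 0 < e -> exists2 del, 0 < del & exists n1 : nat, forall n, (n1 <= n)%N ->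
    forall E : {set n.-tuple letter},
      1 - del <= prob mu [set x | prefix_word x n \in E] ->
      expR (n%:R * (hh - e)) <= #|E|%:R) ->
  forall (n0 n1 : nat) (e : R), 0 < e -> exists n, exists Gamma : {set n.-tuple letter},
  exists Q, [/\ (n1 <= n)%N, Q \in unitmx, expR (n%:R * (hh - e)) <= #|Gamma|%:R &
    forall w, w \in Gamma -> cone_word A lam D Q e n0 w].
Proof.
move=> hent n0 n1 e e0.
pose ep := Num.min e (2 * lam - D).
have ep0 : 0 < ep by rewrite lt_min e0 subr_gt0.
have epe : ep <= e by rewrite ge_min lexx.
have epg : ep <= 2 * lam - D by rewrite ge_min lexx orbT.
pose LM := ln (M.+1%:R : R).
have LM0 : 0 <= LM by rewrite ln_ge0// ler1n.
have [q hq [l l0 [Q [E [mE hE] [a1 ha1]]]]] :=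
  likely_cone_word n0 (20 * (1 + LM + `|hh| + e)) ep0 epg.
have [del del0 [n2 hn2]] := hent _ (divr_gt0 e0 (ltr0n R 4)).
have [a2 ha2] := hE _ del0.
pose a := (a1 + a2 + n2 + l + 3 * n1).+1; pose N := (q * a + a)%N.
have [a1a a2a n2N la n1a] : [/\ a1 <= a, a2 <= a, n2 <= N + l, l <= a & 3 * n1 <= a]%N.
  by rewrite /N /a; clear; split; nia.
have q3 : (3 <= q)%N.
  rewrite -(ler_nat R) -(ler_pM2l e0); apply: le_trans (le_trans hq _); last first.
    by rewrite ler_wpM2r.
  by have := normr_ge0 hh; lra.
pose EE := [set v : (N + l).-tuple letter | `[<exists2 x, E a x & prefix_word x (N + l) = v>]]%SET.
have cardE : expR ((N + l)%:R * (hh - e / 4)) <= #|EE|%:R.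
  apply: hn2 => //; apply: le_trans (ha2 _ a2a) _; apply: prob_le.
  - exact: mE.
  - exact: (measurable_block EE).
  - by move=> x Ex; rewrite /= inE; apply/asboolP; exists x.
have /choice[d hd] : forall v : (N + l).-tuple letter, exists d : X * nat * nat, v \in EE ->
    let: (x, j, m) := d in
    [/\ prefix_word x (N + l) = v, (j < a)%N, (q * a <= m < q * a + a)%N,
      Q (block x l j) \in unitmx &
      cone_word A lam D (Q (block x l j)) ep n0 (segment x j (m - j))].
  move=> v; have [|vE] := boolP (v \in EE); last by exists (cst ord0, 0%N, 0%N).
  rewrite inE => /asboolP[x Ex xv]; have [j [m [h1 h2 h3 h4]]] := ha1 _ a1a _ Ex.
  by exists (x, j, m).
(* the data that determine a prefix together with its cone word *)
pose L : finType := ('I_a.+1 * 'I_a.+1 * l.-tuple letter * a.-tuple letter * (a + l).-tuple letter)%type.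
pose phi v : L := let: (x, j, m) := d v in
  (inord j, inord (m - q * a), block x l j, prefix_word x a, prefix_word (iter (q * a) T x) (a + l)).
have : (0 < #|EE|)%N.
  by rewrite -(ltr0n R); apply: lt_le_trans cardE; exact: expR_gt0.
case/card_gt0P=> v0 v0E.
have [c /imsetP[v1 v1E ->] hcard] := pigeonhole_fiber phi v0E.
set F := [set v in EE | phi v == phi v1]%SET in hcard.
case E1 : (d v1) => [[x1 j] m]; have := hd _ v1E; rewrite E1 => -[xv1 ja /andP[m1 m2] uQ cw1].
have hF v : v \in F -> exists x, [/\ d v = (x, j, m), prefix_word x (N + l) = v,
    prefix_word x a = prefix_word x1 a,
    prefix_word (iter (q * a) T x) (a + l) = prefix_word (iter (q * a) T x1) (a + l) &
    cone_word A lam D (Q (block x1 l j)) ep n0 (segment x j (m - j))].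
  rewrite !inE => /andP[/asboolP hv /eqP]; have /hd : v \in EE by rewrite inE; apply/asboolP.
  rewrite /phi E1; case: (d v) => [[x j'] m'] [xv j'a /andP[m'1 m'2] _ cw] hL.
  have e1 := congr1 (fun t : L => t.1.1.1.1) hL.
  have e2 := congr1 (fun t : L => t.1.1.1.2) hL.
  have e3 := congr1 (fun t : L => t.1.1.2) hL.
  have e4 := congr1 (fun t : L => t.1.2) hL.
  have e5 := congr1 (fun t : L => t.2) hL.
  rewrite /= in e1 e2 e3 e4 e5.
  have ej : j' = j.
    by move: (congr1 val e1); rewrite /= !inordK// ltnS ltnW.
  have em : m' = m.
    move: (congr1 val e2); rewrite /= !inordK; try by clear -m'2 m2; lia.
    by clear -m1 m'1; lia.
  by exists x; split => //; [rewrite ej em|rewrite -e3 -ej -em].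
pose n := (m - j)%N.
pose mid v := block (d v).1.1 n j.
have mid_inj : {in F &, injective mid}.
  move=> v w /hF[x [dv xv ha2x hqx _]] /hF[y [dw yw ha2y hqy _]].
  rewrite /mid dv dw /= => hxy; rewrite -xv -yw; apply/eq_prefix_word => i iN.
  have /eq_prefix_word h1 : prefix_word x a = prefix_word y a by rewrite ha2x ha2y.
  have /eq_prefix_word h2 := etrans hqx (esym hqy).
  have [ia|ai] := ltnP i a; first exact: h1.
  have [im|mi] := ltnP i m.
    have ijn : (i - j < n)%N by rewrite /n; clear -im ja ai; lia.
    have := congr1 (fun t => tnth t (Ordinal ijn)) hxy; rewrite !tnth_mktuple /=.
    by rewrite subnKC//; clear -ja ai; lia.
  have := h2 (i - q * a)%N; rewrite !iter_left_shift subnKC; last by clear -m1 mi; lia.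
  by apply; move: iN; rewrite /N; clear -m1 mi; lia.
exists n, [set mid v | v in F]%SET, (Q (block x1 l j)); split => //.
- by rewrite /n; clear -m1 ja n1a q3; nia.
- rewrite card_in_imset//.
  pose B : R := 2 * a%:R + (2 * a%:R + 2 * l%:R) * LM.
  have LB : #|L|%:R <= expR B.
    rewrite !card_prod !card_tuple !card_ord !natrM !natrX.
    have e1 k : (M.+1%:R : R) ^+ k = expR (k%:R * LM) by rewrite expRM_natl lnK ?posrE ?ltr0n.
    have e2 : a.+1%:R <= expR a%:R :> R by rewrite -natr1 addrC expR_ge1Dx.
    rewrite !e1 -!mulrA -!expRD mulrA.
    have -> : expR B = expR a%:R * expR a%:R * expR (l%:R * LM + (a%:R * LM + (a + l)%:R * LM)).
      by rewrite -!expRD natrD /B; congr expR; ring.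
    by apply: ler_wpM2r; rewrite ?expR_ge0//; apply: ler_pM.
  have hc : n%:R * (hh - e) <= (N + l)%:R * (hh - e / 4) - B.
    rewrite natrD /N natrD natrM; apply: counting_budget => //.
    - by rewrite ler_nat.
    - by apply: le_trans hq _; apply: ler_wpM2r.
    - have -> : q%:R * a%:R + a%:R - 2 * a%:R = (q * a)%:R - a%:R :> R.
        by rewrite natrM; ring.
      by rewrite lerBlDr -(natrD R n a) ler_nat /n; clear -m1 ja; lia.
    - by rewrite -(natrM R q a) -(natrD R (q * a) a) ler_nat /n; clear -m2; lia.
  rewrite -(ler_pM2l (expR_gt0 B)) -expRD; apply: le_trans (_ : #|EE|%:R <= _).
    by apply: le_trans cardE; rewrite ler_expR addrC -lerBrDr.
  apply: le_trans (_ : #|L|%:R * #|F|%:R <= _); first by rewrite -natrM ler_nat.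
  exact: ler_wpM2r.
- move=> w /imsetP[v /hF[x [dv _ _ _ cw]] ->]; apply: (cone_word_weaken epe).
  by rewrite (_ : val (mid v) = segment x j n)// /mid dv val_block.
Qed.
End ManyConeWords.

(** * The Euclidean norm and the cone of a frame *)

Section Cones.
Variable R : realType.
Implicit Types (X Y Q : 'M[R]_2) (u v : 'cV[R]_2).

Lemma enormE u : enorm u = Num.sqrt (u 0 0 ^+ 2 + u 1 0 ^+ 2).
Proof. by rewrite /enorm sum_ord2. Qed.

Lemma enorm_ge0 u : 0 <= enorm u. Proof. exact: sqrtr_ge0. Qed.

Lemma enormZ (a : R) u : enorm (a *: u) = `|a| * enorm u.
Proof.
by rewrite !enormE !mxE !exprMn -mulrDr sqrtrM ?sqr_ge0// sqrtr_sqr.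
Qed.

Lemma enorm_le_l1norm u : enorm u <= l1norm u.
Proof.
rewrite enormE l1norm_col2E -[leRHS]ger0_norm ?addr_ge0// -sqrtr_sqr ler_wsqrtr//.
by rewrite sqrrD !real_normK ?num_real// addrAC lerDl mulrn_wge0// mulr_ge0.
Qed.

Lemma coord_le_enorm u i : `|u i 0| <= enorm u.
Proof.
rewrite -sqrtr_sqr enormE ler_wsqrtr//; move: i.
by apply: ord2P; rewrite ?lerDl ?lerDr sqr_ge0.
Qed.

Lemma l1norm_le_enorm u : l1norm u <= 2 * enorm u.
Proof.
rewrite l1norm_col2E; have := coord_le_enorm u 0; have := coord_le_enorm u 1; lra.
Qed.

Lemma enorm_gt0 u : u != 0 -> 0 < enorm u.
Proof.
move=> u0; have := l1norm_gt0 u0; have := l1norm_le_enorm u; have := enorm_ge0 u; lra.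
Qed.

Lemma enorm_mul_le X u : enorm (X *m u) <= l1norm X * enorm u.
Proof.
apply: le_trans (enorm_le_l1norm _) _.
rewrite l1norm_col2E l1norm2E !mulmx2E.
have h i : `|X i 0 * u 0 0 + X i 1 * u 1 0| <= (`|X i 0| + `|X i 1|) * enorm u.
  apply: le_trans (ler_normD _ _) _; rewrite !normrM mulrDl.
  by rewrite lerD// ler_wpM2l// coord_le_enorm.
by rewrite mulrDl lerD.
Qed.

Lemma opnorm_has_sup X :
  has_sup [set enorm (X *m u) | u in [set u : 'cV[R]_2 | enorm u = 1]].
Proof.
split; last first.
  by exists (l1norm X) => _ [u /= u1 <-]; rewrite -[l1norm X]mulr1 -u1 enorm_mul_le.
pose u : 'cV[R]_2 := \col_i (i == 0)%:R.
exists (enorm (X *m u)); exists u => //=.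
by rewrite enormE !mxE /= expr1n expr0n addr0 sqrtr1.
Qed.

Lemma opnorm_le X : opnorm X <= l1norm X.
Proof.
apply: ge_sup; first by have [] := opnorm_has_sup X.
by move=> _ [u /= u1 <-]; rewrite -[l1norm X]mulr1 -u1 enorm_mul_le.
Qed.

Lemma le_opnorm X u : enorm (X *m u) <= opnorm X * enorm u.
Proof.
have [->|u0] := eqVneq u 0.
  by rewrite mulmx0 -(scale0r 0) enormZ normr0 !mul0r mulr0.
have e0 := enorm_gt0 u0.
rewrite -ler_pdivrMr// mulrC -[(enorm u)^-1]ger0_norm ?invr_ge0 ?enorm_ge0//.
rewrite -enormZ scalemxAr; apply: ub_le_sup; first by have [] := opnorm_has_sup X.
by exists ((enorm u)^-1 *: u) => //=; rewrite enormZ ger0_norm ?invr_ge0 ?enorm_ge0// mulVf// gt_eqF.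
Qed.

Definition cone_of Q : set 'cV[R]_2 :=
  [set u | u != 0 /\ forall i, 0 <= (invmx Q *m u) i 0].

Lemma continuous_row_form X i : continuous (fun u : 'cV[R]_2 => (X *m u) i 0).
Proof.
have h (a : R) j : continuous (fun u : 'cV[R]_2 => a * u j 0).
  by move=> u; apply: (@continuousM R _ (fun=> a) (fun u : 'cV[R]_2 => u j 0));
    [exact: cst_continuous|exact: coord_continuous].
rewrite (_ : (fun u => _) = (fun u : 'cV[R]_2 => X i 0 * u 0 0) \+ (fun u : 'cV[R]_2 => X i 1 * u 1 0)).
  by move=> u; apply: continuousD; exact: h.
by apply/funext => v; rewrite mulmx2E.
Qed.

Lemma cone_interior Q u :
  (forall i, 0 < (invmx Q *m u) i 0) -> (cone_of Q)° u.
Proof.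
move=> hu.
have h0 := cvgr_gt _ (@continuous_row_form (invmx Q) 0 u) _ (hu 0).
have h1 := cvgr_gt _ (@continuous_row_form (invmx Q) 1 u) _ (hu 1).
rewrite /interior /=; apply: filterS2 (h0 _) (h1 _) => v v0 v1.
split; first by apply: contraTneq v0 => ->; rewrite mulmx0 mxE ltxx.
by apply: ord2P; exact: ltW.
Qed.

Lemma cone_of_cone Q : Q \in unitmx -> is_cone (cone_of Q).
Proof.
move=> uQ; split.
- move=> u v t [u0 hu] [v0 hv] /andP[t0 t1].
  have t1' : 0 <= 1 - t by rewrite subr_ge0.
  have hi i : (invmx Q *m (t *: u + (1 - t) *: v)) i 0 =
      t * (invmx Q *m u) i 0 + (1 - t) * (invmx Q *m v) i 0.
    by rewrite mulmxDr -!scalemxAr !mxE.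
  split; last by move=> i; rewrite hi addr_ge0// mulr_ge0.
  have inj (w : 'cV[R]_2) : w != 0 -> exists i, (invmx Q *m w) i 0 != 0.
    move=> w0; apply/existsP; apply: contraNT w0 => /existsPn h.
    rewrite -(mulKVmx uQ w) (_ : invmx Q *m w = 0) ?mulmx0//.
    by apply/colP => i; rewrite [RHS]mxE; apply/eqP; have := h i; rewrite negbK.
  apply/eqP => z0.
  have z i : t * (invmx Q *m u) i 0 + (1 - t) * (invmx Q *m v) i 0 = 0.
    by rewrite -hi z0 mulmx0 mxE.
  have [tz|tz] := eqVneq t 0.
    have [i /eqP] := inj _ v0; apply.
    by have := z i; rewrite tz mul0r add0r subr0 mul1r.
  have [i ui] := inj _ u0; have tp : 0 < t * (invmx Q *m u) i 0.
    by rewrite mulr_gt0// lt_neqAle eq_sym ?tz ?ui/= ?t0 ?hu.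
  have := ltr_wpDr (mulr_ge0 t1' (hv i)) tp.
  by rewrite z ltxx.
- move=> u t [u0 hu] t0; split; first by rewrite scaler_eq0 negb_or gt_eqF.
  by move=> i; rewrite -scalemxAr mxE mulr_ge0// ltW.
- by move=> [/eqP].
- exists [set u : 'cV[R]_2 | forall i, 0 <= (invmx Q *m u) i 0].
    rewrite (_ : [set _ | _] = \bigcap_(i in [set: 'I_2])
       ((fun u : 'cV[R]_2 => (invmx Q *m u) i 0) @^-1` [set x | 0 <= x])).
      apply: closed_bigI => i _; apply: closed_comp; last exact: closed_ge.
      by move=> u _; exact: continuous_row_form.
    by apply/seteqP; split => [u hu i _|u hu i]; apply: hu.
  apply/seteqP; split => u /=.
    by move=> [u0 hu]; split => //; apply/eqP.
  by move=> [hu /eqP].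
- exists (Q *m const_mx 1); apply: cone_interior => i.
  by rewrite mulKmx// mxE.
Qed.
End Cones.

(** * Positive matrices and their powers *)

Section PositiveMatrices.
Variable R : realType.
Implicit Types (X Y Z : 'M[R]_2).

Lemma positive_mx_mul X Y : positive_mx X -> positive_mx Y -> positive_mx (X *m Y).
Proof. by move=> hX hY i j; rewrite mulmx2E addr_gt0// mulr_gt0. Qed.

Lemma scalemx2E n (a : R) (Y : 'M[R]_(2, n)) i j : (a *: Y) i j = a * Y i j.
Proof. exact: mxE. Qed.

Lemma mulmx_nonneg X (v : 'cV[R]_2) : (forall i j, 0 <= X i j) -> (forall i, 0 <= v i 0) ->
  forall i, 0 <= (X *m v) i 0.
Proof. by move=> hX hv i; rewrite mulmx2E addr_ge0// mulr_ge0. Qed.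

Definition diag2 (a b : R) : 'M[R]_2 := diag_mx (\row_j (if j == 0 then a else b)).

Lemma diag2E a b i j : diag2 a b i j = if i == j then (if i == 0 then a else b) else 0.
Proof. by rewrite !mxE; have [->|] := eqVneq i j; rewrite ?mulr1n ?mulr0n. Qed.

Lemma mul_diag2 a b c d : diag2 a b *m diag2 c d = diag2 (a * c) (b * d).
Proof.
apply/matrixP => i j; rewrite mulmx2E !diag2E.
by move: i j; apply: ord2P; apply: ord2P => /=; ring.
Qed.

Lemma diag2X a b p : diag2 a b ^+ p = diag2 (a ^+ p) (b ^+ p).
Proof.
elim: p => [|p IH]; last by rewrite !exprS IH -mul_diag2.
apply/matrixP => i j; rewrite !expr0 diag2E !mxE.
by move: i j; apply: ord2P; apply: ord2P.
Qed.

(** The eigenvectors are explicit, and the projection to the larger eigenvalue is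
    a positive multiple of [X - k2%:M]. *)
Lemma positive_eigenbasis X : positive_mx X -> 0 < \det X ->
  exists k1 k2 : R, exists Z, [/\ 0 < k2, k2 < k1, Z \in unitmx,
    X *m Z = Z *m diag2 k1 k2 & positive_mx (Z *m diag2 1 0 *m invmx Z)].
Proof.
move=> hX; rewrite det2E => dX.
have [a0 b0 c0 d0] : [/\ 0 < X 0 0, 0 < X 0 1, 0 < X 1 0 & 0 < X 1 1] by split; exact: hX.
set a := X 0 0 in a0 dX; set b := X 0 1 in b0 dX; set c := X 1 0 in c0 dX.
set d := X 1 1 in d0 dX.
have bc0 := mulr_gt0 b0 c0.
pose delta := Num.sqrt ((a - d) ^+ 2 + 4 * (b * c)).
have disc0 : 0 <= (a - d) ^+ 2 + 4 * (b * c) by rewrite addr_ge0 ?sqr_ge0// mulr_ge0// ltW.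
have dd : delta ^+ 2 = (a - d) ^+ 2 + 4 * (b * c) by rewrite sqr_sqrtr.
have delta0 : 0 <= delta by exact: sqrtr_ge0.
have h1 : a - d < delta by nra.
have h2 : d - a < delta by nra.
have h3 : delta < a + d by nra.
have delta1 : 0 < delta by lra.
pose k1 := (a + d + delta) / 2; pose k2 := (a + d - delta) / 2.
pose Z : 'M[R]_2 := \matrix_(i, j) (if i == 0 then b else (if j == 0 then k1 - a else k2 - a)).
have k12 : k1 - k2 = delta by rewrite /k1 /k2; field.
have uZ : Z \in unitmx.
  rewrite unitmxE unitfE det2E !mxE /=.
  have -> : b * (k2 - a) - b * (k1 - a) = - (b * delta) by rewrite -k12; ring.
  by rewrite oppr_eq0 mulf_neq0// gt_eqF.
have XZ : X *m Z = Z *m diag2 k1 k2.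
  apply/matrixP => i j; rewrite !mulmx2E !diag2E !mxE.
  move: i j; apply: ord2P; apply: ord2P => /=; rewrite -/a -/b -/c -/d ?mulr0 ?addr0 ?add0r.
  - ring.
  - ring.
  - apply/eqP; rewrite -subr_eq0; apply/eqP.
    transitivity (((a - d) ^+ 2 + 4 * (b * c) - delta ^+ 2) / 4); last by rewrite dd subrr mul0r.
    by rewrite /k1; field.
  - apply/eqP; rewrite -subr_eq0; apply/eqP.
    transitivity (((a - d) ^+ 2 + 4 * (b * c) - delta ^+ 2) / 4); last by rewrite dd subrr mul0r.
    by rewrite /k2; field.
have hP : Z *m diag2 1 0 *m invmx Z = delta^-1 *: (X - k2%:M).
  have -> : delta^-1 *: (X - k2%:M) = delta^-1 *: (X - k2%:M) *m Z *m invmx Z by rewrite mulmxK.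
  congr (_ *m _); rewrite -scalemxAl mulmxBl XZ -scalar_mxC.
  have e : diag2 k1 k2 - k2%:M = delta *: diag2 1 0.
    by rewrite -k12; apply/matrixP => i j; rewrite !mxE; move: i j; apply: ord2P; apply: ord2P;
      rewrite /= ?mulr1n ?mulr0n; ring.
  by rewrite -mulmxBr e -scalemxAr scalerA mulVf ?scale1r// gt_eqF.
exists k1, k2, Z; split => //; [by rewrite /k2; lra|by rewrite /k1 /k2; lra|].
rewrite hP => i j; rewrite !mxE mulr_gt0 ?invr_gt0//.
move: i j; apply: ord2P; apply: ord2P; rewrite /= ?mulr1n ?mulr0n ?subr0 -/a -/b -/c -/d /k2 //; lra.
Qed.

(** Entry by entry, so that the continuity lemmas for real functions apply. *)
Definition entrywise_continuous (F : R -> 'M[R]_2) :=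
  forall i j, continuous (fun t => F t i j).

Lemma entrywise_continuous_cst X : entrywise_continuous (fun=> X).
Proof. by move=> i j t; exact: cst_continuous. Qed.

Lemma entrywise_continuous_diag a : entrywise_continuous (fun t => diag2 a t).
Proof.
move=> i j; rewrite (_ : (fun t => _) = if (i == j) && (i != 0) then id else
    fun=> if i == j then a else 0); last first.
  by apply/funext => t; rewrite diag2E; case: (i == j); case: (i == 0).
by case: ifP => _ t; [exact: cvg_id|exact: cst_continuous].
Qed.

Lemma entrywise_continuous_mul F G : entrywise_continuous F -> entrywise_continuous G ->
  entrywise_continuous (fun t => F t *m G t).
Proof.
move=> hF hG i j.
rewrite (_ : (fun t => _) = (fun t => F t i 0 * G t 0 j) \+ (fun t => F t i 1 * G t 1 j)).
  move=> t; apply: continuousD;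
    [apply: (@continuousM R _ (fun s => F s i 0) (fun s => G s 0 j))|
     apply: (@continuousM R _ (fun s => F s i 1) (fun s => G s 1 j))];
    by [exact: hF|exact: hG].
by apply/funext => t; rewrite mulmx2E.
Qed.

(** After division by powers of [k1], both products are polynomials in
    [t = (k2 / k1) ^+ p], whose values at [t = 0] are multiples of the positive
    projection and of the rank one matrix with entries [c i 0 * c 0 j]. *)
Lemma dominated_products (k1 k2 : R) (c Z : 'M[R]_2) : 0 < k2 -> k2 < k1 ->
  positive_mx (Z *m diag2 1 0 *m invmx Z) -> c 0 0 != 0 ->
  exists p0, forall p, (p0 <= p)%N ->
  positive_mx (Z *m (diag2 k1 k2 ^+ p *m c *m diag2 k1 k2 ^+ p *m c *m diag2 k1 k2 ^+ p)
     *m invmx Z) /\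
  forall i j, c i 0 != 0 -> c 0 j != 0 -> (c *m diag2 k1 k2 ^+ p *m c) i j != 0.
Proof.
move=> k20 k12 hP c00; have k10 := lt_trans k20 k12.
pose r := k2 / k1.
have r1 : `|r| < 1 by rewrite ger0_norm ?divr_ge0 ?ltW// ltr_pdivrMr// mul1r.
pose F (t : R) := Z *m (diag2 1 t *m c *m diag2 1 t *m c *m diag2 1 t) *m invmx Z.
pose G (t : R) := c *m diag2 1 t *m c.
have cd : entrywise_continuous (fun t => diag2 1 t) by exact: entrywise_continuous_diag.
have cF : entrywise_continuous F.
  by do ?apply: entrywise_continuous_mul => //; exact: entrywise_continuous_cst.
have cG : entrywise_continuous G.
  by do ?apply: entrywise_continuous_mul => //; exact: entrywise_continuous_cst.
have dpE p : diag2 k1 k2 ^+ p = k1 ^+ p *: diag2 1 (r ^+ p).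
  rewrite diag2X; apply/matrixP => i j; rewrite scalemx2E !diag2E.
  case: (i == j); last by rewrite mulr0.
  case: (i == 0); first by rewrite mulr1.
  by rewrite /r expr_div_n mulrCA divff ?mulr1// expf_neq0// gt_eqF.
have F0 : F 0 = c 0 0 ^+ 2 *: (Z *m diag2 1 0 *m invmx Z).
  rewrite /F (_ : _ *m c *m diag2 1 0 *m c *m diag2 1 0 = c 0 0 ^+ 2 *: diag2 1 0).
    by rewrite -scalemxAr -scalemxAl.
  apply/matrixP => i j; rewrite scalemx2E !mulmx2E !diag2E.
  by move: i j; apply: ord2P; apply: ord2P => /=; ring.
have hF i j : \forall t \near (0 : R), 0 < F t i j.
  apply: (cvgr_gt _ (cF i j 0)); rewrite F0 scalemx2E mulr_gt0//.
  by rewrite lt_neqAle sqr_ge0 eq_sym sqrf_eq0 c00.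
have hG i j : c i 0 != 0 -> c 0 j != 0 -> \forall t \near (0 : R), G t i j != 0.
  move=> ci cj; apply: (cvgr_neq0 _ (cG i j 0)).
  by rewrite /G !mulmx2E !diag2E /= !mulr0 mulr1 !addr0 mul0r addr0 mulf_neq0.
have near_all (P : 'I_2 -> 'I_2 -> R -> Prop) : (forall i j, \forall t \near (0 : R), P i j t) ->
    \forall t \near (0 : R), forall i j, P i j t.
  move=> h; apply: filterS (filterI (filterI (h 0 0) (h 0 1)) (filterI (h 1 0) (h 1 1))).
  by move=> t [[p00 p01] [p10 p11]]; apply: ord2P; apply: ord2P.
have hG' : \forall t \near (0 : R), forall i j, c i 0 != 0 -> c 0 j != 0 -> G t i j != 0.
  apply: near_all => i j; have [ci|_] := boolP (c i 0 != 0); last by apply: filterE => t.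
  have [cj|_] := boolP (c 0 j != 0); last by apply: filterE => t _.
  by apply: filterS (hG _ _ ci cj).
have [p0 _ hp0] := cvg_expr r1 (filterI (near_all _ hF) hG').
exists p0 => p /hp0 [/= hp1 hp2]; rewrite dpE; split.
  move=> i j; rewrite -!(scalemxAl, scalemxAr) !scalerA scalemx2E mulr_gt0 ?mulr_gt0 ?exprn_gt0//.
move=> i j ci cj; rewrite -!(scalemxAl, scalemxAr) scalemx2E.
by apply: mulf_neq0; [rewrite expf_neq0// gt_eqF|exact: hp2].
Qed.

End PositiveMatrices.

(** * Finite unions of lines *)

Section InvariantLines.
Variable R : realType.
Implicit Types (H Z : 'M[R]_2) (u v : 'cV[R]_2) (S : set 'M[R]_2).

Definition line_union (L : seq {vspace 'cV[R]_2}) : set 'cV[R]_2 :=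
  [set u | exists2 V, V \in L & u \in V].

Lemma eigenbasis_power H Z (k1 k2 : R) r : Z \in unitmx -> H *m Z = Z *m diag2 k1 k2 ->
  invmx Z *m H ^+ r *m Z = diag2 k1 k2 ^+ r.
Proof.
move=> uZ HZ; elim: r => [|r IH]; first by rewrite !expr0 mulmx1 mulVmx.
by rewrite !exprSr -IH -!mulmxE -!mulmxA HZ.
Qed.

Lemma dim1_colinear (V : {vspace 'cV[R]_2}) u v : \dim V = 1%N -> u != 0 ->
  u \in V -> v \in V -> exists a, v = a *: u.
Proof.
move=> dV u0 uV vV; apply/vlineP.
suff /eqP -> : <[u]>%VS == V by [].
by rewrite eqEdim -memvE uV dV dim_vline u0.
Qed.

(** By pigeonhole two of the vectors share a line. *)
Lemma finite_lines_recurrence (L : seq {vspace 'cV[R]_2}) (v : nat -> 'cV[R]_2) :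
  (forall V, V \in L -> \dim V = 1%N) -> (forall k, v k != 0) ->
  (forall k, line_union L (v k)) ->
  exists i j a, (i < j)%N /\ v j = a *: v i.
Proof.
move=> dL v0 vL.
have /choice[V hV] : forall k, exists V, V \in L /\ v k \in V.
  by move=> k; have [W WL vW] := vL k; exists W.
pose f (k : 'I_(size L).+1) : 'I_(size L) := Ordinal (etrans (index_mem (V k) L) (hV k).1).
have : ~~ injectiveb f.
  by apply/injectiveP => /leq_card; rewrite !card_ord ltnn.
move/injectivePn => [i [j ij /(congr1 val) /= fij]].
have Vij : V i = V j by rewrite -(nth_index fullv (hV i).1) fij nth_index// (hV j).1.
wlog lt_ij : i j ij fij Vij / (i < j)%N.
  move=> h; have [lij|lji|eij] := ltngtP i j; first exact: (h i j).
    by apply: (h j i) => //; rewrite eq_sym.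
  by case/eqP: ij; apply: val_inj.
have vj : v j \in V i by rewrite Vij; exact: (hV j).2.
have [a ha] := dim1_colinear (dL _ (hV i).1) (v0 i) (hV i).2 vj.
by exists i, j, a.
Qed.

Lemma coord_column Z B i j : (invmx Z *m (B *m col j Z)) i 0 = (invmx Z *m B *m Z) i j.
Proof. by rewrite colE !mulmxA -colE mxE. Qed.

Lemma expand_columns Z u : Z \in unitmx ->
  u = (invmx Z *m u) 0 0 *: col 0 Z + (invmx Z *m u) 1 0 *: col 1 Z.
Proof.
move=> uZ; rewrite -[LHS](mulKVmx uZ); apply/matrixP => i j.
by rewrite (ord1 j) mulmx2E !mxE mulrC [in X in _ + X = _]mulrC.
Qed.

(** The powers of [H ^+ m] move every line but the two eigenlines through
    infinitely many lines, hence an invariant union consists of eigenlines. It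
    does not contain the first one, which [B1] maps to no eigenline; nor the
    second one, which [B2] does not fix and can only map to the first one. *)
Lemma hyperbolic_strongly_irreducible S H Z B1 B2 (k1 k2 : R) m :
  0 < k2 -> k2 < k1 -> Z \in unitmx -> H *m Z = Z *m diag2 k1 k2 -> (0 < m)%N ->
  S (H ^+ m) -> S B1 -> S B2 ->
  (invmx Z *m B1 *m Z) 0 0 != 0 -> (invmx Z *m B1 *m Z) 1 0 != 0 ->
  (invmx Z *m B2 *m Z) 0 1 != 0 -> strongly_irreducible S.
Proof.
move=> k20 k21 uZ HZ m0 SH S1 S2 b00 b10 b01 [L [L0 dL hL]].
have k10 := lt_trans k20 k21.
have inv B u : S B -> line_union L u -> line_union L (B *m u).
  by move=> SB hu; apply: (hL _ SB); exists u.
have scale a u : line_union L u -> line_union L (a *: u).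
  by move=> [V VL uV]; exists V => //; rewrite memvZ.
have axis u : line_union L u -> (invmx Z *m u) 0 0 = 0 \/ (invmx Z *m u) 1 0 = 0.
  move=> hu; have [x0|x0] := eqVneq ((invmx Z *m u) 0 0) 0; first by left.
  have [x1|x1] := eqVneq ((invmx Z *m u) 1 0) 0; first by right.
  pose v k := H ^+ (m * k) *m u.
  have hv k : line_union L (v k).
    elim: k => [|k IH]; first by rewrite /v muln0 expr0 mul1mx.
    by rewrite /v mulnS exprD -mulmxE -mulmxA; exact: inv.
  have xv k i : (invmx Z *m v k) i 0 = (if i == 0 then k1 else k2) ^+ (m * k) * (invmx Z *m u) i 0.
    have -> : invmx Z *m v k = diag2 k1 k2 ^+ (m * k) *m (invmx Z *m u).
      by rewrite -(eigenbasis_power (m * k) uZ HZ) -!mulmxA mulKVmx.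
    rewrite diag2X mulmx2E !diag2E; move: i.
    by apply: ord2P => /=; rewrite mul0r ?addr0 ?add0r.
  have v0 k : v k != 0.
    apply: contra_neq x0 => vk; have := xv k 0; rewrite vk mulmx0 mxE /= => /esym/eqP.
    by rewrite mulf_eq0 expf_eq0 gt_eqF// andbF => /eqP.
  have [i [j [a [ij hij]]]] := finite_lines_recurrence dL v0 hv.
  have e n : (invmx Z *m v j) n 0 = a * (invmx Z *m v i) n 0.
    by rewrite hij -scalemxAr scalemx2E.
  have e0 := e 0; have e1 := e 1; rewrite !xv /= mulrA in e0; rewrite !xv /= mulrA in e1.
  have /mulIf c0 := x0; have /mulIf c1 := x1; move/c0: e0 => e0; move/c1: e1 => e1.
  have mij : (m * j = m * (j - i) + m * i)%N by rewrite -mulnDr subnK// ltnW.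
  have p0 k : 0 < k -> forall r, k ^+ r != 0 :> R by move=> k0 r; rewrite expf_neq0// gt_eqF.
  rewrite mij !exprD in e0 e1.
  have := mulIf (p0 _ k10 _) e0; have := mulIf (p0 _ k20 _) e1 => <- /eqP.
  have mji : (0 < m * (j - i))%N by rewrite muln_gt0 m0 subn_gt0.
  by rewrite gt_eqF// (ltr_pXn2r mji) ?nnegrE ?ltW.
pose e i : 'cV[R]_2 := col i Z.
have coordZ := coord_column Z; have expand u := expand_columns u uZ.
have on_axis u i j : i != j -> line_union L u -> (invmx Z *m u) i 0 != 0 ->
    (invmx Z *m u) j 0 = 0 -> line_union L (e i).
  move=> ij hu xi xj; have -> : e i = ((invmx Z *m u) i 0)^-1 *: u; last exact: scale.
  rewrite [X in _ *: X]expand; move: i j ij xi xj.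
  by apply: ord2P; apply: ord2P => //= _ xi ->;
    rewrite scale0r ?addr0 ?add0r scalerA mulVf// scale1r.
have no0 : ~ line_union L (e 0).
  move=> /(inv _ _ S1)/axis; rewrite !coordZ => -[] /eqP; exact/negP.
have no1 : ~ line_union L (e 1).
  move=> /(inv _ _ S2) h; have [|h1] := axis _ h; first by rewrite coordZ; exact/eqP.
  by apply: no0; apply: (on_axis _ 0 1 _ h) => //; rewrite coordZ.
have [V VL] : exists V, V \in L.
  by case: (L) L0 => // V L' _; exists V; rewrite mem_head.
have hu : line_union L (vpick V) by exists V; rewrite ?memv_pick.
have u0 : vpick V != 0.
  by rewrite vpick0; apply/eqP => V0; have := dL _ VL; rewrite V0 dimv0.
have [x0|x0] := eqVneq ((invmx Z *m vpick V) 0 0) 0.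
  have [x1|x1] := eqVneq ((invmx Z *m vpick V) 1 0) 0.
    by move: u0; rewrite (expand (vpick V)) x0 x1 !scale0r addr0 eqxx.
  by apply: no1; apply: (on_axis _ 1 0 _ hu).
have [x1|x1] := axis _ hu; first by rewrite x1 eqxx in x0.
by apply: no0; apply: (on_axis _ 0 1 _ hu).
Qed.

End InvariantLines.

Section EscapingWords.
Variables (R : realType) (M : nat) (A : 'I_M.+1 -> 'M[R]_2).
Hypothesis hA : forall j, A j \in unitmx.
Notation letter := 'I_M.+1.

Lemma unitmx_mul_neq0 (X : 'M[R]_2) (v : 'cV[R]_2) : X \in unitmx -> v != 0 -> X *m v != 0.
Proof. by move=> uX; apply: contraNneq => Xv; rewrite -(mulKmx uX v) Xv mulmx0. Qed.

Lemma vline_scale (a : R) (v : 'cV[R]_2) : a != 0 -> <[a *: v]>%VS = <[v]>%VS.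
Proof.
move=> a0; apply/eqP; rewrite eqEdim -memvE memvZ ?memv_line//= !dim_vline.
by rewrite scaler_eq0 negb_or a0.
Qed.

(** Up to a remainder of length less than [d], every word is one whose length is a
    multiple of [d]. Therefore the images of the line of [z] under all words are
    finitely many lines, and they form an invariant union. *)
Lemma confined_orbit (d : nat) (z : 'cV[R]_2) (zs : seq 'cV[R]_2) : (0 < d)%N -> z != 0 ->
  (forall c : seq letter, (d %| size c)%N ->
     exists z' a, z' \in zs /\ word_matrix A c *m z = a *: z') ->
  ~ strongly_irreducible (range A).
Proof.
move=> d0 z0 hz; apply; have hunit := word_matrix_unit hA.
pose words : seq (seq letter) := flatten [seq map val (enum {: k.-tuple letter}) | k <- iota 0 d].
pose lines : seq {vspace 'cV[R]_2} :=
  [seq <[word_matrix A u *m z']>%VS | u <- words, z' <- zs].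
pose L := [seq V <- lines | `[<exists v, V = <[word_matrix A v *m z]>%VS>]].
have inL v : <[word_matrix A v *m z]>%VS \in L.
  rewrite mem_filter; apply/andP; split; first by apply/asboolP; exists v.
  pose c := take (size v %/ d * d) v; pose u := drop (size v %/ d * d) v.
  have sc : size c = (size v %/ d * d)%N by rewrite size_takel// leq_divM.
  have su : (size u < d)%N by rewrite size_drop {1}(divn_eq (size v) d) addKn ltn_pmod.
  have [|z' [a [z'zs cz]]] := hz c; first by rewrite sc dvdn_mull.
  have a0 : a != 0.
    by apply: contraTneq (unitmx_mul_neq0 (hunit c) z0) => a0; rewrite cz a0 scale0r eqxx.
  apply/allpairsP; exists (u, z'); split => //=.
    apply/flatten_mapP; exists (size u); first by rewrite mem_iota.
    by apply/mapP; exists (in_tuple u); rewrite ?mem_enum.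
  by rewrite -(cat_take_drop (size v %/ d * d) v) word_matrix_cat -mulmxA cz -scalemxAr vline_scale.
exists L; split.
- by apply: contraTneq (inL [::]) => ->.
- move=> V; rewrite mem_filter => /andP[/asboolP[v ->] _].
  by rewrite dim_vline unitmx_mul_neq0.
- move=> _ [j _ <-] U _ [u [V VL uV] <-].
  move: VL uV; rewrite mem_filter => /andP[/asboolP[v ->] _] /vlineP[a ->].
  exists (<[word_matrix A (v ++ [:: j]) *m z]>%VS); first exact: inL.
  by rewrite word_matrix_cat word_matrix1 -scalemxAr mulmxA memvZ// memv_line.
Qed.

(** Both [c1] and a word [a] that moves the line of the second column of [Z] come
    from the previous lemma. If neither of them has the properties required of
    [c2], then [c1] fixes that line while [a] maps the line of the first column
    to it, and [c1] followed by [a] has them. *)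
Lemma escaping_words (d : nat) (Z : 'M[R]_2) : (0 < d)%N -> Z \in unitmx ->
  strongly_irreducible (range A) -> exists c1 c2 : seq letter,
  [/\ (d %| size c1)%N, (d %| size c2)%N,
   (invmx Z *m word_matrix A c1 *m Z) 0 0 != 0 /\ (invmx Z *m word_matrix A c1 *m Z) 1 0 != 0 &
   (invmx Z *m word_matrix A c2 *m Z) 0 0 != 0 /\ (invmx Z *m word_matrix A c2 *m Z) 0 1 != 0].
Proof.
move=> d0 uZ hirr; pose E w := invmx Z *m word_matrix A w *m Z.
have colE' w j : word_matrix A w *m col j Z = E w 0 j *: col 0 Z + E w 1 j *: col 1 Z.
  by rewrite [LHS](expand_columns _ uZ) !coord_column.
have col0 j : col j Z != 0.
  rewrite colE; apply: unitmx_mul_neq0 => //; apply/eqP => /matrixP/(_ j 0)/eqP.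
  by rewrite !mxE !eqxx oner_eq0.
have [c1 [dc1 c00 c10]] : exists c1, [/\ (d %| size c1)%N, E c1 0 0 != 0 & E c1 1 0 != 0].
  apply: contrapT => h; apply: (@confined_orbit d (col 0 Z) [:: col 0 Z; col 1 Z]) hirr => //.
  move=> c dc; have [c0|c0] := eqVneq (E c 0 0) 0.
    by exists (col 1 Z), (E c 1 0); rewrite !inE eqxx orbT colE' c0 scale0r add0r.
  have [c1|c1] := eqVneq (E c 1 0) 0; last by case: h; exists c.
  by exists (col 0 Z), (E c 0 0); rewrite !inE eqxx colE' c1 scale0r addr0.
have [a [da a01]] : exists a, (d %| size a)%N /\ E a 0 1 != 0.
  apply: contrapT => h; apply: (@confined_orbit d (col 1 Z) [:: col 1 Z]) hirr => //.
  move=> c dc; have [c0|c0] := eqVneq (E c 0 1) 0; last by case: h; exists c.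
  by exists (col 1 Z), (E c 1 1); rewrite !inE eqxx colE' c0 scale0r add0r.
have [c01|c01] := eqVneq (E c1 0 1) 0; last by exists c1, c1.
have [a00|a00] := eqVneq (E a 0 0) 0; last by exists c1, a.
have c11 : E c1 1 1 != 0.
  have : \det (E c1) != 0.
    by rewrite -unitfE -unitmxE !unitmx_mul unitmx_inv uZ word_matrix_unit.
  by rewrite det2E c01 mul0r subr0 mulf_eq0 negb_or => /andP[].
have Eca : E (c1 ++ a) = E a *m E c1.
  by rewrite /E word_matrix_cat !mulmxA mulmxK.
exists c1, (c1 ++ a); split; rewrite -?/(E _) //; first by rewrite size_cat dvdn_addr.
by rewrite Eca !(mulmx2E (E a) (E c1)) a00 !mul0r !add0r !mulf_neq0.
Qed.

End EscapingWords.

(** * Products of cone words *)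

Section AdmissibleWords.
Variables (R : realType) (M : nat) (A : 'I_M.+1 -> 'M[R]_2).
Hypothesis hA : forall j, A j \in unitmx.
Notation letter := 'I_M.+1.
Notation Aw := (word_matrix A).
Variables (lam D : R) (Q : 'M[R]_2) (n0 : nat).
Hypothesis uQ : Q \in unitmx.

Definition framed (w : seq letter) : 'M[R]_2 := invmx Q *m Aw w *m Q.

Lemma framed_cat u v : framed (u ++ v) = framed v *m framed u.
Proof. by rewrite /framed word_matrix_cat !mulmxA mulmxK. Qed.

Lemma framed_nil : framed [::] = 1%:M.
Proof. by rewrite /framed /word_matrix /= mulmx1 mulVmx. Qed.

Definition admissible_word (eps : R) (w : seq letter) : Prop :=
  [/\ positive_mx (framed w),
      forall v : 'cV[R]_2, (forall i, 0 <= v i 0) ->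
        expR ((size w)%:R * (lam - eps)) * enorm (Q *m v) <= enorm (Aw w *m (Q *m v)),
      l1norm (Aw w) <= expR ((size w)%:R * (lam + eps)),
      expR ((size w)%:R * (D - eps)) <= \det (Aw w) <= expR ((size w)%:R * (D + eps)) &
      forall k : n0.-tuple letter, infix k w].

Variables (n : nat) (e1 s sd : R) (K : seq letter -> Prop).
Hypotheses (s1 : s = 1 \/ s = -1) (sd1 : sd = 1 \/ sd = -1).
Hypothesis hK : forall w, K w -> [/\ size w = n, positive_mx (s *: framed w),
  0 < sd * \det (Aw w) & cone_word A lam D Q e1 n0 w].

Lemma sign_sqr (z : R) : z = 1 \/ z = -1 -> z ^+ 2 = 1.
Proof. by case=> ->; rewrite ?sqrrN expr1n. Qed.

(** The norm grows under each factor because the previous ones have mapped the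
    cone into itself, up to the sign [s]. *)
Lemma products_of_cone_words (t : seq (seq letter)) : (forall w, w \in t -> K w) ->
  [/\ size (flatten t) = (n * size t)%N,
      forall X, positive_mx X -> positive_mx (s ^+ size t *: (framed (flatten t) *m X)),
      0 < sd ^+ size t * \det (Aw (flatten t)),
      forall v : 'cV[R]_2, (forall i, 0 <= v i 0) ->
        expR ((size (flatten t))%:R * (lam - e1)) * l1norm (Q *m v) <=
        l1norm (Aw (flatten t) *m (Q *m v)) &
      log_norm A (flatten t) <= log_norm A [::] + (size (flatten t))%:R * (lam + e1) /\
      `|log_det A (flatten t) - (size (flatten t))%:R * D| <= (size (flatten t))%:R * e1].
Proof.
elim: t => [_|w t IH ht].
  have sz : (size (flatten (@nil (seq letter))))%:R = 0 :> R by [].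
  have Aw1 : Aw (flatten [::]) = 1%:M by [].
  have sz0 : size (@nil (seq letter)) = 0%N by [].
  rewrite sz sz0 Aw1 det1 !expr0 mul1r; split => //.
  - by rewrite muln0.
  - by move=> X hX; rewrite framed_nil mul1mx scale1r.
  - by move=> v _; rewrite mul0r expR0 mul1r mul1mx.
  - by rewrite !mul0r addr0 subr0 /log_det Aw1 det1 normr1 ln1 normr0.
have -> : flatten (w :: t) = w ++ flatten t by [].
have -> : size (w :: t) = (size t).+1 by [].
have [h1 h2 h3 h4 [h5 h6]] := IH (fun v vt => ht v (mem_behead (s := w :: t) vt)).
have [sw pw dw [_ cw1 cw2 cw3 _]] := hK (ht w (mem_head _ _)).
rewrite size_cat framed_cat natrD; split.
- by rewrite h1 sw mulnS.
- move=> X hX; have := h2 _ (positive_mx_mul pw hX).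
  by rewrite exprS -mulmxA -scalemxAl -scalemxAr scalerA mulrC.
- rewrite word_matrix_cat det_mulmx exprS.
  have -> : sd * sd ^+ size t * (\det (Aw (flatten t)) * \det (Aw w)) =
    sd * \det (Aw w) * (sd ^+ size t * \det (Aw (flatten t))) by ring.
  exact: mulr_gt0.
- move=> v v0.
  have [v' v'0 e] : exists2 v' : 'cV[R]_2, (forall i, 0 <= v' i 0) &
      Aw w *m (Q *m v) = s *: (Q *m v').
    exists (s *: (framed w *m v)).
      move=> i; rewrite scalemxAl; apply: mulmx_nonneg => // a b.
      exact/ltW/pw.
    by rewrite -scalemxAr scalerA -expr2 sign_sqr// scale1r /framed -!mulmxA mulKVmx.
  have sn : `|s| = 1 by case: s1 => ->; rewrite ?normrN normr1.
  have := h4 _ v'0; have := cw1 _ v0.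
  rewrite word_matrix_cat -mulmxA e -scalemxAr !l1normZ sn !mul1r => g1 g2.
  apply: le_trans g2; rewrite mulrDl addrC expRD -mulrA ler_wpM2l ?expR_ge0//.
- split.
    apply: le_trans (log_norm_cat_le hA _ _) _.
    by rewrite mulrDl addrCA lerD.
  rewrite log_det_cat// !mulrDl.
  have -> : log_det A w + log_det A (flatten t) - ((size w)%:R * D + (size (flatten t))%:R * D) =
    (log_det A w - (size w)%:R * D) + (log_det A (flatten t) - (size (flatten t))%:R * D) by ring.
  by apply: le_trans (ler_normD _ _) _; rewrite lerD.
Qed.

Lemma padding_budget (x a N y e e' : R) : 0 <= y * e' -> `|x| + `|y * a| <= N * (e' - e) ->
  x + N * (a + e) <= (N + y) * (a + e').
Proof.
have := ler_norm x; have := ler_norm (- (y * a)); rewrite normrN.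
by rewrite !mulrDl !mulrDr !mulrN; lra.
Qed.

(** The contribution of [y] is bounded, and the slack [eps - e1] per letter
    absorbs it when the number of factors is large. An even number of factors
    makes both signs positive. *)
Lemma padded_products_admissible (eps : R) (y : seq letter) : 0 < eps -> e1 < eps -> (0 < n)%N ->
  0 < \det (Aw y) -> (forall X, positive_mx X -> positive_mx (framed y *m X)) ->
  exists m0, forall m, (m0 <= m)%N -> forall t : seq (seq letter),
    size t = m.*2 -> (forall w, w \in t -> K w) -> admissible_word eps (flatten t ++ y).
Proof.
move=> eps0 e1eps n_gt0 dy py.
pose b1 := ln (2 * l1norm (invmx (Aw y))).
pose b2 := log_norm A [::] + log_norm A y.
pose b3 := log_det A y.
pose Y : R := (size y)%:R.
pose B := `|b1| + `|b2| + `|b3| + `|Y * lam| + `|Y * D|.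
have [m0 hm0] := nat_above (B / (eps - e1)).
exists m0.+1 => m hm t st tK.
have [h1 h2 h3 h4 [h5 h6]] := products_of_cone_words tK.
pose N : R := (size (flatten t))%:R.
have hB : B <= N * (eps - e1).
  rewrite -ler_pdivrMr ?subr_gt0//; apply/ltW/(lt_le_trans (hm0 _ (ltnW hm))).
  by rewrite /N ler_nat h1 st; clear -n_gt0; nia.
have sE : (size (flatten t ++ y))%:R = N + Y by rewrite size_cat natrD.
have Yeps : 0 <= Y * eps by rewrite mulr_ge0// ltW.
have budget (x z : R) : `|x| + `|Y * z| <= B -> x + N * (z + e1) <= (N + Y) * (z + eps).
  by move=> hx; apply: padding_budget => //; exact: le_trans hx hB.
have [B1 B2 B3 B3'] : [/\ `|b1| + `|Y * lam| <= B, `|b2| + `|Y * lam| <= B,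
    `|b3| + `|Y * D| <= B & `|- b3| + `|Y * - D| <= B].
  rewrite mulrN !normrN /B; move: (normr_ge0 b1) (normr_ge0 b2) (normr_ge0 b3).
  move: (normr_ge0 (Y * lam)) (normr_ge0 (Y * D)).
  by move: `|b1| `|b2| `|b3| `|Y * lam| `|Y * D| => *; split; lra.
have sd2 (z : R) : z = 1 \/ z = -1 -> z ^+ size t = 1.
  by move=> hz; rewrite st -mul2n exprM sign_sqr// expr1n.
have t0 : exists w t', t = w :: t'.
  by case: (t) st => [|w t'] //; [case: (m) hm|move=> _; exists w, t'].
have dt : 0 < \det (Aw (flatten t)) by have := h3; rewrite sd2// mul1r.
have dty : 0 < \det (Aw (flatten t ++ y)) by rewrite word_matrix_cat det_mulmx mulr_gt0.
have hlog : log_det A (flatten t ++ y) = log_det A (flatten t) + b3 by exact: log_det_cat.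
split.
- have [w [t' et]] := t0; have wt : w \in t by rewrite et mem_head.
  have [_ pw _ _] := hK (tK w wt).
  have t'K v : v \in t' -> K v by move=> vt'; apply: tK; rewrite et inE vt' orbT.
  have [_ h2' _ _ _] := products_of_cone_words t'K.
  rewrite framed_cat; apply: py; have := h2' _ pw.
  rewrite -scalemxAr scalerA -exprSr -framed_cat.
  by rewrite (_ : (size t').+1 = size t) ?sd2 ?scale1r ?et.
- move=> v v0; rewrite sE.
  have e1' : expR (N * (lam - e1)) * enorm (Q *m v) <= l1norm (Aw (flatten t) *m (Q *m v)).
    by apply: le_trans (h4 _ v0); rewrite ler_wpM2l ?expR_ge0// enorm_le_l1norm.
  have e2 : l1norm (Aw (flatten t) *m (Q *m v)) <=
      expR b1 * enorm (Aw (flatten t ++ y) *m (Q *m v)).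
    have uy := word_matrix_unit hA y.
    rewrite -[X in l1norm X <= _](mulKmx uy) word_matrix_cat -(mulmxA (Aw y)).
    apply: le_trans (l1normM _ _) _; rewrite /b1 lnK.
      by rewrite mulrAC mulrC ler_wpM2r ?l1norm_ge0// l1norm_le_enorm.
    by rewrite posrE mulr_gt0// l1norm_gt0// unitmx2_neq0// unitmx_inv.
  rewrite -(ler_pM2l (expR_gt0 b1)) mulrA -expRD; apply: le_trans e2; apply: le_trans e1'.
  rewrite ler_wpM2r ?enorm_ge0// ler_expR.
  have := budget b1 (- lam); rewrite mulrN normrN => /(_ B1).
  by rewrite !mulrDr !mulrN; lra.
- rewrite sE -expR_log_norm// ler_expR; apply: le_trans (log_norm_cat_le hA _ _) _.
  by have := budget b2 lam B2; move: h5; rewrite -/N /b2; lra.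
- have -> : \det (Aw (flatten t ++ y)) = expR (log_det A (flatten t ++ y)).
    by rewrite expR_log_det// gtr0_norm.
  rewrite sE !ler_expR hlog; have := budget _ _ B3; have := budget _ _ B3'.
  move: h6; rewrite -/N ler_norml => /andP[g1 g2] g3 g4.
  by apply/andP; split; move: g1 g2 g3 g4; rewrite !mulrDr !mulrN; lra.
- move=> k; have [w [t' et]] := t0.
  have wt : w \in t by rewrite et mem_head.
  have [_ _ _ [_ _ _ _ hk]] := hK (tK w wt).
  by rewrite et /= -!catA; exact: infix_catr.
Qed.
End AdmissibleWords.

(** * Strong irreducibility of the admissible words *)

Section AdmissibleFamily.
Variables (R : realType) (M : nat) (A : 'I_M.+1 -> 'M[R]_2).
Hypothesis hA : forall j, A j \in unitmx.
Notation letter := 'I_M.+1.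
Notation Aw := (word_matrix A).

Definition word_power (w : seq letter) r : seq letter := flatten (nseq r w).

Lemma size_word_power w r : size (word_power w r) = (r * size w)%N.
Proof. by elim: r => // r IH; rewrite /= size_cat IH mulSn. Qed.

Lemma word_matrix_power w r : Aw (word_power w r) = Aw w ^+ r.
Proof.
elim: r => [|r IH]; first by rewrite expr0.
by rewrite /word_power /= word_matrix_cat IH exprSr mulmxE.
Qed.

Lemma word_power_mul w r q : word_power (word_power w q) r = word_power w (r * q).
Proof.
elim: r => // r IH; rewrite mulSn /word_power nseqD flatten_cat /=.
by congr cat; exact: IH.
Qed.

Lemma diag_sandwichE (a b c d : R) (X : 'M[R]_2) i j :
  (diag2 a b *m X *m diag2 c d) i j =
  (if i == 0 then a else b) * X i j * (if j == 0 then c else d).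
Proof. by rewrite !mulmx2E !diag2E; move: i j; apply: ord2P; apply: ord2P => /=; ring. Qed.

Variables (lam D : R) (Q : 'M[R]_2) (n0 : nat).
Hypothesis uQ : Q \in unitmx.
Variables (n : nat) (e1 s sd eps : R) (K : seq letter -> Prop).
Hypotheses (s1 : s = 1 \/ s = -1) (sd1 : sd = 1 \/ sd = -1).
Hypothesis hK : forall w, K w -> [/\ size w = n, positive_mx (s *: framed A Q w),
  0 < sd * \det (Aw w) & cone_word A lam D Q e1 n0 w].
Hypotheses (eps0 : 0 < eps) (e1eps : e1 < eps) (n_gt0 : (0 < n)%N).

Definition admissible_matrices N : set 'M[R]_2 :=
  [set B | exists2 w : N.-tuple letter, admissible_word A lam D Q n0 eps w & B = Aw w].

(** The number of copies of [w0 ++ w0] is chosen so that the total length is the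
    prescribed one. *)
Lemma padded_powers_admissible (w0 y : seq letter) : K w0 -> 0 < \det (Aw y) ->
  (forall X, positive_mx X -> positive_mx (framed A Q y *m X)) -> (2 * n %| size y)%N ->
  exists m0, forall m, (m0 <= m)%N -> exists r,
  admissible_matrices (n * m.*2) (Aw y *m Aw (w0 ++ w0) ^+ r).
Proof.
move=> Kw0 dy py /dvdnP[Y sY].
have [m0 hm0] := padded_products_admissible hA uQ s1 sd1 hK eps0 e1eps n_gt0 dy py.
have [sw0 _ _ _] := hK Kw0.
exists (m0 + Y)%N => m hm; exists (m - Y)%N.
have adm : admissible_word A lam D Q n0 eps (word_power w0 (m - Y).*2 ++ y).
  apply: hm0; [|by rewrite size_nseq|by move=> w /nseqP[->]].
  by clear -hm; lia.
have sz : size (word_power w0 (m - Y).*2 ++ y) == (n * m.*2)%N.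
  by rewrite size_cat size_word_power sY sw0; apply/eqP; clear -hm; nia.
exists (Tuple sz) => //=.
rewrite [RHS]word_matrix_cat -(muln2 (m - Y)) -word_power_mul [in RHS]word_matrix_power.
by congr (_ *m Aw _ ^+ _); rewrite /word_power /= cats0.
Qed.

Lemma power_admissible (w0 : seq letter) : K w0 ->
  exists m0, forall m, (m0 <= m)%N -> admissible_matrices (n * m.*2) (Aw (w0 ++ w0) ^+ m).
Proof.
move=> Kw0; have [sw0 _ _ _] := hK Kw0.
have [||m0 hm0] := @padded_products_admissible _ _ _ hA lam D _ n0 uQ n e1 _ _ _ s1 sd1 hK _ [::] eps0 e1eps n_gt0.
- by rewrite /word_matrix det1.
- by move=> X; rewrite framed_nil// mul1mx.
exists m0 => m hm.
have adm : admissible_word A lam D Q n0 eps (word_power w0 m.*2).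
  rewrite -[word_power _ _]cats0; apply: (hm0 m); rewrite ?size_nseq//.
  by move=> w /nseqP[->].
have sz : size (word_power w0 m.*2) == (n * m.*2)%N.
  by rewrite size_word_power sw0 mulnC.
exists (Tuple sz) => //=.
rewrite -(muln2 m) -word_power_mul [in RHS]word_matrix_power.
by congr (Aw _ ^+ _); rewrite /word_power /= cats0.
Qed.

(** The words [h^p c h^p c h^p] with [c] an escaping word have positive
    determinant, since [c] occurs twice in them, and become positive on the cone
    for large [p]. Preceded by powers of [h] they are admissible, and
    this changes the entries in the eigenbasis by nonzero factors only. *)
Lemma admissible_strongly_irreducible (w0 : seq letter) : K w0 ->
  strongly_irreducible (range A) ->
  exists m0, forall m, (m0 <= m)%N -> (0 < m)%N ->
  strongly_irreducible (admissible_matrices (n * m.*2)).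
Proof.
move=> Kw0 hirr; have [sw0 pw0 _ _] := hK Kw0.
set h := w0 ++ w0; have sh : size h = (2 * n)%N by rewrite size_cat sw0 mul2n addnn.
have ph : positive_mx (framed A Q h).
  have := positive_mx_mul pw0 pw0.
  by rewrite -scalemxAl -scalemxAr scalerA -expr2 sign_sqr// scale1r -framed_cat.
have dh : 0 < \det (Aw h).
  rewrite word_matrix_cat det_mulmx -expr2 lt_neqAle sqr_ge0 eq_sym sqrf_eq0 andbT.
  by rewrite -normr_gt0 abs_det_word_gt0.
have dfh : \det (framed A Q h) = \det (Aw h).
  rewrite /framed !det_mulmx mulrAC -det_mulmx mulVmx// det1 mul1r //.
have [|k1 [k2 [Z' [k20 k21 uZ' hZ' pP]]]] := positive_eigenbasis ph; first by rewrite dfh.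
have k10 := lt_trans k20 k21.
pose Z := Q *m Z'.
have uZ : Z \in unitmx by rewrite unitmx_mul uQ.
have iZ : invmx Z = invmx Z' *m invmx Q.
  by rewrite -[RHS]mulmx1 -(mulmxV uZ) /Z !mulmxA mulmxKV// mulVmx// mul1mx.
have hZ : Aw h *m Z = Z *m diag2 k1 k2.
  rewrite /Z -mulmxA -hZ' /framed !mulmxA mulmxV// mul1mx //.
have fQ w : framed A Q w = Z' *m framed A Z w *m invmx Z'.
  by rewrite /framed iZ /Z !mulmxA mulmxV// mul1mx mulmxK.
have fhp p : framed A Z (word_power h p) = diag2 k1 k2 ^+ p.
  by rewrite /framed word_matrix_power (eigenbasis_power p uZ hZ).
have d0 : (0 < 2 * n)%N by rewrite muln_gt0.
have [c1 [c2 [dc1 dc2 [c100 c110] [c200 c201]]]] := escaping_words hA d0 uZ hirr.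
(* The padding is built in the same way from either escaping word. *)
have recipe c : (2 * n %| size c)%N -> framed A Z c 0 0 != 0 ->
    exists m0, forall m, (m0 <= m)%N -> exists2 B, admissible_matrices (n * m.*2) B &
      forall i j, framed A Z c i 0 != 0 -> framed A Z c 0 j != 0 ->
        (invmx Z *m B *m Z) i j != 0.
  move=> dc c00; have [p hp] := dominated_products k20 k21 pP c00.
  have [pos nz] := hp p (leqnn p).
  pose hh := word_power h p; pose y := hh ++ c ++ hh ++ c ++ hh.
  have fy : framed A Z y = diag2 k1 k2 ^+ p *m
      (framed A Z c *m diag2 k1 k2 ^+ p *m framed A Z c) *m diag2 k1 k2 ^+ p.
    by rewrite /y !framed_cat// !fhp !mulmxA.
  have dy : 0 < \det (Aw y).
    have dhh : 0 < \det (Aw hh).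
      by rewrite /hh word_matrix_power; elim: p {hp pos nz hh y fy} => [|p IH];
        rewrite ?expr0 ?det1// exprS -mulmxE det_mulmx mulr_gt0.
    rewrite /y !word_matrix_cat !det_mulmx.
    have dc0 : 0 < \det (Aw c) ^+ 2.
      by rewrite lt_neqAle sqr_ge0 eq_sym sqrf_eq0 andbT -normr_gt0 abs_det_word_gt0.
    have -> : forall a b : R, a * b * a * b * a = a ^+ 3 * b ^+ 2 by move=> a b; ring.
    by rewrite mulr_gt0// exprn_gt0.
  have py X : positive_mx X -> positive_mx (framed A Q y *m X).
    by apply: positive_mx_mul; rewrite fQ fy !mulmxA in pos *.
  have dvy : (2 * n %| size y)%N.
    by rewrite /y !size_cat !size_word_power sh !dvdn_add// dvdn_mull.
  have [m0 hm0] := padded_powers_admissible Kw0 dy py dvy.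
  exists m0 => m /hm0[r hr]; exists (Aw y *m Aw h ^+ r) => // i j ci cj.
  have -> : invmx Z *m (Aw y *m Aw h ^+ r) *m Z = framed A Z (word_power h r ++ y).
    by rewrite /framed word_matrix_cat word_matrix_power.
  rewrite framed_cat// fhp fy -mulmxA; have := nz i j ci cj.
  move: (framed A Z c *m _ *m _) => N hN; rewrite !diag2X mul_diag2 diag_sandwichE.
  apply: mulf_neq0; [apply: mulf_neq0 => //|];
    by case: ifP => _; rewrite ?mulf_neq0 ?expf_neq0 ?gt_eqF.
have [m1 hm1] := power_admissible Kw0.
have [m2 hm2] := recipe _ dc1 c100; have [m3 hm3] := recipe _ dc2 c200.
exists (m1 + m2 + m3)%N => m hm m_gt0.
have [m1m m2m m3m] : [/\ m1 <= m, m2 <= m & m3 <= m]%N by clear -hm; split; lia.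
have [B1 S1 nz1] := hm2 _ m2m; have [B2 S2 nz2] := hm3 _ m3m.
apply: (hyperbolic_strongly_irreducible k20 k21 uZ hZ m_gt0 (hm1 _ m1m) S1 S2).
- exact: nz1.
- exact: nz1.
- exact: nz2.
Qed.

End AdmissibleFamily.

(** * The cardinality of the family and the entropy of the shift *)

Section Families.
Variables (R : realType) (M : nat) (A : 'I_M.+1 -> 'M[R]_2).
Hypothesis hA : forall j, A j \in unitmx.
Notation letter := 'I_M.+1.
Notation Aw := (word_matrix A).

(** The word of a product determines its factors, because these have the same
    length. *)
Lemma card_products (n k : nat) (F : {set n.-tuple letter})
    (G : {set (n * k).-tuple letter}) :
  (forall t : seq (seq letter), size t = k ->
     (forall w, w \in t -> exists2 v, v \in F & w = val v) ->
     forall w : (n * k).-tuple letter, val w = flatten t -> w \in G) ->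
  (#|F| ^ k <= #|G|)%N.
Proof.
move=> hG; rewrite -[X in (_ ^ X)%N](card_ord k) -(card_ffun_on 'I_k F).
pose word (f : {ffun 'I_k -> n.-tuple letter}) : seq (seq letter) :=
  [seq val (f i) | i <- enum 'I_k].
have shape_word f : shape (word f) = nseq k n.
  rewrite /shape /word -map_comp (eq_map (g := fun=> n)); last by move=> i; rewrite /= size_tuple.
  by rewrite -[k in RHS]size_enum_ord; elim: (enum _) => //= _ t ->.
have size_word f : size (flatten (word f)) == (n * k)%N.
  by rewrite size_flatten shape_word sumn_nseq.
pose phi f : (n * k).-tuple letter := Tuple (size_word f).
have phi_inj : injective phi.
  move=> f g /(congr1 val) /= fg; apply/ffunP => i.
  have : word f = word g.
    by rewrite -[LHS]flattenK -[RHS]flattenK !shape_word fg.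
  by move/eq_in_map => h; apply: val_inj; apply: h; rewrite mem_enum.
rewrite -(card_imset _ phi_inj) subset_leq_card//; apply/fintype.subsetP => _ /imsetP[f hf ->].
apply: (hG (word f)) => //; first by rewrite size_map size_enum_ord.
by move=> _ /mapP[i _ ->]; exists (f i) => //; have /ffun_onP := hf.
Qed.

(** The two signs take four values, and the largest class of words keeps at least
    a quarter of the family. *)
Lemma admissible_family (lam D : R) (Q : 'M[R]_2) (n0 n : nat) (e1 eps : R)
    (F0 : {set n.-tuple letter}) (v0 : n.-tuple letter) :
  Q \in unitmx -> 0 < eps -> e1 < eps -> (0 < n)%N -> v0 \in F0 ->
  (forall w, w \in F0 -> cone_word A lam D Q e1 n0 w) ->
  exists2 k, (#|F0| <= 4 * k)%N & exists m0, forall m, (m0 <= m)%N -> (0 < m)%N ->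
  let G := [set w : (n * m.*2).-tuple letter | `[<admissible_word A lam D Q n0 eps w>]]%SET in
  (k ^ m.*2 <= #|G|)%N /\
  (strongly_irreducible (range A) ->
   strongly_irreducible [set B | exists2 w, w \in G & B = Aw w]).
Proof.
move=> uQ eps0 e1eps n_gt0 v0F hF.
pose phi (w : n.-tuple letter) := (`[<positive_mx (framed A Q w)>], 0 < \det (Aw w)).
have [_ /imsetP[v1 v1F ->] hc] := pigeonhole_fiber phi v0F.
set F := [set v in F0 | phi v == phi v1]%SET in hc.
pose s : R := if (phi v1).1 then 1 else -1; pose sd : R := if (phi v1).2 then 1 else -1.
have s1 : s = 1 \/ s = -1 by rewrite /s; case: ifP; [left|right].
have sd1 : sd = 1 \/ sd = -1 by rewrite /sd; case: ifP; [left|right].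
pose K w := exists2 v : n.-tuple letter, v \in F & w = val v.
have hK w : K w -> [/\ size w = n, positive_mx (s *: framed A Q w),
    0 < sd * \det (Aw w) & cone_word A lam D Q e1 n0 w].
  move=> [v]; rewrite inE => /andP[vF /eqP pv] ->; have hv := hF _ vF.
  split => //; first by rewrite size_tuple.
    have [[t ht pt] _ _ _ _] := hv; rewrite /s -pv /=.
    case: asboolP => [p|np]; first by rewrite scale1r.
    by case: ht pt => -> //; rewrite scale1r.
  rewrite /sd -pv /=; case: ifP => [d|/negbT]; first by rewrite mul1r.
  rewrite -leNgt mulN1r oppr_gt0 lt_neqAle => ->; rewrite andbT -normr_gt0.
  exact: abs_det_word_gt0.
exists #|F|; first by move: hc; rewrite card_prod card_bool.
have [m1 hm1] : exists m1, forall m, (m1 <= m)%N -> (0 < m)%N ->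
    strongly_irreducible (range A) ->
    strongly_irreducible (admissible_matrices A lam D Q n0 eps (n * m.*2)).
  have [hirr|nirr] := pselect (strongly_irreducible (range A)); last by exists 0%N.
  have v1F' : v1 \in F by rewrite inE v1F eqxx.
  have [m1 hm1] := admissible_strongly_irreducible hA uQ s1 sd1 hK eps0 e1eps n_gt0
    (ex_intro2 _ _ v1 v1F' erefl : K (val v1)) hirr.
  by exists m1 => m h1 h2 _; exact: hm1.
have [||m2 hm2] := padded_products_admissible hA uQ s1 sd1 hK (y := [::]) eps0 e1eps n_gt0.
- by rewrite /word_matrix det1.
- by move=> X; rewrite framed_nil// mul1mx.
exists (m1 + m2)%N => m hm m_gt0 G.
have [m1m m2m] : (m1 <= m)%N /\ (m2 <= m)%N by clear -hm; lia.
split; last first.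
  move=> /(hm1 _ m1m m_gt0); congr strongly_irreducible; apply/seteqP.
  split=> B [w hw ->]; exists w => //; first by rewrite inE; exact/asboolP.
  by move: hw; rewrite inE => /asboolP.
apply: card_products => t st tF w wt; rewrite inE; apply/asboolP; rewrite wt -[flatten t]cats0.
by apply: (hm2 m) => // v /tF.
Qed.

Variable mu : probability (borel_shift_space M) R.
Notation T := (@left_shift M).
Hypothesis inv : invariant_measure T mu.

Definition entropy_rate (hh : R) : Prop := forall e, 0 < e -> exists2 del, 0 < del &
  exists n1 : nat, forall n, (n1 <= n)%N -> forall E : {set n.-tuple letter},
    1 - del <= prob mu [set x | prefix_word x n \in E] ->
    expR (n%:R * (hh - e)) <= #|E|%:R.

(** If the sequence that defines the entropy does not converge, its limit is by
    convention zero, and the claim is that the set is not empty. *)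
Lemma partition_entropy_rate k (P : 'I_k -> set (borel_shift_space M)) :
  finite_partition P -> entropy_rate (partition_entropy T mu P).
Proof.
move=> hP e e0; have [hc|hd] := pselect (cvgn (fun n : nat => n%:R^-1 * join_entropy T mu P n)).
  exact: entropy_count.
have -> : partition_entropy T mu P = 0 by exact: dvgP.
exists (1 / 2); first by rewrite divr_gt0.
exists 0%N => n _ E hE; apply: (@le_trans _ _ 1).
  by rewrite -expR0 ler_expR sub0r mulrN oppr_le0 mulr_ge0// ltW.
rewrite ler1n lt0n; apply/negP => /eqP/cards0_eq E0; move: hE.
rewrite E0 (_ : [set x | _] = set0) ?prob0; last by apply/seteqP; split => x //=; rewrite inE.
by lra.
Qed.

Lemma entropy_rate_le hh : entropy_rate hh -> hh <= ln (M.+1%:R).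
Proof.
move=> hr; apply/ler_addgt0Pr => e e0; have [del del0 [n1 h]] := hr _ e0.
have := h n1.+1 (leqnSn _) [set: _]%SET; rewrite cardsT card_tuple card_ord.
rewrite (_ : [set x | _] = setT); last by apply/seteqP; split => x //=; rewrite inE.
rewrite probT => /(_ _)/wrap[]; first by rewrite gerBl ltW.
rewrite natrX -[M.+1%:R in X in _ <= X]lnK ?posrE ?ltr0n// -expRM_natl ler_expR.
by rewrite ler_pM2l ?ltr0n// lerBlDr.
Qed.

(** The entropy is finite because it is at most the logarithm of the number of
    letters: apply the counting property to the set of all words. *)
Lemma metric_entropy_adherent (e : R) : 0 < e -> metric_entropy T mu \is a fin_num /\
  exists2 hh, entropy_rate hh & (metric_entropy T mu <= (hh + e)%:E)%E.
Proof.
move=> e0.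
have ub : (metric_entropy T mu <= (ln (M.+1%:R))%:E)%E.
  apply: ge_ereal_sup => _ [k [P [hP ->]]]; rewrite lee_fin.
  exact/entropy_rate_le/partition_entropy_rate.
pose P0 (j : 'I_1) : set (borel_shift_space M) := setT.
have hP0 : finite_partition P0.
  split; first by move=> j; exact: measurableT.
    by move=> i j _ _ _; rewrite (ord1 i) (ord1 j).
  by apply/seteqP; split => // x _; exists ord0.
have lb : ((partition_entropy T mu P0)%:E <= metric_entropy T mu)%E.
  by apply: ereal_sup_ubound; exists 1%N, P0.
have hfin : metric_entropy T mu \is a fin_num.
  rewrite fin_numE; apply/andP; split.
    by rewrite gt_eqF// (lt_le_trans _ lb)// ltNyr.
  by rewrite lt_eqF// (le_lt_trans ub)// ltry.
split => //.
have [_ [k [P [hP ->]]] hlt] := ub_ereal_sup_adherent e0 hfin.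
exists (partition_entropy T mu P); first exact: partition_entropy_rate.
by rewrite EFinD -leeBlDr//; exact: ltW.
Qed.

End Families.

(** * Spectral radii and the theorem *)

Section SpectralRadii.
Variable R : realType.
Implicit Types (S : set 'M[R]_2) (C : set 'cV[R]_2).

Lemma opnorm_ge0 (X : 'M[R]_2) : 0 <= opnorm X.
Proof.
pose u : 'cV[R]_2 := \col_i (i == 0)%:R.
have u1 : enorm u = 1 by rewrite enormE !mxE /= expr1n expr0n addr0 sqrtr1.
by have := le_opnorm X u; rewrite u1 mulr1; apply: le_trans; exact: enorm_ge0.
Qed.

Lemma prod_growth S C (g : R) m (B : 'I_m -> 'M[R]_2) u : 0 <= g ->
  (forall X v, S X -> C v -> C (X *m v) /\ g * enorm v <= enorm (X *m v)) ->
  (forall i, S (B i)) -> C u ->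
  C ((\prod_(i < m) B i) *m u) /\ g ^+ m * enorm u <= enorm ((\prod_(i < m) B i) *m u).
Proof.
move=> g0 hS; elim: m B => [|m IH] B hB Cu.
  by rewrite big_ord0 mul1mx expr0 mul1r.
rewrite big_ord_recl -mulmxE -mulmxA.
have [h1 h2] := IH (fun i => B (lift ord0 i)) (fun i => hB _) Cu.
have [h3 h4] := hS _ _ (hB ord0) h1; split => //.
by apply: le_trans h4; rewrite exprS -mulrA ler_wpM2l.
Qed.

Lemma lower_spectral_radius_ge S C (g : R) (u0 : 'cV[R]_2) : 0 < g -> C u0 -> u0 != 0 ->
  (forall X v, S X -> C v -> C (X *m v) /\ g * enorm v <= enorm (X *m v)) ->
  (g%:E <= lower_spectral_radius S)%E.
Proof.
move=> g0 Cu0 u00 hS; apply: le_ereal_inf_tmp => _ [m /= m0 <-].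
apply: le_ereal_inf_tmp => _ [B hB <-]; rewrite lee_fin.
have [_ h] := prod_growth (ltW g0) hS hB Cu0.
have hm : m%:R != 0 :> R by rewrite pnatr_eq0 -lt0n.
have -> : g = (g ^+ m) `^ (m%:R^-1).
  by rewrite -powR_mulrn ?ltW// -powRrM divff// powRr1// ltW.
apply: ge0_ler_powR; first by rewrite invr_ge0.
- by rewrite nnegrE exprn_ge0// ltW.
- by rewrite nnegrE opnorm_ge0.
- by rewrite -(ler_pM2r (enorm_gt0 u00)); exact: le_trans h (le_opnorm _ _).
Qed.

Lemma joint_spectral_radius_le S (g : R) : (forall X, S X -> opnorm X <= g) ->
  (joint_spectral_radius S <= g%:E)%E.
Proof.
move=> hS; apply: (@le_trans _ _ (ereal_sup (normalized_norms S 1))).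
  by apply: ereal_inf_lbound; exists 1%N.
apply: ge_ereal_sup => _ [B hB <-]; rewrite lee_fin invr1 powRr1 ?opnorm_ge0//.
by rewrite big_ord1; exact: hS.
Qed.

End SpectralRadii.

Section AdmissibleConsequences.
Variables (R : realType) (M : nat) (A : 'I_M.+1 -> 'M[R]_2).
Notation letter := 'I_M.+1.
Variables (lam D eps : R) (Q : 'M[R]_2) (n0 : nat).
Hypothesis uQ : Q \in unitmx.

(** In the coordinates of the frame, a positive matrix maps nonzero vectors of the
    closed quadrant into the open one. *)
Lemma admissible_interior w u : admissible_word A lam D Q n0 eps w -> cone_of Q u ->
  (cone_of Q)° (word_matrix A w *m u).
Proof.
move=> [hpos _ _ _ _] [u0 hu]; apply: cone_interior => i.
have -> : invmx Q *m (word_matrix A w *m u) = framed A Q w *m (invmx Q *m u).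
  by rewrite /framed -!mulmxA mulKVmx.
have : invmx Q *m u != 0 by rewrite unitmx_mul_neq0 ?unitmx_inv.
move: (invmx Q *m u) hu => v hv v0; rewrite mulmx2E.
have h0 := mulr_ge0 (ltW (hpos i 0)) (hv 0); have h1 := mulr_ge0 (ltW (hpos i 1)) (hv 1).
rewrite lt_neqAle addr_ge0// andbT eq_sym paddr_eq0// !mulf_eq0 (gt_eqF (hpos i 0)) (gt_eqF (hpos i 1)) /=.
apply: contra v0 => /andP[/eqP v00 /eqP v01]; apply/eqP/colP.
by apply: ord2P; rewrite mxE.
Qed.

Lemma admissible_growth w u : admissible_word A lam D Q n0 eps w -> cone_of Q u ->
  expR ((size w)%:R * (lam - eps)) * enorm u <= enorm (word_matrix A w *m u).
Proof.
by move=> [_ hg _ _ _] [u0 hu]; have := hg _ hu; rewrite mulKVmx.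
Qed.

Lemma admissible_infix w k : admissible_word A lam D Q n0 eps w -> (size k <= n0)%N -> infix k w.
Proof.
move=> [_ _ _ _ hk] kn0; have sk : size (k ++ nseq (n0 - size k) ord0) == n0.
  by rewrite size_cat size_nseq subnKC.
exact: infix_trans (prefixW (prefix_prefix _ _)) (hk (Tuple sk)).
Qed.

End AdmissibleConsequences.

Theorem theorem4p2 (R : realType) (M : nat) (A : 'I_M.+1 -> 'M[R]_2)
    (mu : probability (borel_shift_space M) R) (n0 : nat) (eps : R)
    (hA : forall j, A j \in unitmx)
    (hfull : fully_supported mu)
    (hinv : invariant_measure (@left_shift M) mu)
    (herg : ergodic (@left_shift M) mu)
    (hn0 : (1 <= n0)%N) (heps : 0 < eps)
    (hlyap : lyapunov (@alpha1 R) A mu <> lyapunov (@alpha2 R) A mu) :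
  let l1 := lyapunov (@alpha1 R) A mu in
  let l2 := lyapunov (@alpha2 R) A mu in
  let h := metric_entropy (@left_shift M) mu in
  exists (n : nat) (Gamma : {set n.-tuple 'I_M.+1}) (C : set 'cV[R]_2),
    let AGamma := [set B : 'M[R]_2 | exists2 w, w \in Gamma & B = word_matrix A w] in
    (n0 < n)%N /\
    (* (i) *)
    (expeR (n%:R%:E * (h - eps%:E)) <= (#|Gamma|%:R : R)%:E)%E /\
    (* (ii) *)
    (is_cone C /\ strictly_preserves AGamma C) /\
    (* (iii) *)
    ((forall (u : 'cV[R]_2) (w : n.-tuple 'I_M.+1), C u -> w \in Gamma ->
        expR (n%:R * (l1 - eps)) * enorm u <= enorm (word_matrix A w *m u)) /\
     ((expR (n%:R * (l1 - eps)))%:E <= lower_spectral_radius AGamma)%E) /\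
    (* (iv) *)
    (joint_spectral_radius AGamma <= (expR (n%:R * (l1 + eps)))%:E)%E /\
    (* (v) *)
    (forall w : n.-tuple 'I_M.+1, w \in Gamma ->
       [/\ expR (n%:R * (l1 + l2 - eps)) <= \det (word_matrix A w),
           \det (word_matrix A w) <= expR (n%:R * (l1 + l2 + eps)) &
           0 < \det (word_matrix A w)]) /\
    (* (vi) *)
    (strongly_irreducible (range A) -> strongly_irreducible AGamma) /\
    (* (vii) *)
    (forall k : seq 'I_M.+1, (1 <= size k <= n0)%N ->
       forall w : n.-tuple 'I_M.+1, w \in Gamma -> infix k w).
Proof.
move=> l1 l2 h.
have [lam [D [[l1E l2E D_le lam_le D_int] lam_cvg]]] := lyapunov_exponents hA hinv.
have gap : D < 2 * lam.
  rewrite lt_neqAle D_le andbT; apply/eqP => D2; apply: hlyap.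
  by rewrite l1E l2E D2; ring.
clear hlyap.
(* One [e1] is lost in the entropy of a partition, one in the number of cone
   words, and two pay for the factor 4 in the choice of signs. *)
pose e1 := eps / 4.
have e10 : 0 < e1 by rewrite divr_gt0.
have e1eps : e1 < eps by rewrite ltr_pdivrMr// ltr_pMr// ltr1n.
have [hfin [hh hrate hle]] := metric_entropy_adherent hinv e10.
have [n1 hn1] := nat_above (ln 4 / (2 * e1)).
have [n [F0 [Q [n1n uQ cardF coneF]]]] :=
  many_cone_words hA hfull hinv herg lam_le lam_cvg D_int gap hrate n0 n1.+1 e10.
have n_gt0 : (0 < n)%N by exact: leq_trans n1n.
have [v0 v0F] : exists v0, v0 \in F0.
  apply/set0Pn; rewrite -card_gt0 -(ltr0n R).
  by apply: lt_le_trans cardF; exact: expR_gt0.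
have [k hk [m0 hm0]] := admissible_family hA uQ heps e1eps n_gt0 v0F coneF.
pose m := (m0 + n0).+1; have m_gt0 : (0 < m)%N by [].
have [|cardG irrG] := hm0 m _ m_gt0; first by rewrite /m leqW// leq_addr.
set G := [set w : (n * m.*2).-tuple 'I_M.+1 | _]%SET in cardG irrG.
have inG w : w \in G -> admissible_word A lam D Q n0 eps w by rewrite inE => /asboolP.
have sz (w : (n * m.*2).-tuple 'I_M.+1) : (size w)%:R = (n * m.*2)%:R :> R by rewrite size_tuple.
have pres X v : [set B | exists2 w, w \in G & B = word_matrix A w] X -> cone_of Q v ->
    cone_of Q (X *m v) /\ expR ((n * m.*2)%:R * (lam - eps)) * enorm v <= enorm (X *m v).
  move=> [w /inG wG ->] Cv; split; last by have := admissible_growth uQ wG Cv; rewrite sz.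
  exact: interior_subset (admissible_interior uQ wG Cv).
have cone_ne : cone_of Q (Q *m const_mx 1).
  have hi i : 0 < (invmx Q *m (Q *m const_mx 1 : 'cV[R]_2)) i 0 by rewrite mulKmx// mxE.
  exact: interior_subset (cone_interior hi).
exists (n * m.*2)%N, G, (cone_of Q) => AGamma.
have sumE : lam + (D - lam) = D by ring.
rewrite /l1 /l2 l1E l2E sumE; split; first by rewrite /m; clear -n_gt0; nia.
split; [|split; [|split; [|split; [|split; [|split]]]]].
- rewrite /h -(fineK hfin) -EFinB -EFinM; rewrite -(fineK hfin) lee_fin in hle.
  rewrite lee_fin; apply: le_trans (_ : (k ^ m.*2)%:R <= _); last by rewrite ler_nat.
  have kE : expR (n%:R * (hh - e1) - ln 4) <= k%:R.
    rewrite expRD expRN lnK ?posrE// ler_pdivrMr// [k%:R * _]mulrC -natrM.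
    by apply: le_trans cardF _; rewrite ler_nat.
  have hn : ln 4 <= n%:R * (2 * e1).
    by rewrite -ler_pdivrMr ?mulr_gt0//; apply/ltW/hn1/ltnW.
  apply: le_trans (_ : expR (n%:R * (hh - e1) - ln 4) ^+ m.*2 <= _); last first.
    by rewrite natrX; apply: lerXn2r; rewrite ?nnegrE ?expR_ge0.
  rewrite -expRM_natl ler_expR mulnC natrM -mulrA ler_wpM2l//.
  have := ler_wpM2l (ler0n R n) hle; move: hn; rewrite /e1 !mulrDr !mulrN; lra.
- split; first exact: cone_of_cone.
  by move=> _ [w /inG wG ->] _ [u Cu <-]; exact: admissible_interior wG Cu.
- split.
    by move=> u w Cu /inG wG; rewrite -(sz w); exact: admissible_growth wG Cu.
  have [ne0 _] := cone_ne.
  exact: (lower_spectral_radius_ge (expR_gt0 _) cone_ne ne0 pres).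
- apply: joint_spectral_radius_le => _ [w /inG[_ _ hw _ _] ->].
  by apply: le_trans (opnorm_le _) _; rewrite -(sz w).
- move=> w /inG[_ _ _ /andP[d1 d2] _]; rewrite -(sz w); split => //.
  exact: lt_le_trans (expR_gt0 _) d1.
- exact: irrG.
- by move=> j /andP[_ jn0] w /inG wG; exact: admissible_infix wG jn0.
Qed.
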